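(* Let $n\ge 1$ and let $\mathcal{K}\subset\mathbb{R}^n$ be a closed convex centrally symmetric body with positive measure, with polar body $\mathcal{K}^o$. Assume that $\Lambda\subset\mathbb{R}^n$ and $0\le\rho<\frac{\pi}{2}$ satisfy $$\Lambda+\rho\,\mathcal{K}^o=\mathbb{R}^n .$$ Then $$\sup_{x\in\mathbb{R}^n}|f(x)|\le\frac{1}{\cos\rho}\,\sup_{\lambda\in\Lambda}|f(\lambda)|\quad\text{for every } f\in B_{\mathcal{K}},$$ and so $\Lambda$ is a sampling set for $B_{\mathcal{K}}$.
   Context: A ''closed convex centrally symmetric body'' is a compact convex set $A\subset\mathbb{R}^n$ with nonempty interior and $A=-A$. The polar body of $\mathcal{K}$ is $\mathcal{K}^o:=\{x\in\mathbb{R}^n: x\cdot t\le 1\text{ for all }t\in\mathcal{K}\}$. For sets, $A+B=\{a+b: a\in A,\ b\in B\}$ and $\rho A=\{\rho a: a\in A\}$. For a compact set $\mathcal{S}\subset\mathbb{R}^n$, the Bernstein space $B_{\mathcal{S}}$ consists of all bounded continuous functions $f:\mathbb{R}^n\to\mathbb{C}$ whose spectrum belongs to $\mathcal{S}$, meaning that $\int_{\mathbb{R}^n}f(x)\hat\varphi(x)\,dx=0$ for every smooth function $\varphi$ whose support belongs to a ball disjoint from $\mathcal{S}$, where $\hat\varphi(x)=\int_{\mathbb{R}^n}e^{-it\cdot x}\varphi(t)\,dt$. A set $\Lambda\subset\mathbb{R}^n$ is a sampling set for $B_{\mathcal{S}}$ if there is a constant $C>0$ such that $\sup_{x\in\mathbb{R}^n}|f(x)|\le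 C\sup_{\lambda\in\Lambda}|f(\lambda)|$ for every $f\in B_{\mathcal{S}}$. *)

(* Defs.v *)
From HB Require Import structures.
From mathcomp Require Import all_boot all_order all_algebra.
From mathcomp Require Import all_classical all_reals all_analysis.
From mathcomp Require Export complex.

Set Implicit Arguments.
Unset Strict Implicit.
Unset Printing Implicit Defensive.

Import Order.TTheory GRing.Theory Num.Def Num.Theory.
Import numFieldNormedType.Exports.

Local Open Scope classical_set_scope.
Local Open Scope ring_scope.
Local Open Scope complex_scope.

Fact rV_display : measure_display. Proof. exact. Qed.

Section rV_measurable.
Variables (R : realType) (n : nat).

Let coord (i : 'I_n) (x : 'rV[R]_n) : measurableTypeR R := x ord0 i.

Let rV_set0 : g_sigma_preimage coord set0.
Proof. exact: sigma_algebra0. Qed.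

Let rV_setC A : g_sigma_preimage coord A -> g_sigma_preimage coord (~` A).
Proof. exact: sigma_algebraC. Qed.

Let rV_bigcup (F : (set 'rV[R]_n)^nat) :
  (forall i, g_sigma_preimage coord (F i)) ->
  g_sigma_preimage coord (\bigcup_i (F i)).
Proof. exact: sigma_algebra_bigcup. Qed.

(* The product sigma-algebra on R^n, as for n.-tuple in the library. *)
HB.instance Definition _ := @isMeasurable.Build rV_display
  'rV[R]_n (g_sigma_preimage coord) rV_set0 rV_setC rV_bigcup.

Lemma measurable_coord (i : 'I_n) : measurable_fun [set: 'rV[R]_n] (coord i).
Proof.
move=> _ Y mY; rewrite setTI; apply: sub_sigma_algebra => /=.
rewrite -bigcup_seq/=; exists i => /=; first by rewrite mem_index_enum.
by exists Y => //; rewrite setTI.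
Qed.

Lemma measurable_fun_coordP d (T : measurableType d) (f : T -> 'rV[R]_n) :
  (forall i, measurable_fun [set: T] (coord i \o f)) ->
  measurable_fun [set: T] f.
Proof.
move=> mf _ Y mY; rewrite setTI.
suff : g_sigma_preimage coord `<=` [set A | measurable (f @^-1` A)] by exact.
apply: smallest_sub.
  split => /=.
  - by rewrite preimage_set0.
  - by move=> A mA; rewrite setTD preimage_setC; exact: measurableC.
  - by move=> F mF; rewrite preimage_bigcup; exact: bigcup_measurable.
move=> A; rewrite -bigcup_seq/= => -[i _ [B mB <-]] /=.
by rewrite setTI -comp_preimage -[X in measurable X]setTI; exact: mf.
Qed.

End rV_measurable.

Section rV_cons.
Variables (R : realType) (n : nat).

Definition rV_cons (p : measurableTypeR R * 'rV[R]_n) : 'rV[R]_n.+1 :=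
  \row_i oapp (fun j => p.2 ord0 j) p.1 (unlift ord0 i).

Lemma measurable_rV_cons : measurable_fun setT rV_cons.
Proof.
apply: measurable_fun_coordP => i.
case: (unliftP ord0 i) => [j|] ->.
- rewrite (_ : _ \o _ = (fun x : 'rV[R]_n => x ord0 j : measurableTypeR R) \o snd).
    by apply: measurableT_comp; [exact: measurable_coord|exact: measurable_snd].
  by apply/funext => p /=; rewrite mxE liftK.
- rewrite (_ : _ \o _ = fst); first exact: measurable_fst.
  by apply/funext => p /=; rewrite mxE unlift_none.
Qed.

Definition rV_uncons (x : 'rV[R]_n.+1) : measurableTypeR R * 'rV[R]_n :=
  (x ord0 ord0, \row_j x ord0 (lift ord0 j)).

Lemma measurable_rV_uncons : measurable_fun setT rV_uncons.
Proof.
apply/measurable_fun_pairP; split; first exact: measurable_coord.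
apply: measurable_fun_coordP => i.
rewrite (_ : _ \o _ =
    fun x : 'rV[R]_n.+1 => x ord0 (lift ord0 i) : measurableTypeR R).
  exact: measurable_coord.
by apply/funext => x /=; rewrite mxE.
Qed.

Lemma rV_consK : cancel rV_cons rV_uncons.
Proof.
case=> a x; rewrite /rV_uncons /rV_cons mxE unlift_none /=; congr pair.
by apply/rowP => j; rewrite !mxE liftK.
Qed.

Variable mu : {sigma_finite_measure set 'rV[R]_n -> \bar R}.

Definition rV_cons_measure : set 'rV[R]_n.+1 -> \bar R :=
  pushforward (lebesgue_measure \x mu)%E rV_cons.

Let rV_cons_measure0 : rV_cons_measure set0 = 0%E.
Proof. by rewrite /rV_cons_measure /pushforward preimage_set0 measure0. Qed.

Let rV_cons_measure_ge0 A : (0 <= rV_cons_measure A)%E.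
Proof. by rewrite /rV_cons_measure /pushforward; exact: measure_ge0. Qed.

Let rV_cons_measure_sigma_additive : semi_sigma_additive rV_cons_measure.
Proof.
have mpre A : measurable A -> measurable (rV_cons @^-1` A).
  by move=> mA; rewrite -[X in measurable X]setTI; exact: measurable_rV_cons.
move=> F mF tF mUF; rewrite /rV_cons_measure /pushforward preimage_bigcup.
apply: measure_semi_sigma_additive.
- by move=> k; exact: mpre.
- apply/trivIsetP => i j _ _ ij; rewrite -preimage_setI.
  by move/trivIsetP : tF => /(_ _ _ I I ij) ->; rewrite preimage_set0.
- by rewrite -preimage_bigcup; exact: mpre.
Qed.

HB.instance Definition _ := isMeasure.Build _ _ _ rV_cons_measure
  rV_cons_measure0 rV_cons_measure_ge0 rV_cons_measure_sigma_additive.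

Let rV_cons_measure_sigma_finite : sigma_finite setT rV_cons_measure.
Proof.
have /sigma_finiteP[F [TF ndF Foo]] := sigma_finiteT (@lebesgue_measure R).
have /sigma_finiteP[G [TG ndG Goo]] := sigma_finiteT mu.
exists (fun k => rV_uncons @^-1` (F k `*` G k)).
  rewrite -preimage_bigcup -(preimage_setT rV_uncons); congr (_ @^-1` _).
  rewrite -setXTT TF TG predeqE => -[x y]; split.
    move=> [/= [k _ Fkx] [l _ Gly]]; exists (maxn k l) => //; split.
    - by move: x Fkx; exact/subsetPset/ndF/leq_maxl.
    - by move: y Gly; exact/subsetPset/ndG/leq_maxr.
  by move=> [k _ []/= ? ?]; split; exists k.
move=> k; have [? ?] := Foo k; have [? ?] := Goo k; split.
  rewrite -[X in measurable X]setTI; apply: measurable_rV_uncons => //.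
  exact: measurableX.
rewrite /rV_cons_measure /pushforward -comp_preimage.
rewrite (_ : _ \o _ = id); last by apply/funext => p /=; rewrite rV_consK.
by rewrite preimage_id product_measure1E// lte_mul_pinfty// ge0_fin_numE.
Qed.

HB.instance Definition _ := Measure_isSigmaFinite.Build _ _ _ rV_cons_measure
  rV_cons_measure_sigma_finite.

End rV_cons.

(* Lebesgue measure on R^n: iterated product of the measure on R. *)
Fixpoint lebesgue_rV (R : realType) (n : nat) :
    {sigma_finite_measure set 'rV[R]_n -> \bar R} :=
  match n with
  | 0 => @dirac _ 'rV[R]_0 0 R
  | m.+1 => rV_cons_measure (lebesgue_rV R m)
  end.

Section bernstein.
Variables (R : realType) (n : nat).
Notation V := 'rV[R]_n.
Implicit Types (K S A Lambda : set V) (f : V -> R[i]) (u : V -> R).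

Definition dot (x t : V) : R := \sum_(i < n) x ord0 i * t ord0 i.

(* The library norm on 'rV is the sup norm; balls below are Euclidean. *)
Definition enorm (x : V) : R := Num.sqrt (dot x x).

Definition eball (c : V) (r : R) : set V := [set t | enorm (t - c) < r].

Definition symmetric_convex_body K :=
  [/\ compact K, convex_set K, interior K !=set0 & [set - x | x in K] = K].

Definition polar K : set V := [set x | forall t, K t -> dot x t <= 1].

Definition minkowski_sum A B : set V := [set a + b | a in A & b in B].

Definition dilate (rho : R) A : set V := [set rho *: a | a in A].

Definition partial (i : 'I_n) u : V -> R := fun x => 'D_(delta_mx ord0 i) u x.

(* C^oo: every iterated partial derivative is continuous and itself admits all
   partial derivatives at every point ('D_v is a junk value otherwise). *)
Definition smooth_real u := forall s : seq 'I_n,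
  let v := foldr partial u s in
  continuous v /\ forall i x, derivable v x (delta_mx ord0 i).

Definition smooth f :=
  smooth_real (fun x => complex.Re (f x)) /\
  smooth_real (fun x => complex.Im (f x)).

Definition csupport f : set V := closure [set t | f t != 0].

Definition integral_rV f : R[i] :=
  (\int[lebesgue_rV R n]_x complex.Re (f x)) +i*
  (\int[lebesgue_rV R n]_x complex.Im (f x)).

Definition expi (y : R) : R[i] := cos y +i* sin y.

Definition fourier f (x : V) : R[i] :=
  integral_rV (fun t => expi (- dot t x) * f t).

Definition spectrum_in S f := forall (phi : V -> R[i]) (c : V) (r : R),
  0 < r -> smooth phi -> csupport phi `<=` eball c r ->
  eball c r `&` S = set0 ->
  integral_rV (fun x => f x * fourier phi x) = 0.

(* R[i]^o carries the topology of the modulus. *)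
Definition bernstein S : set (V -> R[i]) := [set f |
  [/\ continuous (f : V -> R[i]^o),
      exists M : R, forall x, Normc.normc (f x) <= M
    & spectrum_in S f]].

(* Real supremum: equals 0 when A is empty; used only for bounded f. *)
Definition supmod A f : R := sup [set Normc.normc (f x) | x in A].

Definition sampling_set S Lambda := exists C : R, 0 < C /\
  forall f, bernstein S f -> supmod setT f <= C * supmod Lambda f.

End bernstein.

(* Main.v *)
(* For 0 < rho, s < pi/2, the residues of exp(i x z) / ((z - rho) (z + s) sin z) give p, q > 0
   and nonnegative d_k, e_k such that the functional
     g(0)/(rho s) - p g(rho) - q g(-s) - sum_(k >= 1) (-1)^k (d_k g(k pi) + e_k g(-k pi))
   vanishes at g(t) = exp(i x t) for |x| < 1.
   If f has spectrum in K and v lies in the polar body of K (shrunk slightly), the functional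
   annihilates t |-> f(x + t v): multiply f by the Fourier transform m of a bump, so that f m
   is integrable with spectrum near K; the function of x obtained by applying the functional
   to t |-> (f m)(x + t v) has zero Fourier transform, hence vanishes, and m tends to 1.
   Let M = sup |f|. Bounding every term but the first two by M, and computing the sum of the
   d_k + e_k by taking x = 1 in the real part of the functional, one gets
     |f(x)| / (rho s) <= p |f(x + rho v)| + M (1/(rho s) - p cos rho + q (1 - cos s)).
   Choosing v with x + rho v in Lambda, taking the supremum over x and letting s tend to 0,
   where q (1 - cos s) = o(p), yields M cos rho <= sup over Lambda of |f|. *)

Require Import Defs.
From mathcomp Require Import all_boot all_order all_algebra.
From mathcomp Require Import all_classical all_reals all_analysis.
From mathcomp Require Import measurable_realfun.
From mathcomp Require Import ring lra.

Set Implicit Arguments.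
Unset Strict Implicit.
Unset Printing Implicit Defensive.

Import Order.TTheory GRing.Theory Num.Theory.
Import numFieldNormedType.Exports.

Local Open Scope classical_set_scope.
Local Open Scope ring_scope.

(** * Integration on R^n *)

(** The choice s = 0 would give a double pole at 0 and bring in g'(0); a positive [s] leaves point
    values only. The function cos t takes the value (-1)^k at k pi, so bounding the values there by
    [M] costs nothing, and the only loss is q (1 - cos s), from the node -s. No contour integral
    occurs: 1 / ((z - rho) (z + s)) is split into simple fractions, and the two resulting series are
    summed by means of the Dirichlet kernel. Its singularity sits at x = 1, so the identities come
    on |x| < 1 first and reach x = 1 by uniform convergence. The condition |x| < 1 is strict while
    multiplication by m enlarges the spectrum; hence v is tau y with tau < 1 and y bounded by 1 on
    [K], and tau tends to 1 after the bump has shrunk. A vanishing Fourier transform is exploited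
    without an inversion formula: products of powers of cosines converge to Gaussians. Complex
    values are handled through real combinations of Re f and Im f. *)

Section lebesgue_invariance.
Context {R : realType}.
Local Notation mu := (@lebesgue_measure R).

(** A measure that agrees with Lebesgue measure on half-open intervals equals it, so the pushforward
    only has to be evaluated on those. *)
Lemma lebesgue_measure_preimage_shift (v : R) (A : set (measurableTypeR R)) :
  measurable A -> pushforward mu (fun x => x + v) A = mu A.
Proof.
move=> mA; have ms : measurable_fun setT (fun x : measurableTypeR R => x + v : measurableTypeR R).
  exact: measurable_funD.
pose nu := measure_function_pushforward__canonical__measure_function_Measure mu ms.
symmetry; refine (@lebesgue_measure_unique R nu _ A mA) => X [[a b] _ <-] /=.
rewrite /nu /= /pushforward /=.
rewrite (_ : _ @^-1` _ = `]a - v, b - v]%classic); last first.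
  by apply/seteqP; split=> x /=; rewrite !in_itv/= ltrBlDr lerBrDr.
rewrite !lebesgue_measure_itv/= !lte_fin ltrD2r.
by case: ifP => // _; rewrite -!EFinB; congr (_%:E); ring.
Qed.

Lemma lebesgue_measure_preimage_opp (A : set (measurableTypeR R)) :
  measurable A -> pushforward mu (fun x => - x) A = mu A.
Proof.
move=> mA; have ms : measurable_fun setT (fun x : measurableTypeR R => - x : measurableTypeR R).
  exact: measurableT_comp.
pose nu := measure_function_pushforward__canonical__measure_function_Measure mu ms.
symmetry; refine (@lebesgue_measure_unique R nu _ A mA) => X [[a b] _ <-] /=.
rewrite /nu /= /pushforward /=.
rewrite (_ : _ @^-1` _ = `[- b, - a[%classic); last first.
  by apply/seteqP; split=> x /=; rewrite !in_itv/= lerNl ltrNr andbC.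
rewrite !lebesgue_measure_itv/= !lte_fin ltrN2.
by case: ifP => // _; rewrite -!EFinB; congr (_%:E); ring.
Qed.

Lemma integral_lebesgue_shift (v : R) (f : measurableTypeR R -> \bar R) :
  measurable_fun setT f -> (forall x, 0 <= f x)%E ->
  (\int[mu]_x f (x + v)%R = \int[mu]_x f x)%E.
Proof.
move=> mf f0; have ms : measurable_fun setT (fun x : measurableTypeR R => x + v : measurableTypeR R).
  exact: measurable_funD.
have := @ge0_integral_pushforward _ _ _ _ R _ ms mu setT f measurableT mf (fun x _ => f0 x).
rewrite preimage_setT => <-.
pose nu := measure_function_pushforward__canonical__measure_function_Measure mu ms.
apply: (@eq_measure_integral _ _ _ _ mu nu) => A mA _.
exact: lebesgue_measure_preimage_shift.
Qed.

Lemma integral_lebesgue_opp (f : measurableTypeR R -> \bar R) :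
  measurable_fun setT f -> (forall x, 0 <= f x)%E ->
  (\int[mu]_x f (- x)%R = \int[mu]_x f x)%E.
Proof.
move=> mf f0; have ms : measurable_fun setT (fun x : measurableTypeR R => - x : measurableTypeR R).
  exact: measurableT_comp.
have := @ge0_integral_pushforward _ _ _ _ R _ ms mu setT f measurableT mf (fun x _ => f0 x).
rewrite preimage_setT => <-.
pose nu := measure_function_pushforward__canonical__measure_function_Measure mu ms.
apply: (@eq_measure_integral _ _ _ _ mu nu) => A mA _.
exact: lebesgue_measure_preimage_opp.
Qed.

End lebesgue_invariance.

(** Positive and negative parts commute with composition by [s], so the nonnegative case suffices;
    both sides live in the extended reals, hence no integrability is asked. *)
Lemma invariant_integral d (T : measurableType d) (R : realType)
    (mu : {measure set T -> \bar R}) (s : T -> T) :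
  (forall f : T -> \bar R, measurable_fun setT f -> (forall x, 0 <= f x)%E ->
    (\int[mu]_x f (s x) = \int[mu]_x f x)%E) ->
  forall f : T -> \bar R, measurable_fun setT f ->
    (\int[mu]_x f (s x) = \int[mu]_x f x)%E.
Proof.
move=> inv f mf; rewrite [LHS]integralE [RHS]integralE; congr (_ - _)%E.
- rewrite -(inv f^\+%E) //; last exact: measurable_funepos.
  by apply: eq_integral => x _; rewrite !funeposE.
- rewrite -(inv f^\-%E) //; last exact: measurable_funeneg.
  by apply: eq_integral => x _; rewrite !funenegE.
Qed.

Section rV_measurability.
Context {R : realType} {n : nat}.
Local Notation V := 'rV[R]_n.

(** The sigma-algebra is generated by the coordinates and the topology by the sup norm; they meet
    because an open set is the union of the countably many rational cubes that it contains. *)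
Lemma open_measurable_rV (U : set V) : open U -> measurable U.
Proof.
move=> oU.
pose box (p : 'rV[rat]_n * nat) : set V :=
  [set x | forall i, `|x ord0 i - ratr (p.1 ord0 i)| < p.2.+1%:R^-1].
have mbox p : measurable (box p).
  rewrite (_ : box p = \bigcap_(i in [set: 'I_n]) ((fun x : V => x ord0 i : measurableTypeR R) @^-1`
      [set y | `|y - ratr (p.1 ord0 i)| < p.2.+1%:R^-1])); last first.
    apply/seteqP; split=> [x h i _|x h i]; [exact: h|exact: (h i I)].
  apply: fin_bigcap_measurable => // i _.
  rewrite -[X in measurable X]setTI; apply: measurable_coord => //.
  rewrite (_ : [set _ | _] = `](ratr (p.1 ord0 i) - p.2.+1%:R^-1), (ratr (p.1 ord0 i) + p.2.+1%:R^-1)[%classic).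
    exact: measurable_itv.
  by apply/seteqP; split=> y /=; rewrite in_itv/= ltr_distl.
rewrite (_ : U = \bigcup_(p in [set p | box p `<=` U]) box p).
  rewrite bigcup_mkcond; apply: countable_bigcupT_measurable => // p.
  by case: ifPn.
apply/seteqP; split=> [x Ux|x [p pU /pU]//].
have : nbhs x U by rewrite nbhsE /=; exists U.
rewrite -nbhs_ballE => -[e /= e0 xeU].
(* A cube of radius 1/(k+1) around a rational point that is itself within 1/(k+1) of [x] stays in
   the ball of radius [e]. *)
have [k ke] : exists k : nat, k.+1%:R^-1 < e / 2.
  have [k _ /(_ k (leqnn k))] := near_infty_natSinv_lt (PosNum (divr_gt0 e0 (ltr0n R 2))).
  by exists k.
have hq (i : 'I_n) : exists q : rat, `|x ord0 i - ratr q| < k.+1%:R^-1.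
  have : x ord0 i - k.+1%:R^-1 < x ord0 i + k.+1%:R^-1 :> R.
    by rewrite ltrD2l gt0_cp// invr_gt0.
  move=> /rat_in_itvoo[q]; rewrite in_itv/= => /andP[h1 h2]; exists q.
  by move: h1 h2; set K := _^-1 => h1 h2; rewrite ltr_norml; apply/andP; split; lra.
have [q hq'] := choice hq.
exists (\row_i q i, k); last by move=> i /=; rewrite mxE.
move=> y yb; apply: xeU; split => // i j; rewrite (ord1 i).
have := yb j; rewrite /= mxE => h1; have h2 := hq' j.
rewrite /ball/= (_ : x ord0 j - y ord0 j = (x ord0 j - ratr (q j)) - (y ord0 j - ratr (q j))); last by ring.
move: h1 h2 ke; set K := _^-1 => h1 h2 ke.
have := ler_normB (x ord0 j - ratr (q j)) (y ord0 j - ratr (q j)); lra.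
Qed.

Lemma continuous_measurable_rV (f : V -> R) : continuous f -> measurable_fun setT f.
Proof.
move=> /continuousP cf; apply: (measurability _ (RGenOpens.measurableE R)).
move=> _ [_ [a [b ->] <-]]; rewrite setTI; apply: open_measurable_rV.
exact/cf/interval_open.
Qed.

Lemma continuous_coord (i : 'I_n) : continuous (fun x : V => x ord0 i).
Proof. exact: coord_continuous. Qed.

Lemma measurable_rV_shift (v : V) : measurable_fun setT (fun x : V => x + v).
Proof.
apply: measurable_fun_coordP => i.
rewrite (_ : _ \o _ = (fun x : V => (x ord0 i : R) + v ord0 i)); last by apply/funext => x /=; rewrite mxE.
by apply: measurable_funD => //; exact: measurable_coord.
Qed.

End rV_measurability.

Section lebesgue_rV_integral.
Context {R : realType}.

(** Tonelli along the first coordinate; it lets facts about [lebesgue_rV] be proved by induction on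
    the dimension. *)
Lemma ge0_integral_rV_cons n (f : 'rV[R]_n.+1 -> \bar R) :
  measurable_fun setT f -> (forall x, 0 <= f x)%E ->
  (\int[lebesgue_rV R n.+1]_x f x =
   \int[lebesgue_measure]_a \int[lebesgue_rV R n]_y f (rV_cons (a, y)))%E.
Proof.
move=> mf f0.
have -> := @ge0_integral_pushforward _ _ _ _ R _ (@measurable_rV_cons R n)
  (lebesgue_measure \x lebesgue_rV R n)%E setT f measurableT mf (fun x _ => f0 x).
rewrite preimage_setT fubini_tonelli1 //; last by move=> z; exact: f0.
by apply: measurableT_comp => //; exact: measurable_rV_cons.
Qed.

Lemma rV_consD n (a b : R) (x y : 'rV[R]_n) :
  rV_cons (a, x) + rV_cons (b, y) = rV_cons (a + b, x + y).
Proof. by apply/rowP => i; rewrite !mxE; case: unliftP => [j|] _ //=; rewrite mxE. Qed.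

Lemma rV_unconsK n : cancel (@rV_uncons R n) (@rV_cons R n).
Proof.
move=> x; apply/rowP => i; rewrite mxE.
by case: (unliftP ord0 i) => [j|] -> /=; rewrite ?mxE.
Qed.

Lemma ge0_integral_rV_shift n (v : 'rV[R]_n) (f : 'rV[R]_n -> \bar R) :
  measurable_fun setT f -> (forall x, 0 <= f x)%E ->
  (\int[lebesgue_rV R n]_x f (x + v)%R = \int[lebesgue_rV R n]_x f x)%E.
Proof.
elim: n v f => [|n IH] v f mf f0.
  by apply: eq_integral => x _; congr f; apply/rowP => -[].
have mfs : measurable_fun setT (fun x : 'rV[R]_n.+1 => f (x + v)).
  by apply: measurableT_comp => //; exact: measurable_rV_shift.
have mfc : measurable_fun setT (fun p => f (rV_cons p)).
  by apply: measurableT_comp => //; exact: measurable_rV_cons.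
rewrite (ge0_integral_rV_cons mfs (fun x => f0 _)) (ge0_integral_rV_cons mf f0).
rewrite -[v]rV_unconsK /rV_uncons; move: (v ord0 ord0) (\row_j _) => b w.
rewrite -[RHS](integral_lebesgue_shift b); last 2 first.
- by apply: (measurable_fun_fubini_tonelli_F _ mfc) => z; exact: f0.
- by move=> a; apply: integral_ge0.
apply: eq_integral => a _; rewrite -[RHS](IH w) //.
- by apply: eq_integral => y _; rewrite rV_consD.
- exact: measurableT_comp mfc (pair1_measurable _).
Qed.

Lemma integral_rV_shift n (v : 'rV[R]_n) (f : 'rV[R]_n -> \bar R) :
  measurable_fun setT f ->
  (\int[lebesgue_rV R n]_x f (x + v)%R = \int[lebesgue_rV R n]_x f x)%E.
Proof. by apply: invariant_integral => g; exact: ge0_integral_rV_shift. Qed.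

End lebesgue_rV_integral.

(** * Integrals of products over the coordinates *)

Section product_integral.
Context {R : realType}.
Local Notation mu := (@lebesgue_measure R).

Definition rV_tail n (x : 'rV[R]_n.+1) : 'rV[R]_n := \row_j x ord0 (lift ord0 j).

Lemma measurable_rV_tail n : measurable_fun setT (@rV_tail n).
Proof.
apply: measurable_fun_coordP => i.
rewrite (_ : _ \o _ = fun x : 'rV[R]_n.+1 => x ord0 (lift ord0 i) : measurableTypeR R).
  exact: measurable_coord.
by apply/funext => x /=; rewrite mxE.
Qed.

Lemma rV_tail_cons n a (y : 'rV[R]_n) : rV_tail (rV_cons (a, y)) = y.
Proof. by apply/rowP => i; rewrite !mxE liftK. Qed.

Lemma rV_head_cons n a (y : 'rV[R]_n) : rV_cons (a, y) ord0 ord0 = a.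
Proof. by rewrite mxE unlift_none. Qed.

Section head_tail.
Variables (n : nat) (u : measurableTypeR R -> R) (w : 'rV[R]_n -> R).
Hypothesis iu : mu.-integrable setT (EFin \o u).
Hypothesis iw : (lebesgue_rV R n).-integrable setT (EFin \o w).

Let g (x : 'rV[R]_n.+1) := u (x ord0 ord0) * w (rV_tail x).

Let mu_ : measurable_fun setT u.
Proof. by apply/measurable_EFinP; case/integrableP : iu. Qed.

Let mw_ : measurable_fun setT w.
Proof. by apply/measurable_EFinP; case/integrableP : iw. Qed.

Let mg : measurable_fun setT g.
Proof.
apply: measurable_funM.
  by apply: measurableT_comp => //; exact: measurable_coord.
by apply: measurableT_comp => //; exact: measurable_rV_tail.
Qed.

Lemma integrable_rV_mul : (lebesgue_rV R n.+1).-integrable setT (EFin \o g).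
Proof.
apply/integrableP; split; first exact/measurable_EFinP.
rewrite ge0_integral_rV_cons; last 2 first.
- by apply: measurableT_comp => //; exact/measurable_EFinP.
- by move=> x; exact: abse_ge0.
have [_ lu] := integrableP _ _ _ iu; have [_ lw] := integrableP _ _ _ iw.
rewrite (_ : (\int[_]_a _)%E = (\int[mu]_a (`|(u a)%:E| * \int[lebesgue_rV R n]_y `|(w y)%:E|))%E).
  rewrite ge0_integralZr //; last 2 first.
  - by apply: measurableT_comp => //; exact/measurable_EFinP.
  - exact: integral_ge0.
  by apply: lte_mul_pinfty => //; [exact: integral_ge0|rewrite ge0_fin_numE ?integral_ge0].
apply: eq_integral => a _; rewrite -ge0_integralZl //; last first.
  by apply: measurableT_comp => //; exact/measurable_EFinP.
by apply: eq_integral => y _; rewrite /g /= rV_tail_cons rV_head_cons normrM.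
Qed.

Lemma Rintegral_rV_mul :
  (\int[lebesgue_rV R n.+1]_x g x = (\int[mu]_a u a) * \int[lebesgue_rV R n]_y w y)%R.
Proof.
have ig := integrable_rV_mul.
rewrite /Rintegral.
have mc : measurable_fun setT (fun p => (g (rV_cons p))%:E).
  by apply/measurable_EFinP; apply: measurableT_comp => //; exact: measurable_rV_cons.
(* Fubini for signed integrands needs integrability on the product space, pulled back here from [ig]
   along [rV_cons]. *)
have igp : (mu \x lebesgue_rV R n)%E.-integrable setT (EFin \o g \o @rV_cons R n).
  apply/integrableP; split=> //.
  have [_] := integrableP _ _ _ ig; apply: le_lt_trans.
  rewrite [leRHS](@ge0_integral_pushforward _ _ _ _ R _ (@measurable_rV_cons R n)
    (lebesgue_measure \x lebesgue_rV R n)%E setT (fun x => `|(g x)%:E|%E) measurableT) //.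
  by apply: measurableT_comp => //; exact/measurable_EFinP.
have -> : (\int[lebesgue_rV R n.+1]_x (g x)%:E =
    \int[mu \x lebesgue_rV R n]_p (g (rV_cons p))%:E)%E.
  by rewrite (@integral_pushforward _ _ _ _ R _ (@measurable_rV_cons R n)
    (mu \x lebesgue_rV R n)%E setT (EFin \o g)) // ?preimage_setT //; exact/measurable_EFinP.
rewrite -(@integral12_prod_meas1 _ _ _ _ R mu (lebesgue_rV R n) _ igp) /fubini_F.
have fw : (\int[lebesgue_rV R n]_y (w y)%:E \is a fin_num)%E by exact: integrable_fin_num.
have fu : (\int[mu]_y (u y)%:E \is a fin_num)%E by exact: integrable_fin_num.
rewrite -[RHS]fineM // -(fineK fw) -integralZr //; congr fine.
apply: eq_integral => a _; rewrite fineK // -integralZl //.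
by apply: eq_integral => y _; rewrite /= /g rV_tail_cons rV_head_cons.
Qed.

End head_tail.

(** R^0 is a single point carrying a Dirac mass: the base of the inductions on the dimension. *)
Lemma integrable_rV0 (f : 'rV[R]_0 -> R) :
  (lebesgue_rV R 0).-integrable setT (EFin \o f).
Proof.
have -> : EFin \o f = cst (f 0)%:E.
  by apply/funext => x /=; congr (f _)%:E; apply/rowP => -[].
by apply: finite_measure_integrable_cst => //; exact: measurableT.
Qed.

Lemma Rintegral_rV0 (f : 'rV[R]_0 -> R) :
  (\int[lebesgue_rV R 0]_x f x = f 0)%R.
Proof.
have -> : f = cst (f 0).
  by apply/funext => x /=; congr (f _); apply/rowP => -[].
by rewrite Rintegral_cst //= /dirac indicT mulr1.
Qed.

Lemma prod_rV_cons (S : comNzSemiRingType) n (u : 'I_n.+1 -> R -> S) (x : 'rV[R]_n.+1) :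
  \prod_i u i (x ord0 i) =
  u ord0 (x ord0 ord0) * \prod_i u (lift ord0 i) (rV_tail x ord0 i).
Proof. by rewrite big_ord_recl; congr (_ * _); apply: eq_bigr => i _; rewrite mxE. Qed.

Lemma integrable_rV_prod n (u : 'I_n -> R -> R) :
  (forall i, mu.-integrable setT (EFin \o u i)) ->
  (lebesgue_rV R n).-integrable setT (fun x => (\prod_i u i (x ord0 i))%:E).
Proof.
elim: n u => [|n IH] u iu; first exact: integrable_rV0.
have := integrable_rV_mul (iu ord0) (IH _ (fun i => iu (lift ord0 i))).
by apply: eq_integrable => // x _; rewrite /= prod_rV_cons.
Qed.

Lemma Rintegral_rV_prod n (u : 'I_n -> R -> R) :
  (forall i, mu.-integrable setT (EFin \o u i)) ->
  (\int[lebesgue_rV R n]_x (\prod_i u i (x ord0 i)) = \prod_i \int[mu]_t u i t)%R.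
Proof.
elim: n u => [|n IH] u iu; first by rewrite Rintegral_rV0 !big_ord0.
rewrite big_ord_recl -IH => [|i]; last exact: iu.
rewrite -(Rintegral_rV_mul (iu ord0) (integrable_rV_prod (fun i => iu (lift ord0 i)))).
by apply: eq_Rintegral => x _; rewrite prod_rV_cons.
Qed.

End product_integral.

(** * Bounds on sine and cosine *)

Section elementary_bounds.
Context {R : realType}.
Implicit Types x y : R.

Lemma MVT_everywhere (f df : R -> R) (a b : R) : a <= b ->
  (forall x, is_derive x 1 f (df x)) ->
  exists2 c, a <= c <= b & f b - f a = df c * (b - a).
Proof.
move=> ab dfE; have [c] := MVT_segment ab (fun x _ => dfE x)
  (derivable_within_continuous (fun x _ => @ex_derive _ _ _ _ _ _ _ (dfE x))).
by rewrite in_itv/= => cab fE; exists c.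
Qed.

Lemma is_derive_ge0_le (f df : R -> R) (a b : R) : a <= b ->
  (forall x, is_derive x 1 f (df x)) ->
  (forall x, a <= x <= b -> 0 <= df x) -> f a <= f b.
Proof.
move=> ab dfE df0; have [c cab E] := MVT_everywhere ab dfE.
by rewrite -subr_ge0 E mulr_ge0 ?df0 // subr_ge0.
Qed.

Lemma sin_le_id x : 0 <= x -> sin x <= x.
Proof.
move=> x0; rewrite -subr_ge0.
have := @is_derive_ge0_le (fun t => t - sin t) (fun t => 1 - cos t) 0 x x0 _ _.
rewrite sin0 subr0; apply; last by move=> t _; rewrite subr_ge0 cos_le1.
Qed.

Lemma abs_sin_le x : `|sin x| <= `|x|.
Proof.
wlog x0 : x / 0 <= x => [H|].
  have [/H//|x0] := leP 0 x.
  by rewrite -normrN -sinN -[leRHS]normrN; apply: H; rewrite oppr_ge0 ltW.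
rewrite (ger0_norm x0) ler_norml sin_le_id // andbT.
have [x1|x1] := leP x 1; last by rewrite (le_trans _ (sin_geN1 x)) // lerN2 ltW.
have [->|xn0] := eqVneq x 0; first by rewrite sin0 oppr0.
have : 0 < sin x by apply: sin2_gt0; rewrite lt_neqAle eq_sym xn0 x0 /= (le_lt_trans x1)// ltr1n.
by move=> s0; rewrite (le_trans _ (ltW s0)) // oppr_le0.
Qed.

Lemma one_sub_cos x : 1 - cos x = sin (x / 2) ^+ 2 *+ 2.
Proof.
rewrite [in LHS](_ : x = (x / 2) *+ 2); last by rewrite mulr2n -splitr.
by rewrite cos_mulr2n; have := cos2Dsin2 (x / 2); lra.
Qed.

Lemma cos_ge x : 1 - x ^+ 2 / 2 <= cos x.
Proof.
have h : sin (x / 2) ^+ 2 <= (x / 2) ^+ 2.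
  by rewrite -[leLHS]real_normK ?num_real // -[leRHS]real_normK ?num_real // lerXn2r ?nnegrE ?abs_sin_le.
by have := one_sub_cos x; rewrite mulr2n; lra.
Qed.

Lemma sin_ge x : 0 <= x -> x - x ^+ 3 / 6 <= sin x.
Proof.
move=> x0; rewrite -subr_ge0.
have := @is_derive_ge0_le (fun t => sin t - (t - t ^+ 3 / 6))
  (fun t => cos t - (1 - t ^+ 2 / 2)) 0 x x0 _ _.
rewrite sin0 expr0n /= mul0r !subr0; apply; last by move=> t _; rewrite subr_ge0 cos_ge.
by move=> t; apply: is_derive_eq => /=; rewrite /GRing.scale/=; lra.
Qed.

(** By the half-angle formula it is enough to square y - y^3/6 <= sin y at y = |x|/2 and to drop the
    term y^6/36. *)
Lemma cos_le x : cos x <= 1 - x ^+ 2 / 2 + x ^+ 4 / 24.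
Proof.
pose y := `|x / 2|.
have y0 : 0 <= y by exact: normr_ge0.
have h : y ^+ 2 - y ^+ 4 / 3 <= sin (x / 2) ^+ 2.
  have -> : sin (x / 2) ^+ 2 = sin y ^+ 2.
    rewrite /y; have [x0|x0] := leP 0 (x / 2); first by rewrite ger0_norm.
    by rewrite ltr0_norm // sinN sqrrN.
  (* Squaring needs y - y^3/6 >= 0; for y^2 > 3 the left side is nonpositive anyway. *)
  have [y3|y3] := leP (y ^+ 2) 3.
    have s1 := sin_ge y0.
    have y6 : 0 <= y - y ^+ 3 / 6.
      by rewrite (_ : _ - _ = y * (1 - y ^+ 2 / 6)) ?mulr_ge0 //; [lra|ring].
    apply: le_trans (_ : (y - y ^+ 3 / 6) ^+ 2 <= _).
      rewrite (_ : (_ - _) ^+ 2 = y ^+ 2 - y ^+ 4 / 3 + y ^+ 6 / 36); last by field.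
      by rewrite lerDl divr_ge0 // exprn_ge0.
    by rewrite lerXn2r // nnegrE (le_trans y6).
  apply: le_trans (sqr_ge0 _).
  rewrite (_ : _ - _ = y ^+ 2 * (1 - y ^+ 2 / 3)); last by field.
  by rewrite mulr_ge0_le0 ?sqr_ge0 //; lra.
have y2 : y ^+ 2 = x ^+ 2 / 4 by rewrite /y real_normK ?num_real // expr_div_n; congr (_ / _); ring.
have y4 : y ^+ 4 = x ^+ 4 / 16.
  by rewrite (exprM y 2 2) y2; field.
by have := one_sub_cos x; rewrite mulr2n; rewrite y2 y4 in h; lra.
Qed.

(** With y = x^2/2, both functions lie between 1 - y and 1 - y + y^2. *)
Lemma cos_expR_bound x : `|cos x - expR (- (x ^+ 2 / 2))| <= (x ^+ 2 / 2) ^+ 2.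
Proof.
set y := x ^+ 2 / 2; have y0 : 0 <= y by rewrite divr_ge0 ?sqr_ge0.
have e1 : 1 - y <= expR (- y) by have := expR_ge1Dx (- y); lra.
have e2 : expR (- y) <= 1 - y + y ^+ 2.
  rewrite expRN.
  have y1 : 0 < 1 + y by lra.
  have : (expR y)^-1 <= (1 + y)^-1 by rewrite lef_pV2 ?posrE ?expR_gt0 ?expR_ge1Dx.
  move=> h; apply: (le_trans h); rewrite -[leLHS]div1r ler_pdivrMr //.
  rewrite (_ : (_ * _) = 1 + y ^+ 3); last by ring.
  by rewrite lerDl exprn_ge0.
have := cos_ge x; have := cos_le x.
rewrite (_ : x ^+ 4 / 24 = y ^+ 2 / 6); last by rewrite /y; field.
rewrite -/y => c2 c1; have := sqr_ge0 y.
by rewrite ler_norml => ?; apply/andP; split; lra.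
Qed.

Lemma distr_exp_le (a b : R) N : `|a| <= 1 -> `|b| <= 1 ->
  `|a ^+ N - b ^+ N| <= `|a - b| *+ N.
Proof.
move=> a1 b1; rewrite subrXX normrM mulrC -mulr_natl ler_wpM2r ?normr_ge0 //.
apply: le_trans (ler_norm_sum _ _ _) _.
rewrite -[leRHS](_ : \sum_(i < N) 1 = _); last by rewrite big_const_ord iter_addr_0.
by apply: ler_sum => i _; rewrite normrM !normrX mulr_ile1 ?exprn_ile1.
Qed.

(** A central limit theorem by hand: replacing each of the N + 1 factors by the matching exponential
    costs at most (s t^2 / (N+1))^2, so the total error is O(1/N). This makes Gaussians limits of
    trigonometric polynomials. *)
Lemma cvg_cos_exp_gauss (s t : R) : 0 <= s ->
  cos (Num.sqrt (2 * s / N.+1%:R) * t) ^+ N.+1 @[N --> \oo] --> expR (- (s * t ^+ 2)).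
Proof.
move=> s0.
have th2 N : (Num.sqrt (2 * s / N.+1%:R) * t) ^+ 2 / 2 = s * t ^+ 2 / N.+1%:R :> R.
  rewrite exprMn sqr_sqrtr; first by field; rewrite ?pnatr_eq0.
  by rewrite divr_ge0 ?mulr_ge0.
have bnd N : `|cos (Num.sqrt (2 * s / N.+1%:R) * t) ^+ N.+1 - expR (- (s * t ^+ 2))|
    <= (s * t ^+ 2) ^+ 2 * N.+1%:R^-1.
  have -> : expR (- (s * t ^+ 2)) = expR (- (s * t ^+ 2 / N.+1%:R)) ^+ N.+1.
    by rewrite -expRM_natl; congr expR; rewrite mulrN [_%:R * _]mulrC divfK ?pnatr_eq0.
  apply: le_trans (distr_exp_le _ _ _) _.
  - exact: cos_max.
  - rewrite ger0_norm ?expR_ge0 // -expR0 ler_expR oppr_le0 divr_ge0 //.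
    by rewrite mulr_ge0 ?sqr_ge0.
  have := cos_expR_bound (Num.sqrt (2 * s / N.+1%:R) * t); rewrite th2 => h.
  rewrite -[leLHS]mulr_natl; apply: le_trans (ler_wpM2l _ h) _ => //.
  rewrite le_eqVlt; apply/orP; left; apply/eqP.
  have : (N.+1%:R : R) != 0 by rewrite pnatr_eq0.
  by set K := _%:R => K0; field.
apply/cvgrPdist_le => /= e e0.
have c0 : (s * t ^+ 2) ^+ 2 * N.+1%:R^-1 @[N --> \oo] --> (0 : R).
  by rewrite -[X in _ --> X](mulr0 ((s * t ^+ 2) ^+ 2)); apply: cvgM; [exact: cvg_cst|exact: cvg_harmonic].
have /cvgrPdist_le/(_ e e0) := c0.
apply: filterS => N; rewrite sub0r normrN => h.
by rewrite distrC (le_trans (bnd N)) // (le_trans _ h) // ler_norm.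
Qed.

End elementary_bounds.

(** * Fourier uniqueness *)

Section integral_lemmas.
Context d (T : measurableType d) (R : realType) (mu : {measure set T -> \bar R}).
Implicit Types (u p : T -> R).

Lemma integrable_measurable u : mu.-integrable setT (EFin \o u) -> measurable_fun setT u.
Proof. by case/integrableP => /measurable_EFinP. Qed.

Lemma le_integrable_real u p : measurable_fun setT u -> (forall x, `|u x| <= p x) ->
  mu.-integrable setT (EFin \o p) -> mu.-integrable setT (EFin \o u).
Proof.
move=> mu_ up; apply: le_integrable => //; first exact/measurable_EFinP.
by move=> x _ /=; rewrite lee_fin (le_trans (up x)) // ler_norm.
Qed.

Lemma integrable_mul_bounded (C : R) u p : mu.-integrable setT (EFin \o u) ->
  measurable_fun setT p -> (forall x, `|p x| <= C) ->
  mu.-integrable setT (EFin \o (fun x => u x * p x)).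
Proof.
move=> iu mp pC; have mu_ := integrable_measurable iu.
have iC : mu.-integrable setT (EFin \o (fun x => C * `|u x|)).
  have := integrableZl measurableT C (integrable_norm iu).
  by apply: eq_integrable => // x _ /=; rewrite EFinM.
apply: le_integrable_real iC; first exact: measurable_funM.
by move=> x; rewrite normrM mulrC ler_wpM2r.
Qed.

Lemma integrable_realD u p : mu.-integrable setT (EFin \o u) ->
  mu.-integrable setT (EFin \o p) -> mu.-integrable setT (EFin \o (fun x => u x + p x)).
Proof. by move=> iu ip; have := integrableD measurableT iu ip; apply: eq_integrable. Qed.

Lemma integrable_realB u p : mu.-integrable setT (EFin \o u) ->
  mu.-integrable setT (EFin \o p) -> mu.-integrable setT (EFin \o (fun x => u x - p x)).
Proof. by move=> iu ip; have := integrableB measurableT iu ip; apply: eq_integrable. Qed.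

Lemma integrable_realZl (c : R) u : mu.-integrable setT (EFin \o u) ->
  mu.-integrable setT (EFin \o (fun x => c * u x)).
Proof. by move=> iu; have := integrableZl measurableT c iu; apply: eq_integrable. Qed.

Lemma Rintegral_dominated (f_ : nat -> T -> R) (f g : T -> R) :
  (forall k, measurable_fun setT (f_ k)) -> measurable_fun setT f ->
  (forall x, f_ ^~ x @ \oo --> f x) ->
  mu.-integrable setT (EFin \o g) -> (forall k x, `|f_ k x| <= g x) ->
  (\int[mu]_x f_ k x)%R @[k --> \oo] --> (\int[mu]_x f x)%R.
Proof.
move=> mf_ mf f_f ig f_g.
have f_fE x : (f_ k x)%:E @[k --> \oo] --> (f x)%:E.
  by apply: cvg_EFin; [exact: nearW|exact: f_f].
have [ifl _ H] := @dominated_convergence _ _ R mu setT measurableT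
  (fun k => EFin \o f_ k) (EFin \o f) (EFin \o g)
  (fun k => (measurable_EFinP _ _).2 (mf_ k)) ((measurable_EFinP _ _).2 mf)
  (aeW mu (fun x _ => f_fE x)) ig
  (aeW mu (fun x k _ => f_g k x)).
have fin := integrable_fin_num measurableT ifl.
apply: fine_cvg; rewrite /Rintegral fineK //.
Qed.

End integral_lemmas.
Arguments integrable_mul_bounded {d T R mu} C {u p}.

Section continuity_of_real_functions.
Context {T : topologicalType} {R : realType}.
Implicit Types f g : T -> R.

Lemma cst_continuousT (c : R) : continuous (fun _ : T => c).
Proof. by move=> x; exact: cvg_cst. Qed.

Lemma continuousTD f g : continuous f -> continuous g -> continuous (fun x => f x + g x).
Proof. by move=> cf cg x; apply: cvgD; [exact: cf|exact: cg]. Qed.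

Lemma continuousTB f g : continuous f -> continuous g -> continuous (fun x => f x - g x).
Proof. by move=> cf cg x; apply: cvgB; [exact: cf|exact: cg]. Qed.

Lemma continuousTN f : continuous f -> continuous (fun x => - f x).
Proof. by move=> cf x; apply: cvgN; exact: cf. Qed.

Lemma continuousTM f g : continuous f -> continuous g -> continuous (fun x => f x * g x).
Proof. by move=> cf cg x; apply: cvgM; [exact: cf|exact: cg]. Qed.

Lemma continuousT_comp f (h : R -> R) :
  continuous f -> continuous h -> continuous (fun x => h (f x)).
Proof. by move=> cf ch x; apply: continuous_comp; [exact: cf|exact: ch]. Qed.

Lemma continuousT_sum I (r : seq I) (F : I -> T -> R) : (forall i, continuous (F i)) ->
  continuous (fun x => \sum_(i <- r) F i x).
Proof.
move=> cF; elim: r => [|i r IH].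
  by under eq_fun do rewrite big_nil; exact: cst_continuousT.
by under eq_fun do rewrite big_cons; apply: continuousTD.
Qed.

Lemma continuousT_prod I (r : seq I) (F : I -> T -> R) : (forall i, continuous (F i)) ->
  continuous (fun x => \prod_(i <- r) F i x).
Proof.
move=> cF; elim: r => [|i r IH].
  by under eq_fun do rewrite big_nil; exact: cst_continuousT.
by under eq_fun do rewrite big_cons; apply: continuousTM.
Qed.

End continuity_of_real_functions.

Section euclidean_continuity.
Context {R : realType} {n : nat}.
Local Notation V := 'rV[R]_n.

Lemma continuous_dot (a : V) : continuous (dot a).
Proof.
apply: continuousT_sum => i; apply: continuousTM; first exact: cst_continuousT.
exact: continuous_coord.
Qed.

Lemma continuous_cos_dot (a : V) (c : R) : continuous (fun x : V => cos (dot a x + c)).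
Proof.
apply: continuousT_comp; last exact: continuous_cos.
by apply: continuousTD; [exact: continuous_dot|exact: cst_continuousT].
Qed.

Lemma continuous_prod_coord (u : 'I_n -> R -> R) : (forall i, continuous (u i)) ->
  continuous (fun x : V => \prod_i u i (x ord0 i)).
Proof.
move=> cu; apply: continuousT_prod => i.
by apply: continuousT_comp; [exact: continuous_coord|exact: cu].
Qed.

End euclidean_continuity.

Section fourier_uniqueness.
Context {R : realType} {n : nat}.
Local Notation V := 'rV[R]_n.
Local Notation mu := (lebesgue_rV R n).
Variable u : V -> R.
Hypotheses (cu : continuous u) (iu : mu.-integrable setT (EFin \o u)).
Hypothesis u_orth : forall a c, (\int[mu]_x (u x * cos (dot a x + c)) = 0)%R.

(** Multipliers under which the orthogonality of [u] to all cosines survives. Demanding every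
    frequency and phase makes the class stable under multiplication by a cosine; the bound 1 feeds
    dominated convergence. *)
Let test (p : V -> R) := [/\ continuous p, (forall x, `|p x| <= 1) &
  forall a c, (\int[mu]_x (u x * p x * cos (dot a x + c)) = 0)%R].

Let test1 : test (cst 1).
Proof.
split=> [|x|a c]; [exact: cst_continuous|by rewrite normr1|].
by rewrite -[RHS](u_orth a c); apply: eq_Rintegral => x _; rewrite mulr1.
Qed.

Let test_integrable p : test p -> mu.-integrable setT (EFin \o (fun x => u x * p x)).
Proof.
case=> cp p1 _; apply: (integrable_mul_bounded 1) => //.
exact: continuous_measurable_rV.
Qed.

(** The product of two cosines is half the sum of cosines with frequencies b + a and b - a. *)
Let testM p b e : test p -> test (fun x => p x * cos (dot b x + e)).
Proof.
move=> tp; have ip := test_integrable tp; case: tp => cp p1 op; split.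
- by apply: continuousTM => //; exact: continuous_cos_dot.
- by move=> x; rewrite normrM mulr_ile1 ?cos_max.
move=> a c.
have ic a' c' : mu.-integrable setT (EFin \o (fun x => u x * p x * cos (dot a' x + c'))).
  apply: (integrable_mul_bounded 1) => // [|x]; last exact: cos_max.
  by apply: continuous_measurable_rV; exact: continuous_cos_dot.
rewrite (@eq_Rintegral _ _ _ mu setT (fun x => 2^-1 * (u x * p x * cos (dot (b + a) x + (e + c)) +
    u x * p x * cos (dot (b - a) x + (e - c))))).
  rewrite RintegralZl //; last exact: integrable_realD.
  by rewrite RintegralD // !op addr0 mulr0.
move=> x _.
have -> : dot (b + a) x + (e + c) = (dot b x + e) + (dot a x + c).
  by rewrite /dot (eq_bigr (fun i => b ord0 i * x ord0 i + a ord0 i * x ord0 i)) =>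
    [|i _]; rewrite ?big_split /= ?mxE; ring.
have -> : dot (b - a) x + (e - c) = (dot b x + e) - (dot a x + c).
  by rewrite /dot (eq_bigr (fun i => b ord0 i * x ord0 i - a ord0 i * x ord0 i)) =>
    [|i _]; rewrite ?sumrB /= ?mxE; ring.
by move: (dot b x + e) (dot a x + c) => A C; rewrite cosD cosB; field.
Qed.

Let testX p b e N : test p -> test (fun x => p x * cos (dot b x + e) ^+ N).
Proof.
move=> tp; elim: N => [|N IH].
  by rewrite (_ : (fun _ => _) = p) //; apply/funext => x; rewrite mulr1.
rewrite (_ : (fun _ => _) = (fun x => p x * cos (dot b x + e) ^+ N * cos (dot b x + e))).
  exact: testM.
by apply/funext => x; rewrite exprSr mulrA.
Qed.

Let test_prod (theta : R) (z : V) N :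
  test (fun x => \prod_i cos (theta * (x ord0 i - z ord0 i)) ^+ N).
Proof.
elim: (index_enum _) => [|i r IH].
  by rewrite (_ : (fun _ => _) = cst 1) //; apply/funext => x; rewrite big_nil.
rewrite (_ : (fun _ => _) = (fun x : V => (\prod_(i <- r) cos (theta * (x ord0 i - z ord0 i)) ^+ N) *
  cos (dot (theta *: delta_mx ord0 i : V) x + (- (theta * z ord0 i))) ^+ N)).
  exact: testX.
apply/funext => x; rewrite big_cons mulrC; congr (_ * cos _ ^+ _).
rewrite /dot (bigD1 i) //= big1 => [|j ji]; first by rewrite !mxE !eqxx /= mulr1 addr0; ring.
by rewrite !mxE (negbTE ji) andbF mulr0 mul0r.
Qed.

Let gauss (s : R) (z : V) (x : V) := \prod_(i < n) expR (- (s * (x ord0 i - z ord0 i) ^+ 2)).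

Let continuous_gauss s z : continuous (gauss s z).
Proof.
apply: (continuous_prod_coord (u := fun i t => expR (- (s * (t - z ord0 i) ^+ 2)))) => i.
apply: continuousT_comp; last exact: continuous_expR.
apply: continuousTN; apply: continuousTM; first exact: cst_continuousT.
apply: (@continuousT_comp _ _ (fun t => t - z ord0 i) (fun t => t ^+ 2)); last exact: exprn_continuous.
by apply: continuousTB; [move=> t; exact: cvg_id|exact: cst_continuousT].
Qed.

(** Products of powers of cosines in the coordinates are admissible multipliers and tend to the
    Gaussian; [|u|] dominates. *)
Let integral_gauss s z : 0 <= s -> (\int[mu]_x (u x * gauss s z x) = 0)%R.
Proof.
move=> s0.
have cg := @continuous_gauss s z.
pose f_ N x := u x * \prod_i cos (Num.sqrt (2 * s / N.+1%:R) * (x ord0 i - z ord0 i)) ^+ N.+1.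
have : (\int[mu]_x f_ N x)%R @[N --> \oo] --> (\int[mu]_x (u x * gauss s z x))%R.
  apply: (@Rintegral_dominated _ _ _ _ _ _ (fun x => `|u x|)).
  - move=> k; have [ct _ _] := test_prod (Num.sqrt (2 * s / k.+1%:R)) z k.+1.
    by apply: measurable_funM; apply: continuous_measurable_rV.
  - by apply: measurable_funM; apply: continuous_measurable_rV.
  - move=> x; apply: cvgM; first exact: cvg_cst.
    rewrite /gauss; elim: (index_enum _) => [|i r IH].
      by rewrite big_nil; under eq_fun do rewrite big_nil; exact: cvg_cst.
    rewrite big_cons; under eq_fun do rewrite big_cons.
    by apply: cvgM IH; exact: cvg_cos_exp_gauss.
  - exact: integrable_norm.
  - move=> k x; have [_ t1 _] := test_prod (Num.sqrt (2 * s / k.+1%:R)) z k.+1.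
    by rewrite normrM -[leRHS]mulr1 ler_wpM2l.
rewrite (_ : (fun _ => _) = cst 0); first by move=> h; exact: (cvg_unique _ h (cvg_cst _)).
(* Frequency 0 and phase 0 turn the extra cosine into the constant 1. *)
apply/funext => k; have [_ _ /(_ 0 0)] := test_prod (Num.sqrt (2 * s / k.+1%:R)) z k.+1.
move=> <-; apply: eq_Rintegral => x _; rewrite /f_.
rewrite (_ : cos _ = 1) ?mulr1 //.
by rewrite addr0 /dot big1 ?cos0 // => i _; rewrite mxE mul0r.
Qed.

(* The integral of u against exp(s (3 delta^2 / 4 - |x - z|^2)) vanishes for every s, but
   it would blow up as s grows if u were positive near z. *)
Lemma fourier_uniqueness_le0 (z : V) : u z <= 0.
Proof.
rewrite leNgt; apply/negP => uz.
have : \forall x \near z, u z / 2 < u x.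
  have /cvgrPdist_lt/(_ (u z / 2)) := @cu z.
  rewrite divr_gt0 // => /(_ isT); apply: filterS => x.
  by rewrite ltr_norml => /andP[_ h]; lra.
move=> /nbhs_ballP[dl /= dl0 Hdl].
pose r := dl / n.+2%:R.
have n2 : (n.+2%:R : R) != 0 by rewrite pnatr_eq0.
have r0 : 0 < r by rewrite divr_gt0.
pose q (x : V) := \sum_(i < n) (x ord0 i - z ord0 i) ^+ 2.
have gaussE s x : gauss s z x = expR (- (s * q x)).
  by rewrite /gauss /q mulr_sumr -sumrN expR_sum.
pose B (x : V) := \prod_(i < n) \1_(`[(z ord0 i - r), (z ord0 i + r)]%classic) (x ord0 i) : R.
have iI i : (@lebesgue_measure R).-integrable setT
    (EFin \o \1_(`[(z ord0 i - r), (z ord0 i + r)]%classic)).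
  exact: integrable_indic_itv.
have iB : mu.-integrable setT (EFin \o B) by exact: (integrable_rV_prod iI).
have vB : 0 < (\int[mu]_x B x)%R.
  rewrite (Rintegral_rV_prod iI) prodr_gt0 // => i _.
  rewrite /Rintegral integral_indic ?setIT //.
  rewrite [X in fine X](lebesgue_measure_itv `[(z ord0 i - r), (z ord0 i + r)]).
  rewrite /= lte_fin ifT; last lra.
  by rewrite -EFinB /=; lra.
have B01 x : B x = 0 \/ (B x = 1 /\ forall i, `|x ord0 i - z ord0 i| <= r).
  have [/forallP h|/forallPn[i hi]] := boolP [forall i, `|x ord0 i - z ord0 i| <= r].
    right; split => //; rewrite /B big1 // => i _; rewrite indicE mem_set //=.
    by rewrite in_itv/= -ler_distl.
  left; apply/eqP; rewrite prodf_seq_eq0; apply/hasP; exists i; first exact: mem_index_enum.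
  by rewrite /= indicE memNset //= in_itv/= -ler_distl; exact/negP.
have nr2 : r ^+ 2 *+ n <= dl ^+ 2 / 2.
  rewrite -mulr_natl /r expr_div_n mulrA ler_pdivrMr ?exprn_gt0 //.
  rewrite (_ : _ * n.+2%:R ^+ 2 = n.+2%:R ^+ 2 / 2 * dl ^+ 2); last by ring.
  rewrite ler_wpM2r ?sqr_ge0 // ler_pdivlMr // -natrX -natrM ler_nat -mulnn.
  by rewrite leq_mul // ltnW // ltnW.
(* The Gaussian is multiplied by E = exp(3 k dl^2 / 4). On the cube the product is at least exp(k
   dl^2 / 4); wherever u < 0, some coordinate is at distance at least [dl], the product is at most 1
   and the integrand is at least -|u|. The integral itself is 0. *)
have key (k : nat) : u z / 2 * expR (k%:R * (dl ^+ 2 / 4)) * (\int[mu]_x B x)%R <= (\int[mu]_x `|u x|)%R.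
  set E := expR (k%:R * (3 * dl ^+ 2 / 4)).
  have E0 : 0 <= E by exact: expR_ge0.
  have ig : mu.-integrable setT (EFin \o (fun x => u x * gauss k%:R z x)).
    apply: (integrable_mul_bounded 1) => // [|x].
      exact: continuous_measurable_rV.
    rewrite gaussE ger0_norm ?expR_ge0 // -expR0 ler_expR oppr_le0 mulr_ge0 //.
    by apply: sumr_ge0 => i _; exact: sqr_ge0.
  have : (\int[mu]_x (u z / 2 * expR (k%:R * (dl ^+ 2 / 4)) * B x - `|u x|) <=
      \int[mu]_x (E * (u x * gauss k%:R z x)))%R.
    apply: le_Rintegral => //.
    - by apply: integrable_realB; [exact: integrable_realZl|exact: integrable_norm].
    - exact: integrable_realZl.
    move=> x _; rewrite (_ : E * _ = u x * expR (k%:R * (3 * dl ^+ 2 / 4) - k%:R * q x)); last first.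
      by rewrite /E gaussE expRD; ring.
    have q0 : 0 <= q x by apply: sumr_ge0 => i _; exact: sqr_ge0.
    have [Bx|[Bx hB]] := B01 x; last first.
      have qx : q x <= dl ^+ 2 / 2.
        apply: le_trans nr2; rewrite -[leRHS](_ : \sum_(i < n) r ^+ 2 = _); last first.
          by rewrite big_const_ord iter_addr_0.
        apply: ler_sum => i _; rewrite -[leLHS]real_normK ?num_real //.
        by rewrite lerXn2r ?nnegrE ?normr_ge0 ?(ltW r0) ?hB.
      have ux : u z / 2 < u x.
        apply: Hdl; split => // i j; rewrite (ord1 i) /ball/= distrC.
        apply: (le_lt_trans (hB j)); rewrite /r ltr_pdivrMr // ltr_pMr //.
        by rewrite ltr1n.
      rewrite Bx mulr1; apply: le_trans (_ : u z / 2 * expR (k%:R * (dl ^+ 2 / 4)) <= _).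
        by rewrite gerBl.
      apply: ler_pM; rewrite ?expR_ge0 //; [lra|exact: ltW|].
      rewrite ler_expR -mulrBr ler_wpM2l //; lra.
    rewrite Bx mulr0 sub0r.
    have [ux|ux] := leP 0 (u x).
      by apply: (@le_trans _ _ 0); [rewrite oppr_le0|rewrite mulr_ge0 ?expR_ge0].
    rewrite ltr0_norm // opprK -[leLHS]mulr1 ler_wnM2l ?(ltW ux) //.
    rewrite -[leRHS]expR0 ler_expR -mulrBr mulr_ge0_le0 //.
    suff : dl ^+ 2 <= q x by have := sqr_ge0 dl; lra.
    have [i hi] : exists i, dl <= `|x ord0 i - z ord0 i|.
      apply: contrapT => /forallNP h.
      suff : u z / 2 < u x by lra.
      apply: Hdl; split => // i j; rewrite (ord1 i) /ball/= distrC ltNge.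
      exact/negP/h.
    rewrite /q (bigD1 i) //= (le_trans (y := (x ord0 i - z ord0 i) ^+ 2)) //.
      by rewrite -[leRHS]real_normK ?num_real // lerXn2r ?nnegrE // ltW.
    by rewrite lerDl; apply: sumr_ge0 => j _; exact: sqr_ge0.
  rewrite RintegralB //; [|exact: integrable_realZl|exact: integrable_norm].
  rewrite !RintegralZl // integral_gauss // mulr0; lra.
set I := (\int[mu]_x B x)%R in vB key; set J := (\int[mu]_x _)%R in key.
(* Since expR t >= 1 + t, the left side of [key] is at least [c * k], which exceeds [J] for large
   [k]. *)
pose c := u z / 2 * (dl ^+ 2 / 4) * I.
have c0 : 0 < c by rewrite !mulr_gt0 // divr_gt0 // exprn_gt0.
have J0 : 0 <= J by apply: Rintegral_ge0.
have := archi_boundP (divr_ge0 J0 (ltW c0)).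
set k := Num.bound _; rewrite ltNge => /negP; apply.
rewrite ler_pdivlMr // (le_trans _ (key k)) // /c.
rewrite [leLHS](_ : _ = u z / 2 * I * (k%:R * (dl ^+ 2 / 4))); last by ring.
rewrite [leRHS]mulrAC ler_wpM2l ?mulr_ge0 ?(ltW vB) //; first lra.
by have := expR_ge1Dx (k%:R * (dl ^+ 2 / 4)); lra.
Qed.

End fourier_uniqueness.

(** The hypotheses are invariant under a change of sign of [u], so the one-sided bound applies
    twice. *)
Lemma fourier_uniqueness (R : realType) n (u : 'rV[R]_n -> R) :
  continuous u -> (lebesgue_rV R n).-integrable setT (EFin \o u) ->
  (forall a c, (\int[lebesgue_rV R n]_x (u x * cos (dot a x + c)) = 0)%R) ->
  forall x, u x = 0.
Proof.
move=> cu iu ou x; apply/eqP; rewrite eq_le (fourier_uniqueness_le0 cu iu ou) /=.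
rewrite -oppr_le0; apply: (@fourier_uniqueness_le0 _ _ (fun x => - u x)).
- exact: continuousTN.
- by have := integrableN iu; apply: eq_integrable.
move=> a c; rewrite -[RHS]oppr0 -(ou a c) -mulN1r -RintegralZl //.
  by apply: eq_Rintegral => y _; rewrite mulNr mulN1r.
apply: (integrable_mul_bounded 1) => // [|y]; last exact: cos_max.
by apply: continuous_measurable_rV; exact: continuous_cos_dot.
Qed.

(** * Partial fractions *)

Section limits.
Context {R : realType}.

Lemma cvg_seq_le (u : nat -> R) (l M : R) :
  u @ \oo --> l -> (forall k, u k <= M) -> l <= M.
Proof.
move=> ul uM; rewrite leNgt; apply/negP => Ml.
have /cvgrPdist_lt/(_ (l - M)) := ul; rewrite subr_gt0 => /(_ Ml)[k _ /(_ k (leqnn k))] /=.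
by have := uM k; have := ler_norm (l - u k); lra.
Qed.

Lemma cvg_squeeze0 (u v : nat -> R) : (forall k, `|u k| <= v k) ->
  v @ \oo --> 0 -> u @ \oo --> 0.
Proof.
move=> uv v0; apply/cvgrPdist_le => /= e e0.
have /cvgrPdist_le/(_ e e0) := v0; apply: filterS => k /=.
by rewrite !sub0r !normrN => h; rewrite (le_trans (uv k)) // (le_trans _ h) // ler_norm.
Qed.

Lemma series_le_lim (d : nat -> R) (l : R) : (forall j, 0 <= d j) ->
  series d @ \oo --> l -> forall k, series d k <= l.
Proof.
move=> d0 dl k; rewrite -(cvg_lim _ dl) //; apply: nondecreasing_cvgn_le; last exact: cvgP dl.
by apply/nondecreasing_seqP => m; rewrite seriesEnat /= big_nat_recr //= lerDl.
Qed.

Lemma dominated_series_cvg (v d : nat -> R) : (forall j, `|v j| <= d j) ->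
  cvgn (series d) -> cvgn (series v).
Proof.
move=> vd cd; apply: normed_cvg; apply: (series_le_cvg _ _ vd cd) => j; first exact: normr_ge0.
exact: le_trans (normr_ge0 _) (vd j).
Qed.

(** The tails are bounded by those of [d] uniformly in [x], and this bound survives the passage to 1
    along 1 - 1/(m+1). It carries identities valid on [0, 1) to the endpoint. *)
Lemma series_cvg_at1 (v : nat -> R -> R) (d : nat -> R) (Phi : R -> R) :
  (forall j, continuous (v j)) -> continuous Phi ->
  (forall j x, `|v j x| <= d j) -> cvgn (series d) ->
  (forall x, 0 <= x < 1 -> series (v ^~ x) @ \oo --> Phi x) ->
  series (v ^~ 1) @ \oo --> Phi 1.
Proof.
move=> cv cP vd /cvg_ex[/= D dD] vP.
have d0 j : 0 <= d j by apply: le_trans (vd j 0).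
have bnd x k : 0 <= x < 1 -> `|Phi x - series (v ^~ x) k| <= D - series d k.
  move=> x01; apply: (@cvg_seq_le (fun m => `|series (v ^~ x) (m + k)%N - series (v ^~ x) k|)).
    apply: cvg_norm; apply: cvgB; last exact: cvg_cst.
    by have := vP x x01; rewrite -(cvg_shiftn k).
  move=> m; apply: (@le_trans _ _ (series d (m + k)%N - series d k)).
    rewrite !sub_series_geq ?leq_addl //.
    by apply: le_trans (ler_norm_sum _ _ _) _; apply: ler_sum => j _; exact: vd.
  by rewrite lerD2r series_le_lim.
have bnd1 k : `|Phi 1 - series (v ^~ 1) k| <= D - series d k.
  pose G x := `|Phi x - series (v ^~ x) k|.
  have cG : continuous G.
    apply: (@continuousT_comp _ _ (fun x => Phi x - series (v ^~ x) k) (fun x => `|x|)).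
      apply: continuousTB => //; rewrite /series /=.
      by apply: continuousT_sum => j; exact: cv.
    by move=> y; exact: norm_continuous.
  have h1 : (1 - m.+1%:R^-1 : R) @[m --> \oo] --> (1 : R).
    rewrite -[X in _ --> X]subr0; apply: cvgB; first exact: cvg_cst.
    exact: cvg_harmonic.
  apply: (@cvg_seq_le (fun m => G (1 - m.+1%:R^-1))).
    exact: (cvg_comp _ _ h1 (@cG 1)).
  move=> m; apply: bnd; rewrite subr_ge0 invf_le1 // ler1n /=.
  by rewrite gtrBl invr_gt0.
apply/cvgrPdist_le => /= e e0.
have /cvgrPdist_le/(_ e e0) := dD; apply: filterS => k /= h.
by rewrite (le_trans (bnd1 k)) // (le_trans _ h) // ler_norm.
Qed.

End limits.

Section partial_fractions.
Context {R : realType}.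
Local Notation pi := (@pi R).

Lemma is_derive_sin_lin (a x : R) : is_derive x 1 (fun y => sin (a * y)) (a * cos (a * x)).
Proof.
apply: (@is_derive_eq _ _ _ _ _ _ _ _ (@is_derive1_comp _ sin (fun y => a * y) x _ _ _ _)) => /=.
by rewrite /GRing.scale /=; ring.
Qed.

Lemma is_derive_cos_lin (a x : R) : is_derive x 1 (fun y => cos (a * y)) (- (a * sin (a * x))).
Proof.
apply: (@is_derive_eq _ _ _ _ _ _ _ _ (@is_derive1_comp _ cos (fun y => a * y) x _ _ _ _)) => /=.
by rewrite /GRing.scale /=; ring.
Qed.

Lemma is_derive_series (f df : nat -> R -> R) (x : R) N :
  (forall j, is_derive x 1 (f j) (df j x)) ->
  is_derive x 1 (fun y => series (f ^~ y) N) (series (df ^~ x) N).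
Proof.
move=> fdf; rewrite /series /=; elim: N => [|N IH].
  under eq_fun do rewrite big_geq //.
  by rewrite big_geq //; exact: is_derive_cst.
under eq_fun do rewrite big_nat_recr //=.
by rewrite big_nat_recr //=; apply: is_deriveD.
Qed.

(** Series are indexed from 0, so [j] stands for the node k pi with k = j + 1, and this is
    (-1)^k. *)
Definition alternate (j : nat) : R := (-1) ^+ j.+1.

Lemma alternateE j : alternate j = 1 \/ alternate j = -1.
Proof. by rewrite /alternate -signr_odd; case: odd; [right|left]; rewrite ?expr1 ?expr0. Qed.

Lemma norm_alternate j : `|alternate j| = 1.
Proof. by case: (alternateE j) => ->; rewrite ?normrN normr1. Qed.

(** The Dirichlet kernel taken at pi (x + 1): the signs (-1)^k move its singularity to x = 1 and
    leave [0, 1) free. *)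
Definition dirichlet N (x : R) : R :=
  1 + series (fun j => alternate j * (2 * cos (j.+1%:R * pi * x))) N.

(** The usual quotient of sines, its denominator sin(pi (x + 1) / 2) being cos(pi x / 2). The
    product form telescopes in [N]. *)
Lemma dirichletE N x : dirichlet N x * cos (pi / 2 * x) =
  (-1) ^+ N * cos ((N%:R + 2^-1) * pi * x).
Proof.
rewrite /dirichlet /series /=; elim: N => [|N IH].
  by rewrite big_geq // addr0 expr0 !mul1r add0r; congr cos; ring.
rewrite big_nat_recr //= addrA mulrDl IH /alternate exprS.
rewrite (_ : (N%:R + 2^-1) * pi * x = N.+1%:R * pi * x - pi / 2 * x); last by rewrite -natr1; field.
rewrite (_ : (N.+1%:R + 2^-1) * pi * x = N.+1%:R * pi * x + pi / 2 * x); last by field.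
by rewrite cosB cosD; ring.
Qed.

(* Riemann-Lebesgue for the Dirichlet kernel without integrals: subtracting the explicit
   primitive (-1)^N h(x) sin((N+1/2) pi x) / ((N+1/2) pi), with h = g / cos(pi x / 2), leaves
   a function whose derivative is O(1/N). *)
Lemma dirichlet_primitive_cvg (F : nat -> R -> R) (g dg : R -> R) (B x : R) :
  (forall N (y : R), is_derive y 1 (F N) (g y * dirichlet N y)) ->
  (forall y : R, is_derive y 1 g (dg y)) ->
  (forall y, `|g y| <= 1) -> (forall y, `|dg y| <= B) -> 0 <= x < 1 ->
  F N x - F N 0 @[N --> \oo] --> 0.
Proof.
move=> dF dG g1 dgB /andP[x0 x1].
pose om (N : nat) : R := (N%:R + 2^-1) * pi.
have om0 N : 0 < om N by rewrite mulr_gt0 ?pi_gt0 // ltr_wpDl // invr_gt0.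
pose cs (y : R) := cos (pi / 2 * y).
(* Cosine decreases on [0, pi/2], so [m] bounds the denominator from below on [0, x]; it is positive
   because x < 1, and the later constants depend on it but not on [N]. *)
pose m := cs x.
have pi0 := pi_gt0 R.
have csm y : 0 <= y <= x -> m <= cs y.
  move=> /andP[y0 yx]; rewrite /m /cs.
  have [->//|yxn] := eqVneq y x.
  have yx' : y < x by rewrite lt_neqAle yxn.
  by apply/ltW; rewrite ltr_cos ?in_itv /=; nra.
have m0 : 0 < m by apply: cos_gt0_pihalf; nra.
have cs1 y : cs y <= 1 by exact: cos_le1.
pose h (y : R) := g y * (cs y)^-1.
pose dh (y : R) := dg y * (cs y)^-1 + g y * (pi / 2 * sin (pi / 2 * y) * (cs y) ^- 2).
pose C := `|B| * m^-1 + pi / 2 * m ^- 2.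
have C0 : 0 <= C by rewrite addr_ge0 // mulr_ge0 // ?invr_ge0 ?exprn_ge0 ?divr_ge0 ?ltW.
have dhE y : 0 <= y <= x -> is_derive y 1 h (dh y).
  move=> yx; have cy : cs y != 0 by rewrite gt_eqF // (lt_le_trans m0) // csm.
  have dcs : is_derive y 1 cs (- (pi / 2 * sin (pi / 2 * y))) by exact: is_derive_cos_lin.
  have dcv := @is_deriveV R cs y _ 1 cy dcs.
  apply: (@is_derive_eq _ _ _ _ _ _ _ _ (is_deriveM (dG y) dcv)).
  by rewrite /dh /GRing.scale /=; ring.
have dhC y : 0 <= y <= x -> `|dh y| <= C.
  move=> yx; have cy := csm y yx; have cy0 := lt_le_trans m0 cy.
  have i1 : (cs y)^-1 <= m^-1 by rewrite lef_pV2.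
  have i2 : (cs y) ^- 2 <= m ^- 2.
    by rewrite lef_pV2 ?posrE ?exprn_gt0 // lerXn2r ?nnegrE ?(ltW m0) ?(ltW cy0).
  apply: le_trans (ler_normD _ _) _; rewrite /C; apply: lerD.
    rewrite normrM; apply: ler_pM => //; first by rewrite (le_trans (dgB y)) // ler_norm.
    by rewrite gtr0_norm ?invr_gt0.
  rewrite normrM -[leRHS]mul1r; apply: ler_pM => //.
  rewrite normrM; apply: ler_pM => //.
    rewrite normrM gtr0_norm ?divr_gt0 // -[leRHS]mulr1 ler_wpM2l ?sin_max //.
    by rewrite divr_ge0 // ltW.
  by rewrite gtr0_norm ?invr_gt0 ?exprn_gt0.
have hm : `|h x| <= m^-1.
  rewrite normrM -[leRHS]mul1r; apply: ler_pM => //.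
  by rewrite gtr0_norm ?invr_gt0.
pose P N (y : R) := F N y - (-1) ^+ N * (om N)^-1 * (h y * sin (om N * y)).
have dP N y : 0 <= y <= x -> is_derive y 1 (P N)
    (- ((-1) ^+ N * (om N)^-1 * (dh y * sin (om N * y)))).
  move=> yx; have cy : cs y != 0 by rewrite gt_eqF // (lt_le_trans m0) // csm.
  have e1 := is_deriveM (dhE y yx) (is_derive_sin_lin (om N) y).
  have e2 := is_deriveM (is_derive_cst ((-1) ^+ N * (om N)^-1 : R) y 1) e1.
  have e3 := is_deriveB (dF N y) e2.
  apply: (@is_derive_eq _ _ _ _ _ _ _ _ e3); rewrite /GRing.scale /=.
  have omn : om N != 0 by rewrite gt_eqF.
  have := dirichletE N y; rewrite -/(om N) -/(cs y) => DE.
  have -> : dirichlet N y = (-1) ^+ N * cos (om N * y) / cs y by rewrite -DE mulfK.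
  by rewrite /h /=; field; apply/andP.
apply: (@cvg_squeeze0 _ _ (fun N => (C + m^-1) * N.+1%:R^-1)); last first.
  by rewrite -[X in _ --> X](mulr0 (C + m^-1)); apply: cvgM; [exact: cvg_cst|exact: cvg_harmonic].
move=> N.
(* (N + 1/2) pi >= N + 1, because pi >= 2. *)
have omN : (om N)^-1 <= N.+1%:R^-1.
  rewrite lef_pV2 ?posrE // /om -natr1; have := pi_ge2 R; have : 0 <= (N%:R : R) by [].
  nra.
have sg : `|(-1) ^+ N * (om N)^-1| <= N.+1%:R^-1.
  by rewrite normrM normrX normrN1 expr1n mul1r gtr0_norm ?invr_gt0.
have dPo y : y \in `]0, x[ ->
    is_derive y 1 (P N) (- ((-1) ^+ N * (om N)^-1 * (dh y * sin (om N * y)))).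
  by rewrite in_itv /= => /andP[h1 h2]; apply: dP; rewrite !ltW.
have cP : {within `[0, x], continuous (P N)}.
  apply: derivable_within_continuous => y; rewrite in_itv /= => yx.
  exact: (@ex_derive _ _ _ _ _ _ _ (dP N y yx)).
(* The subtracted term vanishes at 0 with the sine, so the mean value theorem for [P N] leaves only
   terms of size O(1/N). *)
have [c] := MVT_segment x0 dPo cP.
rewrite in_itv /= => cx; rewrite {1}/P /P mulr0 sin0 !mulr0 !subr0 => E.
have -> : F N x - F N 0 = (-1) ^+ N * (om N)^-1 * (h x * sin (om N * x)) -
    (-1) ^+ N * (om N)^-1 * (dh c * sin (om N * c)) * x.
  by move: E; lra.
apply: le_trans (ler_normB _ _) _; rewrite [leLHS]addrC [leRHS]mulrDl; apply: lerD.
  rewrite -mulrA normrM mulrC; apply: ler_pM => //.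
  rewrite !normrM -mulrA -[leRHS]mulr1; apply: ler_pM => //; first exact: dhC.
  by rewrite mulr_ile1 ?sin_max // ger0_norm // ltW.
rewrite normrM mulrC; apply: ler_pM => //.
by rewrite normrM -[leRHS]mulr1; apply: ler_pM => //; exact: sin_max.
Qed.


Lemma cos_natpi k : cos (k%:R * pi) = (-1) ^+ k.
Proof.
elim: k => [|k IH]; first by rewrite mul0r cos0.
by rewrite -natr1 mulrDl mul1r cosDpi IH exprS mulN1r.
Qed.

Lemma sin_natpi k : sin (k%:R * pi) = 0.
Proof.
elim: k => [|k IH]; first by rewrite mul0r sin0.
by rewrite -natr1 mulrDl mul1r sinDpi IH oppr0.
Qed.

Section nodes.
Variable r : R.
Hypotheses (r_neq0 : r != 0) (r_lt : `|r| < pi / 2).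

Let node (j : nat) : R := j.+1%:R * pi.
Let diffc (j : nat) : R := (node j - r)^-1 - (node j + r)^-1.
Let sumc (j : nat) : R := (node j - r)^-1 + (node j + r)^-1.

Let node_bounds j : 0 < node j - r /\ 0 < node j + r.
Proof.
have pi0 := pi_gt0 R.
have : 1 * pi <= node j by rewrite ler_wpM2r ?ler1n // ltW.
by move: r_lt; rewrite ltr_norml => /andP[h1 h2] h3; split; lra.
Qed.

(** [sinsum] and [cossum] are, by product-to-sum, primitives of cos(r x) and sin(r x) times the
    Dirichlet kernel. That their increments tend to 0 is the source of both expansions. *)
Let sinsum N (x : R) := sin (r * x) / r + series (fun j => alternate j *
  (sin ((node j - r) * x) / (node j - r) + sin ((node j + r) * x) / (node j + r))) N.
Let cossum N (x : R) := - (cos (r * x) / r) + series (fun j => alternate j *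
  (cos ((node j - r) * x) / (node j - r) - cos ((node j + r) * x) / (node j + r))) N.

Let is_derive_sinsum N (x : R) : is_derive x 1 (sinsum N) (cos (r * x) * dirichlet N x).
Proof.
have e1 := is_deriveM (is_derive_sin_lin r x) (is_derive_cst (r^-1 : R) x 1).
have e2 j : is_derive x 1 (fun y : R => alternate j *
    (sin ((node j - r) * y) / (node j - r) + sin ((node j + r) * y) / (node j + r)))
    (cos (r * x) * (alternate j * (2 * cos (node j * x)))).
  have [p1 p2] := node_bounds j.
  have f1 := is_deriveM (is_derive_sin_lin (node j - r) x) (is_derive_cst ((node j - r)^-1 : R) x 1).
  have f2 := is_deriveM (is_derive_sin_lin (node j + r) x) (is_derive_cst ((node j + r)^-1 : R) x 1).
  have f3 := is_deriveM (is_derive_cst (alternate j) x 1) (is_deriveD f1 f2).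
  apply: (@is_derive_eq _ _ _ _ _ _ _ _ f3); rewrite /GRing.scale /=.
  rewrite (mulrBl x) (mulrDl _ _ x) cosB cosD.
  by field; rewrite !gt_eqF.
have e3 := is_deriveD e1 (@is_derive_series (fun j y => alternate j *
    (sin ((node j - r) * y) / (node j - r) + sin ((node j + r) * y) / (node j + r)))
    (fun j y => cos (r * y) * (alternate j * (2 * cos (node j * y)))) x N e2).
apply: (@is_derive_eq _ _ _ _ _ _ _ _ e3); rewrite /GRing.scale /=.
rewrite /dirichlet mulrDr mulr1; congr (_ + _); last by rewrite /series /= mulr_sumr.
by field.
Qed.

Let is_derive_cossum N (x : R) : is_derive x 1 (cossum N) (sin (r * x) * dirichlet N x).
Proof.
have e1 := is_deriveN (is_deriveM (is_derive_cos_lin r x) (is_derive_cst (r^-1 : R) x 1)).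
have e2 j : is_derive x 1 (fun y : R => alternate j *
    (cos ((node j - r) * y) / (node j - r) - cos ((node j + r) * y) / (node j + r)))
    (sin (r * x) * (alternate j * (2 * cos (node j * x)))).
  have [p1 p2] := node_bounds j.
  have f1 := is_deriveM (is_derive_cos_lin (node j - r) x) (is_derive_cst ((node j - r)^-1 : R) x 1).
  have f2 := is_deriveM (is_derive_cos_lin (node j + r) x) (is_derive_cst ((node j + r)^-1 : R) x 1).
  have f3 := is_deriveM (is_derive_cst (alternate j) x 1) (is_deriveB f1 f2).
  apply: (@is_derive_eq _ _ _ _ _ _ _ _ f3); rewrite /GRing.scale /=.
  rewrite (mulrBl x) (mulrDl _ _ x) sinB sinD.
  by field; rewrite !gt_eqF.
have e3 := is_deriveD e1 (@is_derive_series (fun j y => alternate j *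
    (cos ((node j - r) * y) / (node j - r) - cos ((node j + r) * y) / (node j + r)))
    (fun j y => sin (r * y) * (alternate j * (2 * cos (node j * y)))) x N e2).
apply: (@is_derive_eq _ _ _ _ _ _ _ _ e3); rewrite /GRing.scale /=.
rewrite /dirichlet mulrDr mulr1; congr (_ + _); last by rewrite /series /= mulr_sumr.
by field.
Qed.

Let sinsum_cvg (x : R) : 0 <= x < 1 -> sinsum N x @[N --> \oo] --> 0.
Proof.
move=> x01; have dc (y : R) := is_derive_cos_lin r y.
have := dirichlet_primitive_cvg is_derive_sinsum dc (fun y => cos_max _) _ x01.
move=> /(_ `|r|); rewrite (_ : (fun N => sinsum N x - sinsum N 0) = sinsum ^~ x).
  by apply=> y; rewrite normrN normrM -[leRHS]mulr1 ler_wpM2l ?sin_max.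
apply/funext => N; rewrite [X in _ - X](_ : _ = 0) ?subr0 //.
rewrite /sinsum mulr0 sin0 mul0r add0r /series /= big1 // => j _.
by rewrite !mulr0 sin0 !mul0r addr0 mulr0.
Qed.

Let cossum_cvg (x : R) : 0 <= x < 1 -> cossum N x - cossum N 0 @[N --> \oo] --> 0.
Proof.
move=> x01; have dc (y : R) := is_derive_sin_lin r y.
have := dirichlet_primitive_cvg is_derive_cossum dc (fun y => sin_max _) _ x01.
by move=> /(_ `|r|); apply=> y; rewrite normrM -[leRHS]mulr1 ler_wpM2l ?cos_max.
Qed.

(** Equal to 1 / (k^2 - 1/4) with k = j + 1, a telescoping stand-in for 1 / k^2 with total 2. *)
Let majorant (j : nat) : R := (j.+1%:R - 2^-1)^-1 - (j.+1%:R + 2^-1)^-1.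

Let majorant_sum N : series majorant N = 2 - (N%:R + 2^-1)^-1.
Proof.
rewrite /series /=; elim: N => [|N IH]; first by rewrite big_geq // add0r invrK subrr.
rewrite big_nat_recr //= IH /majorant.
by rewrite (_ : N.+1%:R - 2^-1 = N%:R + 2^-1); [ring|rewrite -natr1; field].
Qed.

Let majorant_ge0 j : 0 <= majorant j.
Proof.
have j0 : 1 <= (j.+1%:R : R) by rewrite ler1n.
by rewrite subr_ge0 lef_pV2 ?posrE; lra.
Qed.

Let majorant_cvg : cvgn (series majorant).
Proof.
apply: nondecreasing_is_cvgn.
  by apply/nondecreasing_seqP => m; rewrite seriesEnat /= big_nat_recr //= lerDl.
exists 2 => _ [N _ <-]; rewrite majorant_sum gerBl invr_ge0.
by rewrite addr_ge0.
Qed.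

(** The difference equals 2 r / (k^2 pi^2 - r^2), and |r| < pi/2 gives k^2 pi^2 - r^2 >= pi^2 (k^2 -
    1/4). *)
Let norm_diffc j : `|diffc j| <= 2 * `|r| / pi ^+ 2 * majorant j.
Proof.
have [p1 p2] := node_bounds j; have pi0 := pi_gt0 R.
have j0 : 1 <= (j.+1%:R : R) by rewrite ler1n.
have -> : diffc j = 2 * r * ((node j - r) * (node j + r))^-1.
  by rewrite /diffc; field; rewrite !gt_eqF.
have -> : 2 * `|r| / pi ^+ 2 * majorant j =
    2 * `|r| * (pi ^+ 2 * (j.+1%:R ^+ 2 - 4^-1))^-1.
  rewrite /majorant; move: j0; set K := j.+1%:R => j0; set a := K - 2^-1.
  have a0 : 0 < a by rewrite /a; lra.
  rewrite (_ : K + 2^-1 = a + 1); last by rewrite /a; field.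
  rewrite (_ : K ^+ 2 - 4^-1 = a * (a + 1)); last by rewrite /a; field.
  by field; rewrite !gt_eqF //; lra.
rewrite normrM (normrM 2) (ger0_norm (_ : 0 <= 2)) // ler_wpM2l ?mulr_ge0 //.
rewrite gtr0_norm ?invr_gt0 ?mulr_gt0 // lef_pV2 ?posrE; [|by rewrite mulr_gt0|].
  rewrite [leRHS](_ : _ = node j ^+ 2 - r ^+ 2); last by ring.
  have : r ^+ 2 <= (pi / 2) ^+ 2.
    rewrite -[leLHS]real_normK ?num_real // lerXn2r ?nnegrE ?divr_ge0 //; exact: ltW.
  rewrite /node => h; move: h; set K := j.+1%:R; nra.
by rewrite mulr_gt0 ?exprn_gt0 //; nra.
Qed.

Let cossum0 N : cossum N 0 = - r^-1 + series (fun j => alternate j * diffc j) N.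
Proof.
rewrite /cossum mulr0 cos0 mul1r; congr (_ + _); apply: eq_bigr => j _.
by rewrite !mulr0 cos0 !mul1r.
Qed.

(* The constant is 1 / sin r, up to sign; only its sign is needed. *)
Lemma secant_constant : exists A : R, [/\ (r > 0 -> A < 0) &
  forall x : R, 0 <= x < 1 ->
    - r^-1 + series (fun j => alternate j * diffc j * cos (node j * x)) N @[N --> \oo]
      --> A * cos (r * x) /\
    series (fun j => alternate j * sumc j * sin (node j * x)) N @[N --> \oo]
      --> A * sin (r * x)].
Proof.
have cK : cvgn (series (fun j => 2 * `|r| / pi ^+ 2 * majorant j)).
  have -> : series (fun j => 2 * `|r| / pi ^+ 2 * majorant j) =
      (fun N => 2 * `|r| / pi ^+ 2 * series majorant N).
    by apply/funext => N; rewrite /series /= mulr_sumr.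
  by apply: is_cvgM; [exact: is_cvg_cst|exact: majorant_cvg].
have /cvg_ex[/= A0 hA0] : cvgn (series (fun j => alternate j * diffc j)).
  apply: dominated_series_cvg cK => j.
  by rewrite normrM norm_alternate mul1r norm_diffc.
pose A := - r^-1 + A0.
have hA : cossum N 0 @[N --> \oo] --> A.
  under eq_fun do rewrite cossum0.
  by apply: cvgD => //; exact: cvg_cst.
have pi0 := pi_gt0 R.
exists A; split.
  move=> r0; rewrite /A addrC subr_lt0.
  (* The majorant sums to at most 2, so A0 <= 4 r / pi^2, which is less than 1/r because r <
     pi/2. *)
  have A04 : A0 <= 2 * r / pi ^+ 2 * 2.
    apply: (cvg_seq_le hA0) => N; apply: (@le_trans _ _ (2 * r / pi ^+ 2 * series majorant N)).
      rewrite /series /= mulr_sumr; apply: ler_sum => j _.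
      apply: le_trans (ler_norm _) _; rewrite normrM norm_alternate mul1r.
      by rewrite (le_trans (norm_diffc j)) // gtr0_norm.
    rewrite ler_wpM2l //; first by rewrite divr_ge0 ?mulr_ge0 ?exprn_ge0 // ltW.
    by rewrite majorant_sum gerBl invr_ge0 addr_ge0.
  apply: (le_lt_trans A04); rewrite -[ltRHS]mul1r ltr_pdivlMr //.
  rewrite [ltLHS](_ : _ = 4 * r ^+ 2 / pi ^+ 2); last by ring.
  rewrite ltr_pdivrMr ?exprn_gt0 // mul1r.
  move: r_lt; rewrite gtr0_norm // => h; nra.
move=> x x01.
have hC : cossum N x @[N --> \oo] --> A.
  rewrite (_ : cossum ^~ x = (fun N => (cossum N x - cossum N 0) + cossum N 0)).
    by rewrite -[X in _ --> X]add0r; apply: cvgD => //; exact: cossum_cvg.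
  by apply/funext => N; rewrite subrK.
have hS := sinsum_cvg x01.
(* The angle is (node - r) x + r x and also (node + r) x - r x. Hence the wanted sums are the pair
   ([cossum], [sinsum]) rotated by r x, and its limit (A, 0) becomes (A cos(r x), A sin(r x)). *)
have key j : [/\ cos (node j * x) = cos ((node j - r) * x) * cos (r * x) - sin ((node j - r) * x) * sin (r * x),
   cos (node j * x) = cos ((node j + r) * x) * cos (r * x) + sin ((node j + r) * x) * sin (r * x),
   sin (node j * x) = sin ((node j - r) * x) * cos (r * x) + cos ((node j - r) * x) * sin (r * x) &
   sin (node j * x) = sin ((node j + r) * x) * cos (r * x) - cos ((node j + r) * x) * sin (r * x)].
  by rewrite -cosD -cosB -sinD -sinB; split; [congr cos|congr cos|congr sin|congr sin]; ring.
have cs1 := cos2Dsin2 (r * x).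
split.
- have -> : (fun N => - r^-1 + series (fun j => alternate j * diffc j * cos (node j * x)) N) =
      (fun N => cossum N x * cos (r * x) - sinsum N x * sin (r * x)).
    apply/funext => N; rewrite /cossum /sinsum !mulrDl opprD addrACA; congr (_ + _).
      rewrite (_ : - r^-1 = - r^-1 * (cos (r * x) ^+ 2 + sin (r * x) ^+ 2)); first by field.
      by rewrite cs1 mulr1.
    rewrite /series /= !mulr_suml -sumrB; apply: eq_bigr => j _.
    have [k1 k2 _ _] := key j; have [p1 p2] := node_bounds j.
    rewrite /diffc mulrBr mulrBl {1}k1 k2.
    by field; rewrite !gt_eqF.
  rewrite -[X in _ --> X]subr0 -[X in _ - X](mul0r (sin (r * x))).
  by apply: cvgB; apply: cvgM => //; exact: cvg_cst.
- have -> : series (fun j => alternate j * sumc j * sin (node j * x)) =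
      (fun N => sinsum N x * cos (r * x) + cossum N x * sin (r * x)).
    apply/funext => N; rewrite /cossum /sinsum !mulrDl addrACA [X in _ = X + _](_ : _ = 0).
      rewrite add0r /series /= !mulr_suml -big_split; apply: eq_bigr => j _ /=.
      have [_ _ k3 k4] := key j; have [p1 p2] := node_bounds j.
      rewrite /sumc mulrDr mulrDl {1}k3 k4.
      by field; rewrite !gt_eqF.
    by ring.
  rewrite -[X in _ --> X]add0r -[X in X + _](mul0r (cos (r * x))).
  by apply: cvgD; apply: cvgM => //; exact: cvg_cst.
Qed.

End nodes.

End partial_fractions.

(* The last two series are the real and imaginary parts of the functional of the header
   evaluated at g(t) = exp(i x t), where cos (k pi x) and sin (k pi x) collect the nodes k pi
   and - k pi. *)
Lemma extremal_functional (R : realType) (rho s : R) :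
  0 < rho < pi / 2 -> 0 < s < pi / 2 ->
  exists p q : R, exists d e : nat -> R,
  [/\ 0 < p, 0 < q, p * sin rho = q * sin s, (forall j, 0 <= d j) /\ (forall j, 0 <= e j) &
   series (fun j => d j + e j) @ \oo --> (rho * s)^-1 - p * cos rho - q * cos s /\
   forall x : R, `|x| < 1 ->
    series (fun j => alternate j * (d j + e j) * cos (j.+1%:R * pi * x)) @ \oo
      --> (rho * s)^-1 - p * cos (rho * x) - q * cos (s * x) /\
    series (fun j => alternate j * (d j - e j) * sin (j.+1%:R * pi * x)) @ \oo
      --> - p * sin (rho * x) + q * sin (s * x)].
Proof.
move=> /andP[r0 rpi] /andP[s0 spi].
have pi0 := pi_gt0 R.
(* Since (rho + s) / ((z - rho) (z + s)) = 1 / (z - rho) - 1 / (z + s), the functional is the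
   difference of the expansions at r = rho and r = -s, divided by rho + s. *)
have [|| A [An hA]] := @secant_constant R rho.
- by rewrite gt_eqF.
- by rewrite gtr0_norm.
have [|| B [_ hB]] := @secant_constant R (- s).
- by rewrite oppr_eq0 gt_eqF.
- by rewrite normrN gtr0_norm.
have {An} A0 := An r0.
pose nd (j : nat) : R := j.+1%:R * pi.
have ndge j : pi <= nd j by rewrite -[leLHS]mul1r ler_wpM2r ?ler1n // ltW.
have nz j : [/\ 0 < nd j - rho, 0 < nd j + rho, 0 < nd j - s & 0 < nd j + s].
  by have := ndge j; split; lra.
pose d j := ((nd j - rho) * (nd j + s))^-1.
pose e j := ((nd j + rho) * (nd j - s))^-1.
have d0 j : 0 <= d j by have [h1 h2 h3 h4] := nz j; rewrite invr_ge0 mulr_ge0 // ltW.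
have e0 j : 0 <= e j by have [h1 h2 h3 h4] := nz j; rewrite invr_ge0 mulr_ge0 // ltW.
have rs0 : 0 < rho + s by lra.
(* [A] and [B] are -1 / sin rho and 1 / sin s, so [p] and [q] are the residues 1 / ((rho + s) sin
   rho) and 1 / ((rho + s) sin s). *)
pose p := - A / (rho + s); pose q := B / (rho + s).
have p0 : 0 < p by rewrite divr_gt0 // oppr_gt0.
pose Phi x := (rho * s)^-1 - p * cos (rho * x) - q * cos (s * x).
pose Psi x := - p * sin (rho * x) + q * sin (s * x).
have hcos x : 0 <= x < 1 ->
    series (fun j => alternate j * (d j + e j) * cos (nd j * x)) @ \oo --> Phi x.
  move=> x01; have [hA1 _] := hA x x01; have [hB1 _] := hB x x01.
  pose X r N := - r^-1 + series (fun j => alternate j *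
    ((nd j - r)^-1 - (nd j + r)^-1) * cos (nd j * x)) N.
  rewrite (_ : series _ = (fun N => (rho * s)^-1 + (X rho N - X (- s) N) * (rho + s)^-1)).
    rewrite (_ : Phi x = (rho * s)^-1 + (A * cos (rho * x) - B * cos (- s * x)) * (rho + s)^-1).
      apply: cvgD; first exact: cvg_cst.
      by apply: cvgM; [exact: cvgB hA1 hB1|exact: cvg_cst].
    by rewrite /Phi /p /q !mulNr cosN; field; rewrite !gt_eqF.
  apply/funext => N; rewrite /X opprD addrACA mulrDl addrA.
  rewrite (_ : (rho * s)^-1 + _ = 0); last by field; rewrite !gt_eqF.
  rewrite add0r /series /= -sumrB mulr_suml; apply: eq_bigr => j _.
  have [h1 h2 h3 h4] := nz j; rewrite !opprK /d /e.
  by field; rewrite !gt_eqF.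
have hsin x : 0 <= x < 1 ->
    series (fun j => alternate j * (d j - e j) * sin (nd j * x)) @ \oo --> Psi x.
  move=> x01; have [_ hA1] := hA x x01; have [_ hB1] := hB x x01.
  pose Y r N := series (fun j => alternate j *
    ((nd j - r)^-1 + (nd j + r)^-1) * sin (nd j * x)) N.
  rewrite (_ : series _ = (fun N => (Y rho N - Y (- s) N) * (rho + s)^-1)).
    rewrite (_ : Psi x = (A * sin (rho * x) - B * sin (- s * x)) * (rho + s)^-1).
      by apply: cvgM; [exact: cvgB hA1 hB1|exact: cvg_cst].
    by rewrite /Psi /p /q !mulNr sinN; field; rewrite !gt_eqF.
  apply/funext => N; rewrite /Y /series /= -sumrB mulr_suml; apply: eq_bigr => j _.
  have [h1 h2 h3 h4] := nz j; rewrite !opprK /d /e.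
  by field; rewrite !gt_eqF.
have cde : cvgn (series (fun j => d j + e j)).
  pose M j : R := 8 * ((j.+1%:R - 2^-1)^-1 - (j.+1%:R + 2^-1)^-1).
  have hM N : series M N = 8 * (2 - (N%:R + 2^-1)^-1).
    rewrite /series /= -mulr_sumr; congr (_ * _); elim: N => [|N IH].
      by rewrite big_geq // add0r invrK subrr.
    rewrite big_nat_recr //= IH.
    by rewrite (_ : N.+1%:R - 2^-1 = N%:R + 2^-1); [ring|rewrite -natr1; field].
  have deM j : d j + e j <= M j.
    have [h1 h2 h3 h4] := nz j.
    have j1 : 1 <= (j.+1%:R : R) by rewrite ler1n.
    have hpi := pi_ge2 R.
    rewrite /M /d /e /nd in h1 h2 h3 h4 *; set K := j.+1%:R in j1 h1 h2 h3 h4 *.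
    (* As rho, s < pi/2 and pi >= 2, each factor of the denominators is at least pi (k - 1/2) >= 2
       a; moreover 1 / (4 a^2) <= 4 / (a (a + 1)). The two terms give the factor 8. *)
    set a := K - 2^-1; have a0 : 0 < a by rewrite /a; lra.
    have ta (x y : R) : - (pi / 2) <= x -> - (pi / 2) <= y ->
        ((K * pi + x) * (K * pi + y))^-1 <= (4 * a ^+ 2)^-1.
      move=> hx hy; have k1 : 2 * a <= K * pi + x by rewrite /a; nra.
      have k2 : 2 * a <= K * pi + y by rewrite /a; nra.
      by rewrite lef_pV2 ?posrE; nra.
    have t1 := ta (- rho) s; have t2 := ta rho (- s).
    have t3 : (4 * a ^+ 2)^-1 <= 4 * (a^-1 - (a + 1)^-1).
      rewrite (_ : 4 * _ = (a * (a + 1) / 4)^-1); last by field; rewrite !gt_eqF //; lra.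
      rewrite lef_pV2 ?posrE; rewrite /a in a0 *; nra.
    rewrite (_ : K + 2^-1 = a + 1); last by rewrite /a; field.
    have {}t1 := t1 ltac:(lra) ltac:(lra); have {}t2 := t2 ltac:(lra) ltac:(lra).
    lra.
  apply: (series_le_cvg _ _ deM) => [j|j|]; first by rewrite addr_ge0.
    by apply: le_trans (deM j); rewrite addr_ge0.
  apply: nondecreasing_is_cvgn.
    apply/nondecreasing_seqP => m; rewrite seriesEnat /= big_nat_recr //= lerDl.
    by apply: le_trans (deM m); rewrite addr_ge0.
  exists 16 => _ [N _ <-]; rewrite hM.
  have : 0 <= (N%:R + 2^-1 : R)^-1 by rewrite invr_ge0 addr_ge0.
  lra.
have cc (a : R) : continuous (fun x => cos (a * x)).
  apply: continuousT_comp; last exact: continuous_cos.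
  by apply: continuousTM; [exact: cst_continuousT|move=> t; exact: cvg_id].
have cs (a : R) : continuous (fun x => sin (a * x)).
  apply: continuousT_comp; last exact: continuous_sin.
  by apply: continuousTM; [exact: cst_continuousT|move=> t; exact: cvg_id].
(* At x = 1 the factors cos(k pi) = (-1)^k undo the signs, which evaluates the total weight. *)
have P1 : series (fun j => d j + e j) @ \oo --> Phi 1.
  have := @series_cvg_at1 R (fun j x => alternate j * (d j + e j) * cos (nd j * x))
    (fun j => d j + e j) Phi _ _ _ cde hcos.
  rewrite (_ : series (fun j => alternate j * (d j + e j) * cos (nd j * 1)) =
    series (fun j => d j + e j)); last first.
    apply/funext => N; apply: eq_bigr => j _; rewrite mulr1.
    rewrite mulrAC (_ : alternate j * cos (nd j) = 1) ?mul1r //.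
    by rewrite /alternate /nd cos_natpi -expr2 sqrr_sign.
  apply.
  - by move=> j; apply: continuousTM; [exact: cst_continuousT|exact: cc].
  - apply: continuousTB; last by apply: continuousTM; [exact: cst_continuousT|exact: cc].
    apply: continuousTB; first exact: cst_continuousT.
    by apply: continuousTM; [exact: cst_continuousT|exact: cc].
  - move=> j x; rewrite !normrM norm_alternate mul1r ger0_norm ?addr_ge0 //.
    by rewrite -[leRHS]mulr1 ler_wpM2l ?addr_ge0 // cos_max.
(* At x = 1 every sine of the series vanishes; what remains relates [p] and [q]. *)
have Q1 : Psi 1 = 0.
  have := @series_cvg_at1 R (fun j x => alternate j * (d j - e j) * sin (nd j * x))
    (fun j => d j + e j) Psi _ _ _ cde hsin.
  rewrite (_ : series (fun j => alternate j * (d j - e j) * sin (nd j * 1)) = cst 0); last first.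
    apply/funext => N; rewrite /series /= big1 // => j _; rewrite mulr1.
    by rewrite /nd sin_natpi !mulr0.
  move=> h; suff /(cvg_unique _)/(_ (cvg_cst _)) : cst 0 @ \oo --> Psi 1 by move=> /(_ _) ->.
  apply: h.
  - by move=> j; apply: continuousTM; [exact: cst_continuousT|exact: cs].
  - by apply: continuousTD; apply: continuousTM; (exact: cst_continuousT || exact: cs).
  - move=> j x; rewrite !normrM norm_alternate mul1r -[leRHS]mulr1.
    apply: ler_pM => //; last exact: sin_max.
    by rewrite ler_norml; have := d0 j; have := e0 j => *; apply/andP; split; lra.
have qs : p * sin rho = q * sin s by move: Q1; rewrite /Psi !mulr1; lra.
have sr0 : 0 < sin rho by apply: sin_gt0_pihalf; rewrite r0 rpi.
have ss0 : 0 < sin s by apply: sin_gt0_pihalf; rewrite s0 spi.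
exists p, q, d, e; split => //.
(* The sign of [q] is read off from p sin rho = q sin s. *)
- by rewrite -(pmulr_lgt0 _ ss0) -qs mulr_gt0.
split; first by move: P1; rewrite /Phi !mulr1.
move=> x x1; have [x0|x0] := leP 0 x.
  by rewrite ger0_norm // in x1; split; [apply: hcos|apply: hsin]; rewrite x0 x1.
rewrite ltr0_norm // in x1.
have xN : 0 <= - x < 1 by rewrite oppr_ge0 ltW.
split.
  have := hcos _ xN; rewrite /Phi !mulrN !cosN.
  by under [X in series X]eq_fun do rewrite mulrN cosN.
have /cvgN := hsin _ xN; rewrite /Psi !mulrN !sinN.
rewrite (_ : - (_ + _) = - p * sin (rho * x) + q * sin (s * x)); last by ring.
apply: cvg_trans; apply: near_eq_cvg; near=> N; rewrite fctE /series /= -sumrN.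
by apply: eq_bigr => j _; rewrite mulrN sinN; ring.
Unshelve. all: by end_near. Qed.

(** * Bumps and mollifiers *)

Section flat_functions.
Context {R : realType}.

(** The family p(1/t) exp(-1/t), cut off at 0, is closed under differentiation, so one derivative
    formula yields all orders. *)
Definition flat (p : {poly R}) (t : R) : R :=
  if 0 < t then p.[t^-1] * expR (- t^-1) else 0.

(** With u = 1/t, exp(u) >= u^(i+2) / (i+2)! bounds u^i exp(-u) by (i+2)! t^2. The square makes the
    difference quotient at 0 tend to 0. *)
Lemma flat_bound p : exists C : R, forall t, `|flat p t| <= C * t ^+ 2.
Proof.
exists (\sum_(i < size p) `|p`_i| * (i.+2)`!%:R) => t; rewrite /flat.
have C0 : 0 <= \sum_(i < size p) `|p`_i| * (i.+2)`!%:R by apply: sumr_ge0 => i _; rewrite mulr_ge0.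
case: ifPn => t0; last by rewrite normr0 mulr_ge0 ?sqr_ge0.
have u0 : 0 < t^-1 by rewrite invr_gt0.
rewrite normrM (ger0_norm (expR_ge0 _)) horner_coef mulr_suml.
apply: le_trans (ler_wpM2r (expR_ge0 _) (ler_norm_sum _ _ _)) _.
rewrite mulr_suml; apply: ler_sum => i _.
rewrite normrM -!mulrA ler_wpM2l // ger0_norm ?exprn_ge0 ?(ltW u0) //.
rewrite expRN ler_pdivrMr ?expR_gt0 //.
have := expR_ge1Dxn i.+1 (ltW u0); set e := expR _; set F := _%:R => h.
have F0 : 0 < F by rewrite ltr0n fact_gt0.
have hu : t^-1 ^+ i.+2 <= F * e.
  by rewrite -ler_pdivrMl // mulrC; apply: le_trans h; rewrite lerDr.
rewrite (_ : t^-1 ^+ i = t^-1 ^+ i.+2 * t ^+ 2).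
  by rewrite [leRHS]mulrAC ler_wpM2r ?sqr_ge0.
by rewrite -addn2 exprD -mulrA -exprMn mulVf ?gt_eqF // expr1n mulr1.
Qed.

Lemma is_derive_cvg (f : R -> R) (x l : R) :
  h^-1 *: (f (h *: 1 + x) - f x) @[h --> 0^'] --> l -> is_derive x (1 : R) f l.
Proof. by move=> fl; apply: DeriveDef; [exact: cvgP fl|exact: cvg_lim fl]. Qed.

Lemma is_derive_flat p (t : R) : is_derive t (1 : R) (flat p) (flat ('X^2 * (p - p^`())) t).
Proof.
have [t0|t0|->] := ltgtP t 0.
- rewrite [X in is_derive _ _ _ X]/flat ltNge ltW //=.
  apply: near_eq_is_derive (is_derive_cst (0 : R) t 1).
  near=> y; rewrite /flat ltNge ltW //; near: y.
  exact: lt_nbhsl.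
- rewrite [X in is_derive _ _ _ X]/flat t0.
  apply: (@near_eq_is_derive _ _ _ (fun t : R => p.[t^-1] * expR (- t^-1))).
    near=> y; rewrite /flat (_ : 0 < y) //; near: y.
    exact: lt_nbhsr.
  have tn : t != 0 by rewrite gt_eqF.
  have di : is_derive t (1 : R) (fun t : R => t^-1) (- t ^- 2).
    have h := @is_deriveV R id t _ 1 tn (is_derive_id t (1 : R)).
    by apply: (is_derive_eq h); rewrite /GRing.scale /= mulr1.
  have d1 : is_derive t (1 : R) (fun t : R => p.[t^-1]) (p^`().[t^-1] * - t ^- 2).
    exact: (@is_derive1_comp R (horner p) (fun t : R => t^-1)).
  have d2 : is_derive t (1 : R) (fun t : R => expR (- t^-1)) (expR (- t^-1) * t ^- 2).
    have dn : is_derive t (1 : R) (fun t : R => - t^-1) (t ^- 2).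
      by apply: (is_derive_eq (is_deriveN di)); rewrite opprK.
    exact: (@is_derive1_comp R expR (fun t : R => - t^-1)).
  apply: (is_derive_eq (is_deriveM d1 d2)).
  rewrite /GRing.scale /= hornerM hornerXn hornerD hornerN -exprVn.
  by set u := t^-1; ring.
- rewrite [X in is_derive _ _ _ X]/flat ltxx; apply: is_derive_cvg.
  have [C hC] := flat_bound p.
  apply/cvgrPdist_le => /= e e0.
  have C0 : 0 <= C by have := hC 1; rewrite expr1n mulr1; exact: le_trans.
  have : \forall h \near (0 : R)^', `|h| <= e / (C + 1).
    apply: nbhs_dnbhs; have := @nbhs0_le R R^o (e / (C + 1)); apply.
    by rewrite divr_gt0 // ltr_wpDl.
  apply: filterS => h he; rewrite [X in _ - X]/GRing.scale /=.
  rewrite [X in _ - X](_ : _ = h^-1 * flat p h); last first.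
    by rewrite {2}/flat ltxx subr0 addr0 [h *: 1]mulr1.
  rewrite sub0r normrN normrM normfV.
  have [->|hn] := eqVneq h 0; first by rewrite normr0 invr0 mul0r ltW.
  rewrite mulrC ler_pdivrMr ?normr_gt0 // (le_trans (hC h)) //.
  rewrite -(real_normK (num_real h)) expr2 mulrA ler_wpM2r //.
  move: he; rewrite ler_pdivlMr ?ltr_wpDl // => he.
  by apply: le_trans he; rewrite mulrC ler_wpM2l // lerDl.
Unshelve. all: by end_near. Qed.

Lemma flat_le0 p (t : R) : t <= 0 -> flat p t = 0.
Proof. by move=> t0; rewrite /flat ltNge t0. Qed.

End flat_functions.

Section bump.
Context {R : realType}.
Variable eps : R.
Hypothesis eps0 : 0 < eps.
Local Notation mu := (@lebesgue_measure R).

(** Sums of products of two flat functions, coded by the list of their polynomials. They vanish for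
    |t| >= eps, and differentiation acts on the list through [dbump], so all derivatives are
    explicit. *)
Let bumpf (L : seq ({poly R} * {poly R})) (t : R) : R :=
  \sum_(pq <- L) flat pq.1 (eps - t) * flat pq.2 (eps + t).

Let dflat (p : {poly R}) : {poly R} := 'X^2 * (p - p^`()).

Let dbump (L : seq ({poly R} * {poly R})) :=
  [seq (- dflat pq.1, pq.2) | pq <- L] ++ [seq (pq.1, dflat pq.2) | pq <- L].

Let flatN p (t : R) : flat (- p) t = - flat p t.
Proof. by rewrite /flat; case: ifP => _; rewrite ?oppr0 // hornerN mulNr. Qed.

Let is_derive_bumpf L (t : R) : is_derive t (1 : R) (bumpf L) (bumpf (dbump L) t).
Proof.
rewrite /dbump {2}/bumpf big_cat /= !big_map /= -big_split /=.
rewrite /bumpf; elim: L => [|[p q] L IH].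
  rewrite big_nil; under eq_fun do rewrite big_nil.
  exact: is_derive_cst.
rewrite big_cons; under eq_fun do rewrite big_cons.
apply: is_deriveD => /=.
have d1 : is_derive t (1 : R) (fun t => flat p (eps - t)) (flat (dflat p) (eps - t) * -1).
  apply: (@is_derive1_comp R (flat p) (fun t => eps - t)); first exact: is_derive_flat.
  by apply: (is_derive_eq (is_deriveB (is_derive_cst eps t 1) (is_derive_id t (1 : R)))); rewrite sub0r.
have d2 : is_derive t (1 : R) (fun t => flat q (eps + t)) (flat (dflat q) (eps + t) * 1).
  apply: (@is_derive1_comp R (flat q) (fun t => eps + t)); first exact: is_derive_flat.
  by apply: (is_derive_eq (is_deriveD (is_derive_cst eps t 1) (is_derive_id t (1 : R)))); rewrite add0r.
apply: (is_derive_eq (is_deriveM d1 d2)).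
by rewrite /GRing.scale /= flatN; ring.
Qed.

Let bumpf_out L t : eps <= `|t| -> bumpf L t = 0.
Proof.
move=> et; rewrite /bumpf big1 // => pq _.
have [t0|t0] := leP 0 t.
  by rewrite flat_le0 ?mul0r // subr_le0 -(ger0_norm t0).
rewrite [X in _ * X]flat_le0 ?mulr0 //.
by rewrite -[t]opprK subr_le0 -(ltr0_norm t0).
Qed.

Lemma derivatives_continuous (D : nat -> R -> R) :
  (forall k (t : R), is_derive t (1 : R) (D k) (D k.+1 t)) -> forall k, continuous (D k).
Proof.
move=> dD k t; apply: differentiable_continuous; apply/derivable1_diffP.
by apply: (@ex_derive _ _ _ _ _ _ _ (dD k t)).
Qed.

Lemma continuous_support_restrict (f : R -> R) : (forall t, eps <= `|t| -> f t = 0) ->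
  f \_ `[- eps, eps] = f.
Proof.
move=> f0; apply/funext => t; rewrite patchE; case: ifPn => // /negP.
rewrite inE /= in_itv /= => h; rewrite f0 // leNgt; apply/negP => te; apply: h.
by move: te; rewrite ltr_norml => /andP[h1 h2]; rewrite !ltW.
Qed.

Lemma continuous_support_integrable (f : R -> R) : continuous f ->
  (forall t, eps <= `|t| -> f t = 0) -> mu.-integrable setT (EFin \o f).
Proof.
move=> cf f0; rewrite -(continuous_support_restrict f0).
have : mu.-integrable `[- eps, eps] (EFin \o f).
  apply: continuous_compact_integrable; first exact: segment_compact.
  by apply: continuous_subspaceT.
move=> /integrable_mkcond => /(_ (measurable_itv _)).
by apply: eq_integrable => // t _ /=; rewrite restrict_EFin.
Qed.

(** [D k] is the k-th derivative, carried along with the bump so that differentiation is only a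
    change of index. Evenness makes the Fourier transform real; total mass 1 makes it 1 at the
    origin. *)
Lemma exists_bump : exists D : nat -> R -> R,
  [/\ (forall k (t : R), is_derive t (1 : R) (D k) (D k.+1 t)),
      (forall k t, eps <= `|t| -> D k t = 0), (forall t, 0 <= D 0%N t),
      (forall t, D 0%N (- t) = D 0%N t) & (\int[mu]_t D 0%N t = 1)%R].
Proof.
(* This list codes c exp(-1/(eps - t)) exp(-1/(eps + t)); scaling inside the polynomial keeps the
   normalised bump in the family. *)
pose L0 c : seq ({poly R} * {poly R}) := [:: (c%:P, 1)].
have b0 c t : bumpf (L0 c) t = c * bumpf (L0 1) t.
  by rewrite /bumpf !big_seq1 /= /flat !hornerC; case: ifP => _; rewrite ?mul0r ?mulr0 // !mul1r mulrA.
have bge t : 0 <= bumpf (L0 1) t.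
  rewrite /bumpf big_seq1 /= mulr_ge0 // /flat; case: ifP => // _.
    by rewrite hornerC mul1r expR_ge0.
  by rewrite hornerC mul1r expR_ge0.
have cb : continuous (bumpf (L0 1)).
  by apply: (@derivatives_continuous (fun k => bumpf (iter k dbump (L0 1))) _ 0%N) => k t; exact: is_derive_bumpf.
have ib := continuous_support_integrable cb (fun t => @bumpf_out (L0 1) t).
have I0 : 0 < (\int[mu]_t bumpf (L0 1) t)%R.
  have bpos : 0 < bumpf (L0 1) 0.
    by rewrite /bumpf big_seq1 /= subr0 addr0 /flat eps0 !hornerC !mul1r mulr_gt0 ?expR_gt0.
  have : \forall t \near (0 : R), bumpf (L0 1) 0 / 2 < bumpf (L0 1) t.
    have /cvgrPdist_lt/(_ (bumpf (L0 1) 0 / 2)) := @cb 0.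
    rewrite divr_gt0 // => /(_ isT); apply: filterS => x.
    by rewrite ltr_norml => /andP[_ h]; lra.
  move=> /nbhs_ballP[dl /= dl0 Hdl].
  pose J := `[- (dl / 2), dl / 2]%classic.
  have iJ : mu.-integrable setT (EFin \o \1_J) := integrable_indic_itv _ _ _ _.
  apply: (@lt_le_trans _ _ (\int[mu]_t (bumpf (L0 1) 0 / 2 * \1_J t))%R).
    rewrite RintegralZl // mulr_gt0 ?divr_gt0 //.
    rewrite /Rintegral integral_indic ?setIT //; last exact: measurable_itv.
    rewrite [X in fine X](lebesgue_measure_itv `[- (dl / 2), (dl / 2)]) /= lte_fin ifT; last lra.
    by rewrite -EFinB /=; lra.
  apply: le_Rintegral => //; first exact: integrable_realZl.
  move=> t _; rewrite indicE; case: (boolP (t \in J)) => tJ; last by rewrite mulr0.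
  rewrite mulr1 ltW //; apply: Hdl; rewrite /ball /= sub0r normrN.
  move: tJ; rewrite inE /J /= in_itv /= => /andP[h1 h2].
  by rewrite ltr_norml; apply/andP; split; lra.
exists (fun k => bumpf (iter k dbump (L0 (\int[mu]_t bumpf (L0 1) t)%R^-1))); split.
- by move=> k t; exact: is_derive_bumpf.
- by move=> k t; exact: bumpf_out.
- by move=> t /=; rewrite b0 mulr_ge0 // invr_ge0 ltW.
- move=> t /=; rewrite [LHS]b0 [RHS]b0; congr (_ * _); rewrite /bumpf !big_seq1 /= opprK.
  by rewrite mulrC.
- rewrite /=; under eq_Rintegral do rewrite b0.
  by rewrite RintegralZl // mulVf // gt_eqF.
Qed.

End bump.

(** * Fourier transform of the bump *)

Section bump_transform.
Context {R : realType}.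
Local Notation mu := (@lebesgue_measure R).

Lemma Rintegral_shift (f : R -> R) (v : R) : measurable_fun setT f ->
  (\int[mu]_t f (t + v) = \int[mu]_t f t)%R.
Proof.
move=> mf; congr fine.
apply: (@invariant_integral _ _ R mu (fun t : R => t + v) _ (fun t => (f t)%:E)).
  by move=> g; exact: integral_lebesgue_shift.
exact/measurable_EFinP.
Qed.

Lemma Rintegral_opp (f : R -> R) : measurable_fun setT f ->
  (\int[mu]_t f (- t) = \int[mu]_t f t)%R.
Proof.
move=> mf; congr fine.
apply: (@invariant_integral _ _ R mu (fun t : R => - t) _ (fun t => (f t)%:E)).
  by move=> g; exact: integral_lebesgue_opp.
exact/measurable_EFinP.
Qed.

Lemma integrable_oneDsqrV : mu.-integrable setT (EFin \o (fun t : R => (1 + t ^+ 2)^-1)).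
Proof.
have cf : continuous (fun t : R => (1 + t ^+ 2)^-1) by exact: continuous_oneDsqrV.
have p0 (t : R) : 0 <= (1 + t ^+ 2)^-1 by rewrite invr_ge0 addr_ge0 ?sqr_ge0.
apply/integrableP; split; first by apply/measurable_EFinP; exact: continuous_measurable_fun.
under eq_integral do rewrite /= ger0_norm //.
rewrite ge0_symfun_integralT //; last by move=> t /=; rewrite sqrrN.
rewrite -set_itvcy [X in (_ * X)%E](_ : _ = (pi / 2)%:E); first by rewrite -EFinM ltry.
exact: integral0y_oneDsqr.
Qed.

Variables (eps : R) (D : nat -> R -> R).
Hypothesis eps0 : 0 < eps.
Hypothesis dD : forall k (t : R), is_derive t (1 : R) (D k) (D k.+1 t).
Hypothesis D_out : forall k t, eps <= `|t| -> D k t = 0.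
Hypothesis D_ge0 : forall t, 0 <= D 0%N t.
Hypothesis D_even : forall t, D 0%N (- t) = D 0%N t.
Hypothesis D_int : (\int[mu]_t D 0%N t = 1)%R.

Let cD k : continuous (D k). Proof. exact: derivatives_continuous. Qed.

Lemma bump_mul_integrable k (g : R -> R) : continuous g ->
  mu.-integrable setT (EFin \o (fun t => D k t * g t)).
Proof.
move=> cg; apply: (@continuous_support_integrable _ eps) => [|t et].
  exact: continuousTM.
by rewrite D_out // mul0r.
Qed.

Let iD k : mu.-integrable setT (EFin \o D k).
Proof. by apply: (@continuous_support_integrable _ eps) => // t; exact: D_out. Qed.

Let ccos (x : R) : continuous (fun t : R => cos (t * x)).
Proof.
apply: continuousT_comp; last exact: continuous_cos.
by apply: continuousTM; [move=> t; exact: cvg_id|exact: cst_continuousT].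
Qed.

Let csin (x : R) : continuous (fun t : R => sin (t * x)).
Proof.
apply: continuousT_comp; last exact: continuous_sin.
by apply: continuousTM; [move=> t; exact: cvg_id|exact: cst_continuousT].
Qed.

Let cDcos k x : continuous (fun t => D k t * cos (t * x)).
Proof. by apply: continuousTM; [exact: cD|exact: ccos]. Qed.

Let cDsin k x : continuous (fun t => D k t * sin (t * x)).
Proof. by apply: continuousTM; [exact: cD|exact: csin]. Qed.

Let iDcos k x : mu.-integrable setT (EFin \o (fun t => D k t * cos (t * x))).
Proof. by apply: bump_mul_integrable; exact: ccos. Qed.

Let iDsin k x : mu.-integrable setT (EFin \o (fun t => D k t * sin (t * x))).
Proof. by apply: bump_mul_integrable; exact: csin. Qed.

Definition bump_hat (x : R) : R := (\int[mu]_t (D 0%N t * cos (t * x)))%R.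

Lemma bump_hat_sin (x : R) : (\int[mu]_t (D 0%N t * sin (t * x)) = 0)%R.
Proof.
have m : measurable_fun setT (fun t => D 0%N t * sin (t * x)).
  by apply: continuous_measurable_fun; exact: cDsin.
have := Rintegral_opp m.
under eq_Rintegral do rewrite D_even mulNr sinN mulrN -mulN1r.
rewrite RintegralZl //.
by rewrite mulN1r; lra.
Qed.

(** [D 0] is a probability density carried by [-eps, eps], so the integral is an average of [h] over
    that interval. *)
Let int_bound (h : R -> R) (C : R) : continuous h -> (forall t, `|t| <= eps -> `|h t| <= C) ->
  `|(\int[mu]_t (D 0%N t * h t))%R| <= C.
Proof.
move=> ch hC; apply: le_trans (le_normr_Rintegral _ _) _ => //.
  exact: bump_mul_integrable.
rewrite -[leRHS]mulr1 -D_int -RintegralZl //; apply: le_Rintegral => //.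
- exact: integrable_norm (bump_mul_integrable _ _).
- exact: integrable_realZl.
move=> t _; rewrite normrM ger0_norm // mulrC.
have [te|te] := leP `|t| eps; first by rewrite ler_wpM2r // hC.
by rewrite D_out ?mulr0 // ltW.
Qed.

Lemma bump_hat_le1 (x : R) : `|bump_hat x| <= 1.
Proof. by apply: (int_bound (@ccos x)) => t _; exact: cos_max. Qed.

Let cos_lip (a b : R) : `|cos a - cos b| <= `|a - b|.
Proof.
wlog ab : a b / a <= b => [H|].
  have [/H//|/ltW/H] := leP a b; by rewrite distrC (distrC b).
have [c _ E] := MVT_everywhere ab (fun t => is_derive_cos t).
by rewrite distrC E normrM normrN (distrC a) ler_piMl // sin_max.
Qed.

(** The cosine is 1-Lipschitz and |t| <= eps on the support. With the value 1 at the origin, this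
    makes the transform close to 1 on bounded sets when [eps] is small. *)
Lemma bump_hat_lip (x y : R) : `|bump_hat x - bump_hat y| <= eps * `|x - y|.
Proof.
rewrite /bump_hat -RintegralB //.
under eq_Rintegral do rewrite -mulrBr.
apply: int_bound => [|t te]; first by apply: continuousTB; exact: ccos.
apply: le_trans (cos_lip _ _) _; rewrite -mulrBr normrM.
by rewrite ler_wpM2r.
Qed.

Lemma bump_hat0 : bump_hat 0 = 1.
Proof.
rewrite /bump_hat -D_int; apply: eq_Rintegral => t _.
by rewrite mulr0 cos0 mulr1.
Qed.

Lemma continuous_bump_hat : continuous bump_hat.
Proof.
move=> x; apply/cvgrPdist_le => /= e e0; near=> y.
apply: le_trans (bump_hat_lip x y) _.
rewrite -ler_pdivlMl // mulrC; near: y.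
have : 0 < e / eps by rewrite divr_gt0.
by move=> /(@nbhs_closedball_in _ _ x _) || (move=> ee; apply/nbhs_ballP; exists (e / eps) => // y /ltW).
Unshelve. all: by end_near. Qed.

(** Integrating by parts twice trades the factor x^2 for a second derivative of the bump; the decay
    gives integrability. *)
Lemma bump_hat_decay : exists C : R, forall x, `|bump_hat x| <= C * (1 + x ^+ 2)^-1.
Proof.
pose B := (\int[mu]_t `|D 2 t|)%R.
have B0 : 0 <= B by apply: Rintegral_ge0.
have key x : x ^+ 2 * bump_hat x = - (\int[mu]_t (D 2 t * cos (t * x)))%R.
  (* In the derivative of [G] the terms with [D 1] cancel and [g] remains; [G] vanishes at both ends
     of the support, so [g] integrates to 0. *)
  pose G (t : R) := D 1%N t * cos (t * x) + x * (D 0%N t * sin (t * x)).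
  pose g (t : R) := D 2 t * cos (t * x) + x ^+ 2 * (D 0%N t * cos (t * x)).
  have dG (t : R) : is_derive t (1 : R) G (g t).
    have e1 : is_derive t (1 : R) (fun t => cos (t * x)) (- (x * sin (t * x))).
      have h := @is_derive1_comp R cos (fun t => t * x) t (- sin (t * x)) x _ _.
      by apply: is_derive_eq (h _ _) _; rewrite ?mulNr ?(mulrC x) //; apply: is_derive_eq; rewrite /GRing.scale /=; ring.
    have e2 : is_derive t (1 : R) (fun t => sin (t * x)) (x * cos (t * x)).
      have h := @is_derive1_comp R sin (fun t => t * x) t (cos (t * x)) x _ _.
      by apply: is_derive_eq (h _ _) _; rewrite ?(mulrC x) //; apply: is_derive_eq; rewrite /GRing.scale /=; ring.
    have e3 := is_deriveD (is_deriveM (dD 1 t) e1)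
      (is_deriveM (is_derive_cst x t 1) (is_deriveM (dD 0 t) e2)).
    by apply: (is_derive_eq e3); rewrite /GRing.scale /= /g; ring.
  have cg : continuous g.
    apply: continuousTD; first exact: cDcos.
    by apply: continuousTM; [exact: cst_continuousT|exact: cDcos].
  have cG : continuous G.
    apply: continuousTD; first exact: cDcos.
    by apply: continuousTM; [exact: cst_continuousT|exact: cDsin].
  have g0 t : eps <= `|t| -> g t = 0 by move=> te; rewrite /g !D_out // !mul0r mulr0 addr0.
  have G0 t : eps <= `|t| -> G t = 0 by move=> te; rewrite /G !D_out // !mul0r mulr0 addr0.
  have Ig : (\int[mu]_t g t = 0)%R.
    rewrite -(continuous_support_restrict g0) -Rintegral_mkcond /Rintegral.
    rewrite (@continuous_FTC2 R g G) //=.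
    - by rewrite !G0 ?subr0 // ?normrN gtr0_norm.
    - by rewrite (@lt_trans _ _ 0) // oppr_lt0.
    - exact: continuous_subspaceT.
    - split; first by move=> t _; exact: (@ex_derive _ _ _ _ _ _ _ (dG t)).
        by apply: cvg_at_right_filter; exact: cG.
      by apply: cvg_at_left_filter; exact: cG.
    - by move=> t _; rewrite derive1E; exact: (@derive_val _ _ _ _ _ _ _ (dG t)).
  move: Ig; rewrite /g RintegralD //; last exact: integrable_realZl.
  by rewrite RintegralZl //; rewrite /bump_hat; lra.
exists (1 + B) => x; have x2 : 0 < 1 + x ^+ 2 by rewrite ltr_wpDr ?sqr_ge0.
rewrite ler_pdivlMr // mulrDr mulr1 lerD ?bump_hat_le1 //.
rewrite -[X in _ * X]ger0_norm ?sqr_ge0 // -normrM mulrC key normrN.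
apply: le_trans (le_normr_Rintegral _ _) _ => //.
apply: le_Rintegral => //.
- exact: integrable_norm (iDcos _ _).
- exact: integrable_norm.
by move=> t _; rewrite normrM -[leRHS]mulr1 ler_wpM2l // cos_max.
Qed.

Lemma integrable_bump_hat : mu.-integrable setT (EFin \o bump_hat).
Proof.
have [C hC] := bump_hat_decay.
apply: (@le_integrable_real _ _ R mu bump_hat (fun x => C * (1 + x ^+ 2)^-1)) => //.
  exact: continuous_measurable_fun continuous_bump_hat.
exact: integrable_realZl integrable_oneDsqrV.
Qed.

(** The odd part integrates to 0. The free phase [th] covers the sine transform too, which is needed
    when a cosine of a sum is split over several coordinates. *)
Lemma bump_fourier1 (th a x : R) :
  (\int[mu]_t (cos (th + t * x) * D 0%N (t - a)) = cos (th + a * x) * bump_hat x)%R.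
Proof.
rewrite -(@Rintegral_shift _ a); last first.
  apply: continuous_measurable_fun; apply: continuousTM.
    apply: continuousT_comp; last exact: continuous_cos.
    apply: continuousTD; first exact: cst_continuousT.
    by apply: continuousTM; [move=> t; exact: cvg_id|exact: cst_continuousT].
  apply: (@continuousT_comp _ _ (fun t => t - a) (D 0%N)); last exact: cD.
  by apply: continuousTB; [move=> t; exact: cvg_id|exact: cst_continuousT].
rewrite (@eq_Rintegral _ _ _ mu setT (fun t => cos (th + a * x) * (D 0%N t * cos (t * x)) -
    sin (th + a * x) * (D 0%N t * sin (t * x)))).
  rewrite RintegralB //; [|exact: integrable_realZl..].
  by rewrite !RintegralZl ?bump_hat_sin ?mulr0 ?subr0.
move=> t _; rewrite addrK (_ : th + (t + a) * x = (th + a * x) + t * x); last by ring.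
by rewrite cosD; ring.
Qed.

Lemma integrable_bump_fourier1 (th a x : R) :
  mu.-integrable setT (EFin \o (fun t => cos (th + t * x) * D 0%N (t - a))).
Proof.
apply: (@continuous_support_integrable _ (eps + `|a|)) => [|t te].
  apply: continuousTM.
    apply: continuousT_comp; last exact: continuous_cos.
    apply: continuousTD; first exact: cst_continuousT.
    by apply: continuousTM; [move=> t; exact: cvg_id|exact: cst_continuousT].
  apply: (@continuousT_comp _ _ (fun t => t - a) (D 0%N)); last exact: cD.
  by apply: continuousTB; [move=> t; exact: cvg_id|exact: cst_continuousT].
rewrite D_out ?mulr0 //; have := ler_normD (t - a) a; rewrite subrK; lra.
Qed.

End bump_transform.

Section product_bump.
Context {R : realType} {n : nat}.
Local Notation V := 'rV[R]_n.
Variable D : nat -> R -> R.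
Hypothesis dD : forall k (t : R), is_derive t (1 : R) (D k) (D k.+1 t).
Variable a : V.

(** [k] is a multi-index of derivative orders, so that every iterated partial derivative is again of
    this form. *)
Definition prod_bump (k : 'I_n -> nat) (x : V) : R := \prod_i D (k i) (x ord0 i - a ord0 i).

Let incr (i : 'I_n) (k : 'I_n -> nat) : 'I_n -> nat := fun j => ((j == i) + k j)%N.

Lemma continuous_prod_bump k : continuous (prod_bump k).
Proof.
apply: (continuous_prod_coord (u := fun i t => D (k i) (t - a ord0 i))) => i.
apply: (@continuousT_comp _ _ (fun t => t - a ord0 i) (D (k i))); last exact: derivatives_continuous.
by apply: continuousTB; [move=> t; exact: cvg_id|exact: cst_continuousT].
Qed.

Lemma is_derive_along_line (u : V -> R) (x v : V) (l : R) :
  is_derive (0 : R) (1 : R) (fun h : R => u (h *: v + x)) l -> is_derive x v u l.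
Proof.
have E : (fun h : R => h^-1 *: ((u \o shift x) (h *: v) - u x)) =
    (fun h : R => h^-1 *: (((fun h : R => u (h *: v + x)) \o shift 0) (h *: (1 : R)) -
      (fun h : R => u (h *: v + x)) 0)).
  apply/funext => h /=; rewrite addr0 scale0r add0r.
  by rewrite (_ : h *: (1 : R) = h) //; exact: mulr1.
by case=> d1 d2; apply: DeriveDef; rewrite /derivable /derive E.
Qed.

Lemma is_derive_prod_bump i k (x : V) :
  is_derive x (delta_mx ord0 i : V) (prod_bump k) (prod_bump (incr i k) x).
Proof.
apply: is_derive_along_line.
pose P := \prod_(j < n | j != i) D (k j) (x ord0 j - a ord0 j).
rewrite (_ : (fun h : R => _) = (fun h : R => P * D (k i) (h + (x ord0 i - a ord0 i)))); last first.
  apply/funext => h; rewrite /prod_bump (bigD1 i) //= mulrC; congr (_ * D _ _).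
    apply: eq_bigr => j ji; rewrite !mxE (negbTE ji) andbF mulr0 add0r //.
  by rewrite !mxE !eqxx mulr1 addrA.
rewrite (_ : prod_bump _ _ = P * D (k i).+1 (0 + (x ord0 i - a ord0 i))); last first.
  rewrite /prod_bump (bigD1 i) //= mulrC /incr eqxx add0r; congr (_ * _).
  by apply: eq_bigr => j ji; rewrite (negbTE ji).
have d1 : is_derive (0 : R) (1 : R) (fun h : R => D (k i) (h + (x ord0 i - a ord0 i)))
    (D (k i).+1 (0 + (x ord0 i - a ord0 i))).
  have h := @is_derive1_comp R (D (k i)) (fun h : R => h + (x ord0 i - a ord0 i)) 0
    (D (k i).+1 (0 + (x ord0 i - a ord0 i))) 1 _ _.
  by rewrite -[X in is_derive _ _ _ X]mulr1; apply: h; exact: is_derive_shift.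
apply: (is_derive_eq (is_deriveM (is_derive_cst P (0 : R) 1) d1)).
by rewrite /GRing.scale /=; ring.
Qed.

Lemma smooth_prod_bump k : smooth_real (prod_bump k).
Proof.
move=> s; have [k' /= ->] : exists k', foldr (@partial R n) (prod_bump k) s = prod_bump k'.
  elim: s => [|i s [k' IH]] /=; first by exists k.
  exists (incr i k'); rewrite IH; apply/funext => x.
  by apply: (@derive_val _ _ _ _ _ _ _ (is_derive_prod_bump i k' x)).
split; first exact: continuous_prod_bump.
by move=> i x; apply: (@ex_derive _ _ _ _ _ _ _ (is_derive_prod_bump i k' x)).
Qed.

Lemma smooth_real0 : smooth_real (fun _ : V => 0 : R).
Proof.
move=> s; have /= -> : foldr (@partial R n) (fun _ : V => 0 : R) s = fun _ => 0.
  elim: s => [|i s IH] //=; rewrite IH; apply/funext => x.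
  by apply: (@derive_val _ _ _ _ _ _ _ (is_derive_cst (0 : R) x (delta_mx ord0 i : V))).
split; first exact: cst_continuousT.
by move=> i x; apply: (@ex_derive _ _ _ _ _ _ _ (is_derive_cst (0 : R) x (delta_mx ord0 i : V))).
Qed.

End product_bump.

Section euclidean.
Context {R : realType} {n : nat}.
Local Notation V := 'rV[R]_n.

Lemma dotC (x y : V) : dot x y = dot y x.
Proof. by apply: eq_bigr => i _; rewrite mulrC. Qed.

Lemma dotDr (a x y : V) : dot a (x + y) = dot a x + dot a y.
Proof. by rewrite /dot -big_split; apply: eq_bigr => i _; rewrite mxE mulrDr. Qed.

Lemma dotZr (a x : V) c : dot a (c *: x) = c * dot a x.
Proof. by rewrite /dot mulr_sumr; apply: eq_bigr => i _; rewrite mxE mulrCA. Qed.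

Lemma dotNr (a x : V) : dot a (- x) = - dot a x.
Proof. by rewrite -scaleN1r dotZr mulN1r. Qed.

Lemma dotNl (a x : V) : dot (- a) x = - dot a x.
Proof. by rewrite dotC dotNr dotC. Qed.

Lemma coord_le_enorm (x : V) i : `|x ord0 i| <= enorm x.
Proof.
rewrite -sqrtr_sqr ler_wsqrtr // /dot (bigD1 i) //= -expr2 lerDl.
by apply: sumr_ge0 => j _; rewrite -expr2 sqr_ge0.
Qed.

Lemma dot_le_enorm (x y : V) : `|dot x y| <= enorm x * \sum_i `|y ord0 i|.
Proof.
apply: le_trans (ler_norm_sum _ _ _) _; rewrite mulr_sumr; apply: ler_sum => i _.
by rewrite normrM ler_wpM2r // coord_le_enorm.
Qed.

Lemma enormN (x : V) : enorm (- x) = enorm x.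
Proof. by rewrite /enorm dotNl dotNr opprK. Qed.

(** The bump lives on a cube while spectra are tested on open Euclidean balls; sqrt n < n + 1 leaves
    room in every dimension. *)
Lemma cube_sub_eball (a : V) (eps : R) : 0 < eps ->
  [set x : V | forall i, `|x ord0 i - a ord0 i| <= eps] `<=` eball a (n.+1%:R * eps).
Proof.
move=> e0 x /= hx; rewrite /eball /= /enorm.
have ne0 : 0 < n.+1%:R * eps by rewrite mulr_gt0.
rewrite -[ltRHS]gtr0_norm // -sqrtr_sqr ltr_sqrt ?exprn_gt0 //.
apply: (@le_lt_trans _ _ (\sum_(i < n) eps ^+ 2)).
  apply: ler_sum => i _; rewrite !mxE -expr2 -[leLHS]real_normK ?num_real //.
  by rewrite lerXn2r ?nnegrE // ltW.
rewrite sumr_const card_ord -[_ *+ n]mulr_natl exprMn ltr_pM2r ?exprn_gt0 //.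
by rewrite -natrX ltr_nat -mulnn (leq_trans (ltnSn n)) // leq_pmulr.
Qed.

Lemma closed_cube (a : V) (eps : R) :
  closed [set x : V | forall i, `|x ord0 i - a ord0 i| <= eps].
Proof.
rewrite (_ : [set _ | _] = \bigcap_(i in [set: 'I_n]) ((fun x : V => `|x ord0 i - a ord0 i|) @^-1` [set y | y <= eps])).
  apply: closed_bigI => i _; move: (@closed_le R eps); apply: (continuous_closedP _).1.
  apply: (@continuousT_comp _ _ (fun x : V => x ord0 i - a ord0 i) (fun t => `|t|)).
    by apply: continuousTB; [exact: continuous_coord|exact: cst_continuousT].
  by move=> y; exact: norm_continuous.
by apply/seteqP; split => [x h i _|x h i]; [exact: h|exact: (h i I)].
Qed.

End euclidean.

(** * Mollification and the spectrum *)

Section bump_spectrum.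
Context {R : realType}.
Variables (eps : R) (D : nat -> R -> R).
Hypothesis eps0 : 0 < eps.
Hypothesis dD : forall k (t : R), is_derive t (1 : R) (D k) (D k.+1 t).
Hypothesis D_out : forall k t, eps <= `|t| -> D k t = 0.
Hypothesis D_ge0 : forall t, 0 <= D 0%N t.
Hypothesis D_even : forall t, D 0%N (- t) = D 0%N t.
Hypothesis D_int : (\int[@lebesgue_measure R]_t D 0%N t = 1)%R.

Let ib1 := integrable_bump_fourier1 dD D_out.
Let bf1 := bump_fourier1 dD D_out D_even.
Let cbh := @continuous_bump_hat _ _ _ eps0 dD D_out D_ge0 D_int.
Let ibh := integrable_bump_hat eps0 dD D_out D_ge0 D_int.
Let bh1 := bump_hat_le1 dD D_out D_ge0 D_int.

Definition mollifier n (x : 'rV[R]_n) : R := \prod_i bump_hat D (x ord0 i).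

Lemma dot_cons n (x y : 'rV[R]_n.+1) :
  dot x y = x ord0 ord0 * y ord0 ord0 + dot (rV_tail x) (rV_tail y).
Proof. by rewrite /dot big_ord_recl; congr (_ + _); apply: eq_bigr => i _; rewrite !mxE. Qed.

Lemma mollifier_cons n (x : 'rV[R]_n.+1) :
  mollifier x = bump_hat D (x ord0 ord0) * mollifier (rV_tail x).
Proof. by rewrite /mollifier big_ord_recl; congr (_ * _); apply: eq_bigr => i _; rewrite mxE. Qed.

Let phi n (a : 'rV[R]_n) : 'rV[R]_n -> R := prod_bump D a (fun=> 0%N).

Let phi_cons n (a x : 'rV[R]_n.+1) :
  phi a x = D 0%N (x ord0 ord0 - a ord0 ord0) * phi (rV_tail a) (rV_tail x).
Proof. by rewrite /phi /prod_bump big_ord_recl; congr (_ * _); apply: eq_bigr => i _; rewrite !mxE. Qed.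

Let integrable_phi n (a x : 'rV[R]_n) (th : R) :
  (lebesgue_rV R n).-integrable setT (EFin \o (fun t => cos (th + dot t x) * phi a t)).
Proof.
have iphi : (lebesgue_rV R n).-integrable setT (EFin \o phi a).
  apply: (@integrable_rV_prod R n (fun i t => D 0%N (t - a ord0 i))) => i.
  have := ib1 0 (a ord0 i) 0.
  by apply: eq_integrable => // t _ /=; rewrite mulr0 addr0 cos0 mul1r.
have := @integrable_mul_bounded _ _ _ _ 1 _ (fun t : 'rV[R]_n => cos (dot x t + th)) iphi.
rewrite (_ : (fun t => phi a t * _) = (fun t => cos (th + dot t x) * phi a t)).
  apply; last by move=> t; exact: cos_max.
  by apply: continuous_measurable_rV; exact: continuous_cos_dot.
by apply/funext => t; rewrite mulrC addrC dotC.
Qed.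

(** Induction on [n]: cos(A + B) = cos A cos B - sin A sin B separates the first coordinate, and
    each sine is a cosine with phase -pi/2, which the induction hypothesis covers because [th] is
    arbitrary. *)
Lemma prod_bump_fourier n (a x : 'rV[R]_n) (th : R) :
  (\int[lebesgue_rV R n]_t (cos (th + dot t x) * phi a t) = cos (th + dot a x) * mollifier x)%R.
Proof.
elim: n a x th => [|n IH] a x th.
  by rewrite Rintegral_rV0 /phi /prod_bump /mollifier /dot !big_ord0.
have hsin (y : R) : sin y = cos (y - pi / 2) by rewrite cosBpihalf.
pose x0 := x ord0 ord0; pose a0 := a ord0 ord0.
pose u1 (t : R) := cos (th + t * x0) * D 0%N (t - a0).
pose u2 (t : R) := cos ((th - pi / 2) + t * x0) * D 0%N (t - a0).
pose w1 (t : 'rV[R]_n) := cos (0 + dot t (rV_tail x)) * phi (rV_tail a) t.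
pose w2 (t : 'rV[R]_n) := cos (- (pi / 2) + dot t (rV_tail x)) * phi (rV_tail a) t.
have iu1 := ib1 th a0 x0.
have iu2 := ib1 (th - pi / 2) a0 x0.
have iw1 := integrable_phi (rV_tail a) (rV_tail x) 0.
have iw2 := integrable_phi (rV_tail a) (rV_tail x) (- (pi / 2)).
rewrite (@eq_Rintegral _ _ _ (lebesgue_rV R n.+1) setT
   (fun t => u1 (t ord0 ord0) * w1 (rV_tail t) - u2 (t ord0 ord0) * w2 (rV_tail t))).
  rewrite RintegralB //; [|exact: integrable_rV_mul..].
  rewrite !Rintegral_rV_mul // !bf1 !IH.
  rewrite mollifier_cons dot_cons -/x0 -/a0.
  rewrite add0r -addrAC -hsin [- (pi / 2) + _]addrC -hsin addrA (cosD (th + _)).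
  by ring.
move=> t _; rewrite /u1 /u2 /w1 /w2 dot_cons phi_cons -/x0 -/a0.
rewrite add0r -addrAC -hsin [- (pi / 2) + _]addrC -hsin addrA (cosD (th + _)).
by ring.
Qed.

Lemma continuous_mollifier n : continuous (@mollifier n).
Proof. by apply: (continuous_prod_coord (u := fun=> bump_hat D)) => i; exact: cbh. Qed.

Lemma integrable_mollifier n : (lebesgue_rV R n).-integrable setT (EFin \o @mollifier n).
Proof. by apply: (@integrable_rV_prod R n (fun=> bump_hat D)) => i; exact: ibh. Qed.

Lemma mollifier_le1 n (x : 'rV[R]_n) : `|mollifier x| <= 1.
Proof.
rewrite /mollifier normr_prod; elim: (index_enum _) => [|i r IH]; first by rewrite big_nil.
by rewrite big_cons mulr_ile1 // ?prodr_ge0 // bh1.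
Qed.

(** Each factor is within eps |x_i| of 1 and all are bounded by 1, so the errors add. *)
Lemma mollifier_near1 n (x : 'rV[R]_n) : `|mollifier x - 1| <= eps * \sum_i `|x ord0 i|.
Proof.
rewrite /mollifier; elim: (index_enum _) => [|i r IH].
  by rewrite !big_nil subrr normr0 mulr0.
rewrite !big_cons; set P := \prod_(j <- r) _ in IH *.
rewrite (_ : _ * P - 1 = bump_hat D (x ord0 i) * (P - 1) + (bump_hat D (x ord0 i) - 1)); last by ring.
apply: le_trans (ler_normD _ _) _; rewrite [leRHS]mulrDr [leLHS]addrC; apply: lerD.
  have := bump_hat_lip dD D_out D_ge0 D_int (x ord0 i) 0.
  by rewrite bump_hat0 // subr0.
apply: le_trans IH; rewrite normrM ler_piMl //; exact: bh1.
Qed.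

Local Open Scope complex_scope.

(** The product bump centred at [a] is an admissible test function, and its Fourier transform is
    exp(-i a.x) times the mollifier. *)
Lemma spectrum_mollified n (S : set 'rV[R]_n) (f : 'rV[R]_n -> R[i]) (a : 'rV[R]_n) :
  spectrum_in S f -> eball a (n.+1%:R * eps) `&` S = set0 ->
  integral_rV (fun x => f x * (expi (- dot a x) * (mollifier x)%:C)) = 0.
Proof.
move=> Sf aS; have r0 : 0 < n.+1%:R * eps by rewrite mulr_gt0.
have := Sf (fun x => (phi a x)%:C) a _ r0.
rewrite (_ : fourier _ = (fun x => expi (- dot a x) * (mollifier x)%:C)); last first.
  apply/funext => x; rewrite /fourier /integral_rV /expi /=.
  rewrite (@eq_Rintegral _ _ _ (lebesgue_rV R n) setT (fun t => cos (0 + dot t x) * phi a t)); last first.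
    by move=> t _ /=; rewrite mulr0 subr0 cosN add0r.
  rewrite [X in _ +i* X](@eq_Rintegral _ _ _ (lebesgue_rV R n) setT (fun t => cos (pi / 2 + dot t x) * phi a t)); last first.
    by move=> t _ /=; rewrite mulr0 add0r sinN addrC cosDpihalf.
  rewrite !prod_bump_fourier; apply/eqP; rewrite eq_complex /=.
  by rewrite !mulr0 subr0 add0r cosN sinN add0r [pi / 2 + _]addrC cosDpihalf !eqxx.
apply => //.
  split; first exact: smooth_prod_bump.
  exact: smooth_real0.
apply: subset_trans (cube_sub_eball eps0).
rewrite /csupport [X in _ `<=` X](closure_id _).1; last exact: closed_cube.
apply: closure_subset => x /= hx i; rewrite leNgt; apply/negP => xi.
move/eqP: hx; apply; congr (_%:C).
by rewrite /phi /prod_bump (bigD1 i) //= D_out ?mul0r // ltW.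
Qed.

End bump_spectrum.

(** * Series of translates *)

Section normal_convergence.
Context {T : topologicalType} {R : realType}.
Variables (h : nat -> T -> R) (d : nat -> R).
Hypotheses (ch : forall j, continuous (h j)) (hd : forall j x, `|h j x| <= d j).
Hypothesis cd : cvgn (series d).

Lemma normal_series_cvg x : series (h ^~ x) @ \oo --> limn (series (h ^~ x)).
Proof.
have : cvgn (series (h ^~ x)) by apply: dominated_series_cvg cd => j; exact: hd.
by [].
Qed.

(** The Weierstrass M-test: the partial sums are uniformly close to the limit, with error at most a
    tail of [d]. *)
Lemma continuous_normal_series : continuous (fun x => limn (series (h ^~ x))).
Proof.
have [D dD] : exists D : R, series d @ \oo --> D by move/cvg_ex : cd.
have d0 j (x : T) : 0 <= d j by apply: le_trans (hd j x).
have bnd x k : `|limn (series (h ^~ x)) - series (h ^~ x) k| <= D - series d k.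
  apply: (@cvg_seq_le _ (fun m => `|series (h ^~ x) (m + k)%N - series (h ^~ x) k|)).
    apply: cvg_norm; apply: cvgB; last exact: cvg_cst.
    by have := @normal_series_cvg x; rewrite -(cvg_shiftn k).
  move=> m; apply: (@le_trans _ _ (series d (m + k)%N - series d k)).
    rewrite !sub_series_geq ?leq_addl //.
    by apply: le_trans (ler_norm_sum _ _ _) _; apply: ler_sum => j _; exact: hd.
  by rewrite lerD2r; apply: series_le_lim dD _ => j; exact: d0 x.
move=> x; apply/cvgrPdist_le => /= e e0.
have e3 : 0 < e / 3 by rewrite divr_gt0.
have /cvgrPdist_le/(_ _ e3)[k _ /(_ k (leqnn k)) /= hk] := dD.
have Dk : D - series d k <= e / 3 by apply: le_trans hk; exact: ler_norm.
have : continuous (fun x => series (h ^~ x) k).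
  by rewrite /series /=; apply: continuousT_sum => j; exact: ch.
move=> /(_ x) /cvgrPdist_le/(_ _ e3); apply: filterS => y /= hy.
have b1 := le_trans (bnd x k) Dk; have b2 := le_trans (bnd y k) Dk.
move: b1 hy b2; rewrite !ler_norml => /andP[? ?] /andP[? ?] /andP[? ?].
by apply/andP; split; lra.
Qed.

End normal_convergence.

Section series_integral.
Context d (T : measurableType d) (R : realType) (mu : {measure set T -> \bar R}).
Variable h : nat -> T -> R.
Hypothesis ih : forall j, mu.-integrable setT (EFin \o h j).

Lemma Rintegral_series N : mu.-integrable setT (EFin \o (fun x => series (h ^~ x) N)) /\
  (\int[mu]_x series (h ^~ x) N = series (fun j => \int[mu]_x h j x) N)%R.
Proof.
elim: N => [|N [IH1 IH2]].
  have E : (fun x => series (h ^~ x) 0%N) = cst 0.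
    by apply/funext => x; rewrite /series /= big_geq.
  rewrite E; split; first by have := integrable0 mu setT; apply: eq_integrable.
  by rewrite Rintegral_cst // mul0r /series /= big_geq.
have E : (fun x => series (h ^~ x) N.+1) = (fun x => series (h ^~ x) N + h N x).
  by apply/funext => x; rewrite /series /= big_nat_recr.
rewrite E; split; first exact: integrable_realD.
by rewrite RintegralD // IH2 [in RHS]/series /= big_nat_recr.
Qed.

(** By monotone convergence the integral of the sum is the sum of the integrals, which is finite. *)
Lemma integrable_series (S : T -> R) :
  (forall j x, 0 <= h j x) -> measurable_fun setT S ->
  (forall x, series (h ^~ x) @ \oo --> S x) ->
  cvgn (series (fun j => \int[mu]_x h j x)%R) -> mu.-integrable setT (EFin \o S).
Proof.
move=> h0 mS hS /cvg_ex[/= l hl].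
have nd x : nondecreasing_seq (series (h ^~ x)).
  by apply/nondecreasing_seqP => m; rewrite seriesEnat /= big_nat_recr //= lerDl.
have S0 x : 0 <= S x.
  apply: le_trans (series_le_lim (fun j => h0 j x) (hS x) 0).
  by rewrite /series /= big_geq.
apply/integrableP; split; first exact/measurable_EFinP.
have L : (\int[mu]_x limn (fun N => (series (h ^~ x) N)%:E) = \int[mu]_x `|(EFin \o S) x|)%E.
  apply: eq_integral => x _; rewrite /= ger0_norm //.
  by apply/cvg_lim => //; apply: cvg_EFin; [exact: nearW|exact: hS].
have E N : (\int[mu]_x (series (h ^~ x) N)%:E = (series (fun j => \int[mu]_x h j x)%R N)%:E)%E.
  have [i1 <-] := Rintegral_series N.
  by rewrite /Rintegral fineK //; exact: integrable_fin_num.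
have m1 N : measurable_fun setT (fun x => (series (h ^~ x) N)%:E).
  by apply/measurable_EFinP; exact: integrable_measurable (Rintegral_series N).1.
have m2 N x : setT x -> (0 <= (series (h ^~ x) N)%:E)%E.
  by rewrite lee_fin /series /= sumr_ge0.
have m3 x : setT x -> nondecreasing_seq (fun N => (series (h ^~ x) N)%:E).
  by move=> _ m k mk; rewrite lee_fin; exact: nd.
have H := cvg_monotone_convergence measurableT m1 m2 m3.
rewrite -L.
have {}H : (fun N => (series (fun j => \int[mu]_x h j x)%R N)%:E) @ \oo -->
    (\int[mu]_x limn (fun N => (series (h ^~ x) N)%:E))%E.
  by rewrite -(funext E); exact: H.
rewrite (cvg_unique _ H (_ : _ --> l%:E)) ?ltry //.
by apply: cvg_EFin; [exact: nearW|exact: hl].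
Qed.

End series_integral.

Section annihilation.
Context {R : realType} {n : nat}.
Local Notation V := 'rV[R]_n.
Local Notation mu := (lebesgue_rV R n).

Lemma Rintegral_rV_shift (f : V -> R) (z : V) : measurable_fun setT f ->
  (\int[mu]_x f (x + z) = \int[mu]_x f x)%R.
Proof.
by move=> mf; congr fine; apply: (integral_rV_shift z (f := EFin \o f)); exact/measurable_EFinP.
Qed.

Lemma integrable_rV_shift (f : V -> R) (z : V) : mu.-integrable setT (EFin \o f) ->
  mu.-integrable setT (EFin \o (fun x => f (x + z))).
Proof.
move=> /integrableP[mf lf]; apply/integrableP; split.
  by apply: measurableT_comp mf _; exact: measurable_rV_shift.
have -> // := ge0_integral_rV_shift z (f := fun x => `|(EFin \o f) x|%E).
exact: measurableT_comp.
Qed.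

Lemma cvg_rV (T : Type) (F : set_system T) (FF : Filter F) (u : T -> V) (l : V) :
  (forall i, u k ord0 i @[k --> F] --> l ord0 i) -> u @ F --> l.
Proof.
move=> h; apply/cvg_ballP => e e0.
have : forall i, \forall k \near F, ball (l ord0 i) e (u k ord0 i).
  by move=> i; apply: cvg_ball => //; exact: h.
by move=> /filter_forall; apply: filterS => k H; split => // i j; rewrite ord1.
Qed.

Lemma continuous_rV_shift (f : V -> R) (z : V) : continuous f ->
  continuous (fun x : V => f (x + z)).
Proof.
move=> cf x; apply: (@continuous_comp _ _ _ (fun x : V => x + z)); last exact: cf.
apply: (@cvg_rV _ (nbhs x)) => i; rewrite !mxE.
rewrite (_ : (fun k : V => (k + z) ord0 i) = (fun k : V => k ord0 i + z ord0 i)).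
  by apply: cvgD; [exact: coord_continuous|exact: cvg_cst].
by apply/funext => k; rewrite mxE.
Qed.

Variables (w : V -> R) (M : R) (v : V) (c c' t : nat -> R).
Hypotheses (cw : continuous w) (wM : forall x, `|w x| <= M).
Hypothesis iw : mu.-integrable setT (EFin \o w).
Hypothesis cc : cvgn (series (fun j => `|c j| + `|c' j|)).
Hypothesis dichotomy : forall a : V,
  (forall th, (\int[mu]_x (w x * cos (dot a x + th)) = 0)%R) \/
  (series (fun j => (c j + c' j) * cos (t j * dot a v)) @ \oo --> 0 /\
   series (fun j => (c j - c' j) * sin (t j * dot a v)) @ \oo --> 0).

Let h j (x : V) := c j * w (x + t j *: v) + c' j * w (x - t j *: v).

Let cshift (z : V) : continuous (fun x : V => w (x + z)).
Proof. exact: continuous_rV_shift. Qed.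

Let ch j : continuous (h j).
Proof.
by apply: continuousTD; apply: continuousTM; try exact: cst_continuousT; exact: cshift.
Qed.

Let ishift z : mu.-integrable setT (EFin \o (fun x => w (x + z))).
Proof. exact: integrable_rV_shift. Qed.

Let hbound j x : `|h j x| <= M * (`|c j| + `|c' j|).
Proof.
apply: le_trans (ler_normD _ _) _; rewrite !normrM mulrDr.
by apply: lerD; rewrite mulrC ler_wpM2r.
Qed.

(** After the translation the cosine carries the phase th - r a.v; expanding it leaves only the
    phases [th] and th - pi/2. *)
Let integral_shift_cos a th (r : R) :
  (\int[mu]_x (w (x + r *: v) * cos (dot a x + th)) =
   cos (r * dot a v) * (\int[mu]_x (w x * cos (dot a x + th))) +
   sin (r * dot a v) * (\int[mu]_x (w x * cos (dot a x + (th - pi / 2)))))%R.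
Proof.
have icos a' th' : mu.-integrable setT (EFin \o (fun x => w x * cos (dot a' x + th'))).
  apply: (integrable_mul_bounded 1) => // [|x]; last exact: cos_max.
  by apply: continuous_measurable_rV; exact: continuous_cos_dot.
have -> : (\int[mu]_x (w (x + r *: v) * cos (dot a x + th)) =
    \int[mu]_x (w x * cos (dot a x + (th - r * dot a v))))%R.
  rewrite -(@Rintegral_rV_shift (fun x => w x * cos (dot a x + (th - r * dot a v))) (r *: v)); last first.
    exact: integrable_measurable (icos _ _).
  by apply: eq_Rintegral => x _; congr (_ * cos _); rewrite dotDr dotZr; ring.
rewrite -!RintegralZl // -RintegralD //; [|exact: integrable_realZl..].
apply: eq_Rintegral => x _; rewrite !addrA cosBpihalf cosB; ring.
Qed.

(** The sum [U] is continuous and integrable, and its transform at [a] combines that of [w] at [a]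
    with the two series in a.v. By [dichotomy], for each [a] either the former or the latter vanish,
    so Fourier uniqueness gives U = 0. *)
Lemma annihilated_series x : series (h ^~ x) @ \oo --> 0.
Proof.
have cM : cvgn (series (fun j => M * (`|c j| + `|c' j|))).
  rewrite (_ : series _ = (fun N => M * series (fun j => `|c j| + `|c' j|) N)).
    by apply: is_cvgM => //; exact: is_cvg_cst.
  by apply/funext => N; rewrite /series /= mulr_sumr.
pose U (y : V) := limn (series (h ^~ y)).
have UU y : series (h ^~ y) @ \oo --> U y := @normal_series_cvg _ _ _ _ hbound cM y.
suff U0 : forall y, U y = 0 by rewrite -(U0 x).
have cU : continuous U := continuous_normal_series ch hbound cM.
(* The sum [Om] of these terms dominates all partial sums, and it is integrable because the j-th
   term has integral ||w||_1 (|c j| + |c' j|). *)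
pose g j (y : V) := `|c j| * `|w (y + t j *: v)| + `|c' j| * `|w (y - t j *: v)|.
have g0 j y : 0 <= g j y by rewrite addr_ge0 // mulr_ge0.
have gM j y : `|g j y| <= M * (`|c j| + `|c' j|).
  by rewrite ger0_norm // mulrDr; apply: lerD; rewrite mulrC ler_wpM2r.
have cabs : continuous (fun y : V => `|w y|).
  by move=> y; apply: continuous_comp; [exact: cw|exact: norm_continuous].
have cabsz (z : V) : continuous (fun y : V => `|w (y + z)|) := continuous_rV_shift (z := z) cabs.
have cg j : continuous (g j).
  by apply: continuousTD; apply: continuousTM; try exact: cst_continuousT; exact: cabsz.
pose Om (y : V) := limn (series (g ^~ y)).
have OmE y : series (g ^~ y) @ \oo --> Om y := @normal_series_cvg _ _ _ _ gM cM y.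
have cOm : continuous Om := continuous_normal_series cg gM cM.
have inorm z : mu.-integrable setT (EFin \o (fun x => `|w (x + z)|)).
  exact: integrable_abse (ishift z).
have ig j : mu.-integrable setT (EFin \o g j).
  by apply: integrable_realD; exact: integrable_realZl.
have iOm : mu.-integrable setT (EFin \o Om).
  apply: (integrable_series ig) => //; first exact: continuous_measurable_rV.
  rewrite (_ : (fun j => _) = (fun j => (\int[mu]_x `|w x|)%R * (`|c j| + `|c' j|))); last first.
    apply/funext => j; rewrite RintegralD //; [|exact: integrable_realZl..].
    rewrite !RintegralZl // !(@Rintegral_rV_shift (fun x => `|w x|)); first by ring.
      exact: continuous_measurable_rV.
    exact: continuous_measurable_rV.
  rewrite (_ : series _ = (fun N => (\int[mu]_x `|w x|)%R * series (fun j => `|c j| + `|c' j|) N)).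
    by apply: is_cvgM => //; exact: is_cvg_cst.
  by apply/funext => N; rewrite /series /= mulr_sumr.
have hOm N y : `|series (h ^~ y) N| <= Om y.
  apply: le_trans (series_le_lim (fun j => g0 j y) (OmE y) N).
  rewrite /series /=; apply: le_trans (ler_norm_sum _ _ _) _; apply: ler_sum => j _.
  by apply: le_trans (ler_normD _ _) _; rewrite !normrM.
have mh N : measurable_fun setT (fun y => series (h ^~ y) N).
  apply: continuous_measurable_rV; rewrite /series /=.
  by apply: continuousT_sum => j; exact: ch.
have ih j : mu.-integrable setT (EFin \o h j).
  by apply: integrable_realD; exact: integrable_realZl.
have iU : mu.-integrable setT (EFin \o U).
  apply: (le_integrable_real _ _ iOm); first exact: continuous_measurable_rV.
  move=> z; apply: (@cvg_seq_le _ (fun N => `|series (h ^~ z) N|)) => //.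
  by apply: cvg_norm; exact: UU.
apply: (fourier_uniqueness cU iU) => a th.
have mcos : measurable_fun setT (fun y : V => cos (dot a y + th)).
  by apply: continuous_measurable_rV; exact: continuous_cos_dot.
have : (\int[mu]_y (series (h ^~ y) N * cos (dot a y + th)))%R @[N --> \oo]
    --> (\int[mu]_y (U y * cos (dot a y + th)))%R.
  apply: (@Rintegral_dominated _ _ _ _ _ _ Om) => //.
  - by move=> N; exact: measurable_funM.
  - by apply: measurable_funM => //; exact: continuous_measurable_rV.
  - by move=> z; apply: cvgM; [exact: UU|exact: cvg_cst].
  - move=> N z; rewrite normrM -[leRHS]mulr1.
    by apply: ler_pM => //; exact: cos_max.
suff Z : (\int[mu]_y (series (h ^~ y) N * cos (dot a y + th)))%R @[N --> \oo] --> 0.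
  by move=> H; exact: (cvg_unique _ H Z).
set A := (\int[mu]_y (w y * cos (dot a y + th)))%R.
set B := (\int[mu]_y (w y * cos (dot a y + (th - pi / 2))))%R.
(* [c] and [c'] weigh opposite translates, so c + c' goes with the cosines and c - c' with the
   sines. *)
have E : (fun N => (\int[mu]_y (series (h ^~ y) N * cos (dot a y + th)))%R) =
    (fun N => A * series (fun j => (c j + c' j) * cos (t j * dot a v)) N +
      B * series (fun j => (c j - c' j) * sin (t j * dot a v)) N).
  apply/funext => N.
  have ihc j : mu.-integrable setT (EFin \o (fun y => h j y * cos (dot a y + th))).
    by apply: (integrable_mul_bounded 1) => // y; exact: cos_max.
  transitivity (series (fun j => \int[mu]_y (h j y * cos (dot a y + th)))%R N).
    have [_ <-] := Rintegral_series ihc N.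
    by apply: eq_Rintegral => y _; rewrite /series /= mulr_suml.
  rewrite /series /= !mulr_sumr -big_split; apply: eq_bigr => j _ /=.
  have iwc z : mu.-integrable setT (EFin \o (fun y => w (y + z) * cos (dot a y + th))).
    by apply: (integrable_mul_bounded 1) => // y; exact: cos_max.
  have -> : (\int[mu]_y (h j y * cos (dot a y + th)) =
      c j * \int[mu]_y (w (y + t j *: v) * cos (dot a y + th)) +
      c' j * \int[mu]_y (w (y + (- t j) *: v) * cos (dot a y + th)))%R.
    rewrite -!RintegralZl // -RintegralD //; [|exact: integrable_realZl..].
    by apply: eq_Rintegral => y _; rewrite /h scaleNr; ring.
  rewrite !integral_shift_cos -/A -/B mulNr cosN sinN; ring.
rewrite E; have [wa|[h1 h2]] := dichotomy a.
  rewrite /A /B !wa; under eq_fun do rewrite !mul0r addr0.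
  exact: cvg_cst.
rewrite -[X in _ --> X]addr0 -[X in _ --> X + _](mulr0 A) -[X in _ --> _ + X](mulr0 B).
by apply: cvgD; apply: cvgM => //; exact: cvg_cst.
Qed.

End annihilation.

(** * The sampling inequality *)

Section sampled_bound.
Context {R : realType} {n : nat}.
Local Notation V := 'rV[R]_n.
Local Notation mu := (lebesgue_rV R n).

(** The nodes 0, rho and -s will occupy the first three indices and have to be split off. *)
Lemma series_recl3 (u : nat -> R) N :
  series u (N + 3)%N = u 0%N + u 1%N + u 2%N + series (fun j => u j.+3) N.
Proof. by rewrite addn3 /series /= !big_nat_recl //= !addrA. Qed.

Lemma cvg_series_recl3 (u : nat -> R) (l : R) :
  series (fun j => u j.+3) @ \oo --> l -> series u @ \oo --> u 0%N + u 1%N + u 2%N + l.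
Proof.
move=> h; rewrite -(cvg_shiftn 3).
rewrite (_ : (fun k => _) = (fun N => u 0%N + u 1%N + u 2%N + series (fun j => u j.+3) N)).
  by apply: cvgD => //; exact: cvg_cst.
by apply/funext => N; rewrite series_recl3.
Qed.

(** Here [w] stands for a real combination of Re f and Im f times the mollifier: integrable, with
    transform vanishing at each [a] unless |a.v| < 1. The functional is then 0 along every line of
    direction [v], and the term at [x] is isolated. *)
Lemma sampled_bound (rho s p q : R) (d e : nat -> R) (w : V -> R) (M : R) (v : V) :
  0 < rho -> 0 < s -> 0 < p -> 0 < q -> (forall j, 0 <= d j) -> (forall j, 0 <= e j) ->
  series (fun j => d j + e j) @ \oo --> (rho * s)^-1 - p * cos rho - q * cos s ->
  (forall x, `|x| < 1 ->
    series (fun j => alternate j * (d j + e j) * cos (j.+1%:R * pi * x)) @ \oo -->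
      (rho * s)^-1 - p * cos (rho * x) - q * cos (s * x) /\
    series (fun j => alternate j * (d j - e j) * sin (j.+1%:R * pi * x)) @ \oo -->
      - p * sin (rho * x) + q * sin (s * x)) ->
  continuous w -> (forall x, `|w x| <= M) -> mu.-integrable setT (EFin \o w) ->
  (forall a : V, (forall th, (\int[mu]_x (w x * cos (dot a x + th)) = 0)%R) \/
    `|dot a v| < 1) ->
  forall x, `|w x| / (rho * s) <=
    p * `|w (x + rho *: v)| + M * ((rho * s)^-1 - p * cos rho + q * (1 - cos s)).
Proof.
move=> rho0 s0 p0 q0 d0 e0 hde H cw wM iw dich x.
(* [c] weighs translates by t v and [c'] those by -t v: indices 0 and 1 are the nodes 0 and rho,
   index 2 is the node -s, and index j + 3 is the pair k pi, -k pi with k = j + 1. *)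
pose c j := match j with 0 => (rho * s)^-1 | 1 => - p | 2 => 0
  | j'.+3 => - (alternate j' * d j') end.
pose c' j := match j with 0 => 0 | 1 => 0 | 2 => - q
  | j'.+3 => - (alternate j' * e j') end.
pose t j : R := match j with 0 => 0 | 1 => rho | 2 => s | j'.+3 => j'.+1%:R * pi end.
have cc : cvgn (series (fun j => `|c j| + `|c' j|)).
  apply/cvg_ex; eexists; apply: cvg_series_recl3 => /=.
  rewrite (_ : (fun j => _) = (fun j => d j + e j)); first exact: hde.
  by apply/funext => j; rewrite !normrN !normrM !norm_alternate !mul1r !ger0_norm.
have dich' (a : V) : (forall th, (\int[mu]_x (w x * cos (dot a x + th)) = 0)%R) \/
   (series (fun j => (c j + c' j) * cos (t j * dot a v)) @ \oo --> 0 /\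
    series (fun j => (c j - c' j) * sin (t j * dot a v)) @ \oo --> 0).
  have [h|h] := dich a; [by left|right].
  have [H1 H2] := H _ h; split.
    rewrite [X in _ --> X](_ : _ = (c 0%N + c' 0%N) * cos (t 0%N * dot a v) +
      (c 1%N + c' 1%N) * cos (t 1%N * dot a v) + (c 2%N + c' 2%N) * cos (t 2%N * dot a v) +
      - ((rho * s)^-1 - p * cos (rho * dot a v) - q * cos (s * dot a v))).
      apply: cvg_series_recl3 => /=.
      rewrite (_ : series _ = (fun N => - series (fun j => alternate j * (d j + e j) *
        cos (j.+1%:R * pi * dot a v)) N)); first exact: cvgN.
      by apply/funext => N; rewrite /series /= -sumrN; apply: eq_bigr => j _; ring.
    by rewrite /= mul0r cos0; ring.
  rewrite [X in _ --> X](_ : _ = (c 0%N - c' 0%N) * sin (t 0%N * dot a v) +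
    (c 1%N - c' 1%N) * sin (t 1%N * dot a v) + (c 2%N - c' 2%N) * sin (t 2%N * dot a v) +
    - (- p * sin (rho * dot a v) + q * sin (s * dot a v))).
    apply: cvg_series_recl3 => /=.
    rewrite (_ : series _ = (fun N => - series (fun j => alternate j * (d j - e j) *
      sin (j.+1%:R * pi * dot a v)) N)); first exact: cvgN.
    by apply/funext => N; rewrite /series /= -sumrN; apply: eq_bigr => j _; ring.
  by rewrite /= mul0r sin0; ring.
have A := annihilated_series cw wM iw cc dich' x.
set h := (fun j => _) in A.
pose B := p * `|w (x + rho *: v)| + M * ((rho * s)^-1 - p * cos rho + q * (1 - cos s)).
have bnd N : `|w x| / (rho * s) - B <= `|series h (N + 3)%N|.
  have sde : series (fun j => d j + e j) N <= (rho * s)^-1 - p * cos rho - q * cos s.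
    by apply: series_le_lim hde _ => j; rewrite addr_ge0.
  have M0 : 0 <= M by apply: le_trans (wM x).
  set Z := series (fun j => h j.+3) N.
  have hZ : `|Z| <= M * ((rho * s)^-1 - p * cos rho - q * cos s).
    apply: le_trans (ler_wpM2l M0 sde); rewrite /Z /series /= mulr_sumr.
    apply: le_trans (ler_norm_sum _ _ _) _; apply: ler_sum => j _; rewrite /h /=.
    apply: le_trans (ler_normD _ _) _.
    rewrite !normrM !normrN !normrM !norm_alternate !mul1r (ger0_norm (d0 j)) (ger0_norm (e0 j)) [leRHS]mulrDr.
    by apply: lerD; rewrite mulrC ler_wpM2r.
  have qM : `|q * w (x - s *: v)| <= q * M.
    by rewrite normrM gtr0_norm // ler_pM2l.
  rewrite series_recl3 -/Z /h /= !scale0r.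
  set w1 := w (x + rho *: v); set w2 := w (x - s *: v) in qM *.
  have -> : `|w x| / (rho * s) = `|(rho * s)^-1 * w x|.
    by rewrite normrM mulrC gtr0_norm // invr_gt0 mulr_gt0.
  rewrite addr0 !mul0r !addr0 add0r.
  set X := (rho * s)^-1 * w x.
  have -> : X + - p * w1 + - q * w2 + Z = X - (p * w1 + q * w2 - Z) by ring.
  rewrite lerBlDr; apply: (@le_trans _ _ (`|X - (p * w1 + q * w2 - Z)| + `|p * w1 + q * w2 - Z|)).
    by rewrite -{1}(subrK (p * w1 + q * w2 - Z) X) ler_normD.
  rewrite lerD2l /B.
  apply: (@le_trans _ _ (`|p * w1| + `|q * w2| + `|Z|)).
    by apply: le_trans (ler_normB _ _) _; rewrite lerD2r ler_normD.
  rewrite [`|p * w1|]normrM (gtr0_norm p0) -/w1.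
  rewrite (_ : M * ((rho * s)^-1 - p * cos rho + q * (1 - cos s)) =
    q * M + M * ((rho * s)^-1 - p * cos rho - q * cos s)); last by ring.
  by rewrite -addrA lerD2l lerD.
rewrite -[leRHS]/B -subr_le0.
have A3 : (fun N => `|series h (N + 3)%N|) @ \oo --> (0 : R).
  rewrite -(@normr0 _ R); apply: (@cvg_norm _ R).
  by move: A; rewrite -(cvg_shiftn 3).
rewrite -[leLHS]subr0.
apply: (@cvg_seq_le _ (fun N => (`|w x| / (rho * s) - B) - `|series h (N + 3)%N|)).
  by apply: cvgB => //; exact: cvg_cst.
by move=> N; rewrite subr_le0.
Qed.

End sampled_bound.

Section real_and_imaginary_parts.
Context {R : realType}.

Lemma sqr_normc (z : R[i]) : Normc.normc z ^+ 2 = complex.Re z ^+ 2 + complex.Im z ^+ 2.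
Proof. by case: z => a b /=; rewrite sqr_sqrtr // addr_ge0 // sqr_ge0. Qed.

Lemma normc_ge0 (z : R[i]) : 0 <= Normc.normc z.
Proof. by case: z => a b /=; exact: sqrtr_ge0. Qed.

(** Cauchy-Schwarz. The modulus is the largest of these real combinations, which lets real-valued
    results be applied to complex functions. *)
Lemma normc_ge_combination (al be : R) (z : R[i]) : al ^+ 2 + be ^+ 2 <= 1 ->
  `|al * complex.Re z + be * complex.Im z| <= Normc.normc z.
Proof.
move=> h; rewrite -(@ler_pXn2r _ 2) ?nnegrE ?normr_ge0 ?normc_ge0 //.
rewrite real_normK ?num_real // sqr_normc; move: (complex.Re z) (complex.Im z) => a b.
have h1 : 0 <= (al * b - be * a) ^+ 2 by exact: sqr_ge0.
have h2 : (al ^+ 2 + be ^+ 2) * (a ^+ 2 + b ^+ 2) <= a ^+ 2 + b ^+ 2.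
  by rewrite ler_piMl // addr_ge0 // sqr_ge0.
apply: le_trans h2; rewrite -subr_ge0.
by rewrite (_ : _ - _ = (al * b - be * a) ^+ 2) //; ring.
Qed.

Lemma normc_combination (z : R[i]) : exists al be : R, al ^+ 2 + be ^+ 2 <= 1 /\
  al * complex.Re z + be * complex.Im z = Normc.normc z.
Proof.
(* At z = 0 the inverse of 0 is 0 and both coefficients are 0, which is why the condition is [<= 1]
   and not an equality. *)
set N := Normc.normc z; exists (complex.Re z / N), (complex.Im z / N).
rewrite !exprMn -mulrDl -sqr_normc -/N; have [->|N0] := eqVneq N 0.
  by rewrite expr0n /= mul0r ler01 invr0 !mulr0 !mul0r addr0.
split; first by rewrite -exprMn divff // expr1n.
rewrite [LHS](_ : _ = (complex.Re z ^+ 2 + complex.Im z ^+ 2) / N); last by ring.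
by rewrite -sqr_normc -/N expr2 mulfK.
Qed.

Lemma continuous_combination (T : topologicalType) (f : T -> R[i]) (al be : R) :
  continuous (f : T -> R[i]^o) -> al ^+ 2 + be ^+ 2 <= 1 ->
  continuous (fun x => al * complex.Re (f x) + be * complex.Im (f x)).
Proof.
move=> cf h x; apply/cvgrPdist_lt => /= e e0.
have e0' : 0 < e%:C%C by rewrite ltcR.
have /cvgrPdist_lt/(_ _ e0') := cf x.
apply: filterS => y; rewrite normc_def ltcR /=; apply: le_lt_trans.
have := normc_ge_combination (f x - f y) h.
case: (f x) => a b; case: (f y) => a' b' /=; apply: le_trans.
by rewrite le_eqVlt; apply/orP; left; apply/eqP; congr `|_|; ring.
Qed.

End real_and_imaginary_parts.

Section bernstein_bound.
Context {R : realType} {n : nat}.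
Local Notation V := 'rV[R]_n.
Local Notation mu := (lebesgue_rV R n).

Section annihilation.
Variables (f : V -> R[i]) (m : V -> R) (M : R) (a : V).
Hypotheses (cf : continuous (f : V -> R[i]^o)) (fM : forall x, Normc.normc (f x) <= M).
Hypothesis (im : mu.-integrable setT (EFin \o m)).
Hypothesis Zp : integral_rV (fun x => f x * (expi (- dot a x) * (m x)%:C%C)) = 0.
Hypothesis Zn : integral_rV (fun x => f x * (expi (- dot (- a) x) * (m x)%:C%C)) = 0.

Let combM (al be : R) : al ^+ 2 + be ^+ 2 <= 1 ->
  forall x, `|al * complex.Re (f x) + be * complex.Im (f x)| <= M.
Proof. by move=> h x; apply: le_trans (fM x); exact: normc_ge_combination. Qed.

Lemma integrable_combination (al be : R) : al ^+ 2 + be ^+ 2 <= 1 ->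
  mu.-integrable setT (EFin \o (fun x => (al * complex.Re (f x) + be * complex.Im (f x)) * m x)).
Proof.
move=> h; rewrite (_ : _ \o _ =
    EFin \o (fun x => m x * (al * complex.Re (f x) + be * complex.Im (f x)))).
  apply: (integrable_mul_bounded M) => //; last exact: combM.
  by apply: continuous_measurable_rV; exact: continuous_combination.
by apply/funext => x /=; rewrite mulrC.
Qed.

(** For complex [f], vanishing at [a] alone does not separate the real and imaginary parts. Adding
    and subtracting the equations at [a] and [- a] kills the cosine and the sine integral of each
    part. *)
Lemma annihilated_combination (al be th : R) :
  (\int[mu]_x ((al * complex.Re (f x) + be * complex.Im (f x)) * m x * cos (dot a x + th)) = 0)%R.
Proof.
pose F (x : V) := complex.Re (f x) * m x; pose G (x : V) := complex.Im (f x) * m x.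
have iF : mu.-integrable setT (EFin \o F).
  rewrite (_ : F = (fun x => (1 * complex.Re (f x) + 0 * complex.Im (f x)) * m x)).
    by apply: integrable_combination; rewrite expr1n expr0n addr0.
  by apply/funext => x; rewrite mul1r mul0r addr0.
have iG : mu.-integrable setT (EFin \o G).
  rewrite (_ : G = (fun x => (0 * complex.Re (f x) + 1 * complex.Im (f x)) * m x)).
    by apply: integrable_combination; rewrite expr1n expr0n add0r.
  by apply/funext => x; rewrite mul1r mul0r add0r.
have icos (u : V -> R) t : mu.-integrable setT (EFin \o u) ->
    mu.-integrable setT (EFin \o (fun x => u x * cos (dot a x + t))).
  move=> iu; apply: (integrable_mul_bounded 1) => // [|x]; last exact: cos_max.
  by apply: continuous_measurable_rV; exact: continuous_cos_dot.
pose I (u : V -> R) t := (\int[mu]_x (u x * cos (dot a x + t)))%R.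
have ID t (u1 u2 : V -> R) t' (r : R) : mu.-integrable setT (EFin \o u1) ->
    mu.-integrable setT (EFin \o u2) ->
    (\int[mu]_x (u1 x * cos (dot a x + t) + r * (u2 x * cos (dot a x + t'))))%R =
    I u1 t + r * I u2 t'.
  move=> i1 i2; rewrite RintegralD //; [|exact: icos|apply: integrable_realZl; exact: icos].
  by rewrite RintegralZl //; exact: icos.
have sinE x : sin (dot a x) = cos (dot a x + - (pi / 2)) by rewrite cosBpihalf.
have [E1 E2] : I F 0 + 1 * I G (- (pi / 2)) = 0 /\ I G 0 + -1 * I F (- (pi / 2)) = 0.
  case: Zp => Z1 Z2; split; rewrite -ID //.
    rewrite -[RHS]Z1; apply: eq_Rintegral => x _; rewrite -sinE addr0 /F /G /expi cosN sinN.
    by case: (f x) => ? ? /=; ring.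
  rewrite -[RHS]Z2; apply: eq_Rintegral => x _; rewrite -sinE addr0 /F /G /expi cosN sinN.
  by case: (f x) => ? ? /=; ring.
have [E3 E4] : I F 0 + -1 * I G (- (pi / 2)) = 0 /\ I G 0 + 1 * I F (- (pi / 2)) = 0.
  case: Zn => Z1 Z2; split; rewrite -ID //.
    rewrite -[RHS]Z1; apply: eq_Rintegral => x _; rewrite -sinE addr0 /F /G /expi dotNl opprK.
    by case: (f x) => ? ? /=; ring.
  rewrite -[RHS]Z2; apply: eq_Rintegral => x _; rewrite -sinE addr0 /F /G /expi dotNl opprK.
  by case: (f x) => ? ? /=; ring.
have IE u : mu.-integrable setT (EFin \o u) -> I u 0 = 0 -> I u (- (pi / 2)) = 0 -> I u th = 0.
  move=> iu u1 u2; rewrite /I.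
  transitivity (\int[mu]_x (cos th * (u x * cos (dot a x + 0)) +
     (- sin th) * (u x * cos (dot a x + - (pi / 2)))))%R.
    by apply: eq_Rintegral => x _; rewrite addr0 -sinE cosD; ring.
  rewrite RintegralD //; [|by apply: integrable_realZl; exact: icos..].
  rewrite !RintegralZl //; [|exact: icos..].
  by rewrite -/(I u 0) u1 -/(I u (- (pi / 2))) u2 !mulr0 addr0.
have F0 : I F th = 0 by apply: IE => //; lra.
have G0 : I G th = 0 by apply: IE => //; lra.
transitivity (\int[mu]_x (al * (F x * cos (dot a x + th)) + be * (G x * cos (dot a x + th))))%R.
  by apply: eq_Rintegral => x _; rewrite /F /G; ring.
rewrite RintegralD //; [|by apply: integrable_realZl; exact: icos..].
rewrite !RintegralZl //; [|exact: icos..].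
by rewrite -/(I F th) F0 -/(I G th) G0 !mulr0 addr0.
Qed.

End annihilation.

End bernstein_bound.

Section bernstein_inequality.
Context {R : realType} {n : nat}.
Local Notation V := 'rV[R]_n.
Local Notation mu := (lebesgue_rV R n).

(** Serves twice: for the size of the bump and for [s] tending to 0. *)
Lemma le_linear_perturbation (A B C e0 : R) : 0 < e0 ->
  (forall e, 0 < e -> e <= e0 -> A <= B + C * e) -> A <= B.
Proof.
move=> e00 H; apply/ler_addgt0Pr => e e_gt0.
have C1 : 0 < `|C| + 1 by rewrite ltr_wpDl.
pose d := Num.min e0 (e / (`|C| + 1)).
have d0 : 0 < d by rewrite lt_min e00 divr_gt0.
have dle : d <= e / (`|C| + 1) by rewrite ge_min lexx orbT.
have := H d d0; rewrite ge_min lexx => /(_ isT) /le_trans; apply; rewrite lerD2l.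
apply: le_trans (_ : (`|C| + 1) * d <= _); last by rewrite mulrC -ler_pdivlMr.
by rewrite ler_pM2r //; apply: le_trans (ler_norm C) _; rewrite lerDl.
Qed.

Variables (K : set V) (f : V -> R[i]) (M : R).
Hypotheses (KN : [set - x | x in K] = K) (fB : bernstein K f).
Hypothesis fM : forall x, Normc.normc (f x) <= M.
Variables (rho s p q : R) (d e : nat -> R).
Hypotheses (rho0 : 0 < rho) (s0 : 0 < s) (p0 : 0 < p) (q0 : 0 < q).
Hypotheses (d0 : forall j, 0 <= d j) (e0 : forall j, 0 <= e j).
Hypothesis hde :
  series (fun j => d j + e j) @ \oo --> (rho * s)^-1 - p * cos rho - q * cos s.
Hypothesis hcs : forall x, `|x| < 1 ->
  series (fun j => alternate j * (d j + e j) * cos (j.+1%:R * pi * x)) @ \oo -->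
    (rho * s)^-1 - p * cos (rho * x) - q * cos (s * x) /\
  series (fun j => alternate j * (d j - e j) * sin (j.+1%:R * pi * x)) @ \oo -->
    - p * sin (rho * x) + q * sin (s * x).

Let B := M * ((rho * s)^-1 - p * cos rho + q * (1 - cos s)).

Lemma eball_opp_disjoint (a : V) (r : R) :
  eball a r `&` K = set0 -> eball (- a) r `&` K = set0.
Proof.
rewrite -!subset0 => H t [/= ta Kt]; apply: (H (- t)); split.
  by rewrite /eball /= -enormN opprD !opprK; move: ta; rewrite /eball /= opprK.
by rewrite -KN; exists t.
Qed.

(** The factor [tau] pays for two things: the functional requires |x| < 1 strictly, and the
    mollified function has its spectrum near [K] rather than in [K]. *)
Lemma contracted_bound (al be tau : R) (y x : V) : al ^+ 2 + be ^+ 2 <= 1 ->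
  (forall t, K t -> `|dot t y| <= 1) -> 0 <= tau < 1 ->
  let g z := al * complex.Re (f z) + be * complex.Im (f z) in
  (`|g x| / (rho * s) <= p * `|g (x + rho *: (tau *: y))| + B : Prop).
Proof.
move=> h1 yK tau01 g; case/andP: tau01 => tau0 tau1; have [cf _ sf] := fB.
have cg : continuous g by exact: continuous_combination.
have gM z : `|g z| <= M by apply: le_trans (fM z); exact: normc_ge_combination.
pose S := \sum_i `|y ord0 i|.
have S0 : 0 <= S by exact: sumr_ge0.
have N0 : 0 < 2 * (n.+1%:R * (S + 1)) :> R by rewrite !mulr_gt0 // ltr_wpDl.
(* With this size, a frequency within (n + 1) eps of [K] pairs with [y] to at most 1 + (1 - tau)/2.
   The 1 added to [S] keeps the denominator positive at y = 0. *)
pose e1 := (1 - tau) / (2 * (n.+1%:R * (S + 1))).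
have e10 : 0 < e1 by rewrite divr_gt0 // subr_gt0.
have X0 : 0 < rho * s by rewrite mulr_gt0.
(* The error comes from the mollifier at [x], which is within eps times the sum of the |x_i| of 1;
   at x + rho tau y only |m| <= 1 is used. *)
apply: (@le_linear_perturbation _ _ (`|g x| / (rho * s) * \sum_i `|x ord0 i|) e1) => // eps eps0 epse.
have [D [dD D_out D_ge0 D_even D_int]] := exists_bump eps0.
pose m := @mollifier R D n.
have m1 z : `|m z| <= 1 by exact: (mollifier_le1 dD D_out D_ge0 D_int).
have mnear z : `|m z - 1| <= eps * \sum_i `|z ord0 i|.
  exact: (mollifier_near1 dD D_out D_ge0 D_int).
have cm : continuous m by exact: (continuous_mollifier eps0 dD D_out D_ge0 D_int).
have im : mu.-integrable setT (EFin \o m).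
  exact: (integrable_mollifier eps0 dD D_out D_ge0 D_int).
have iw : mu.-integrable setT (EFin \o (fun z => g z * m z)).
  exact: (integrable_combination cf fM).
have cw : continuous (fun z => g z * m z) by exact: continuousTM.
have wM z : `|g z * m z| <= M.
  by rewrite normrM -[leRHS]mulr1; apply: ler_pM.
have dich (a : V) : (forall th, (\int[mu]_x (g x * m x * cos (dot a x + th)) = 0)%R) \/
    `|dot a (tau *: y)| < 1.
  have [E|/eqP/set0P[t [/= ta Kt]]] := pselect (eball a (n.+1%:R * eps) `&` K = set0).
    left => th.
    have Zp := spectrum_mollified eps0 dD D_out D_even sf E.
    have Zn := spectrum_mollified eps0 dD D_out D_even sf (eball_opp_disjoint E).
    exact: (annihilated_combination cf fM im Zp Zn).
  right; rewrite dotZr normrM (ger0_norm tau0).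
  have ay : `|dot a y| <= 1 + (n.+1%:R * eps) * S.
    have -> : dot a y = dot t y - dot (t - a) y.
      by rewrite dotC [dot t y]dotC [dot (t - a) y]dotC dotDr dotNr; ring.
    apply: le_trans (ler_normB _ _) _; apply: lerD; first exact: yK.
    apply: le_trans (dot_le_enorm _ _) _; apply: ler_wpM2r => //; exact: ltW.
  have k1 : n.+1%:R * eps * S <= (1 - tau) / 2.
    apply: (@le_trans _ _ (n.+1%:R * e1 * (S + 1))).
      by apply: ler_pM; rewrite ?mulr_ge0 ?lerDl ?(ltW eps0) // ler_pM2l.
    rewrite /e1 le_eqVlt; apply/orP; left; apply/eqP; field.
    by rewrite nat1r pnatr_eq0 andbT gt_eqF // ltr_wpDl.
  have ay' : `|dot a y| <= 1 + (1 - tau) / 2 by apply: le_trans ay _; rewrite lerD2l.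
  apply: le_lt_trans (ler_wpM2l tau0 ay') _.
  (* This product is 2 (1 - tau (1 + (1 - tau)/2)), so its positivity is the strict bound wanted. *)
  have : 0 < (1 - tau) * (2 - tau) by rewrite mulr_gt0; lra.
  by rewrite mulrDr; nra.
have := sampled_bound rho0 s0 p0 q0 d0 e0 hde hcs cw wM iw dich x.
rewrite -/B; set z := x + _ => main.
have gz : p * `|g z * m z| <= p * `|g z|.
  by rewrite ler_pM2l // normrM -[leRHS]mulr1; apply: ler_pM.
have mx : 1 - eps * \sum_i `|x ord0 i| <= `|m x|.
  have := mnear x; rewrite distrC => h2.
  have := ler_normD (m x) (1 - m x); rewrite addrC subrK normr1.
  by move: h2; lra.
move: main; rewrite normrM -[leLHS]mulrA [`|m x| / _]mulrC mulrA => main.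
have := ler_wpM2l (divr_ge0 (normr_ge0 (g x)) (ltW X0)) mx.
rewrite mulrBr mulr1; lra.
Qed.

(** One real combination of Re f and Im f reaches |f| at [x] and is at most |f| elsewhere; [tau]
    then tends to 1 by continuity. *)
Lemma translate_bound (y x : V) : (forall t, K t -> `|dot t y| <= 1) ->
  Normc.normc (f x) / (rho * s) <= p * Normc.normc (f (x + rho *: y)) + B.
Proof.
move=> yK; have [al [be [h1 <-]]] := normc_combination (f x).
have [cf _ _] := fB.
pose g z := al * complex.Re (f z) + be * complex.Im (f z).
have cg : continuous g by exact: continuous_combination.
have X0 : 0 < rho * s by rewrite mulr_gt0.
apply: (@le_trans _ _ (p * `|g (x + rho *: y)| + B)); last first.
  by rewrite lerD2r ler_pM2l // normc_ge_combination.
apply: (@le_trans _ _ (`|g x| / (rho * s))).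
  by rewrite ler_pM2r ?invr_gt0 // ler_norm.
rewrite -lerBlDr -lerN2.
pose tau k : R := 1 - k.+1%:R^-1.
have tau1 : tau k @[k --> \oo] --> (1 : R).
  by rewrite -[X in _ --> X]subr0; apply: cvgB; [exact: cvg_cst|exact: cvg_harmonic].
have gtau : g (x + rho *: (tau k *: y)) @[k --> \oo] --> g (x + rho *: y).
  apply: (@cvg_comp _ _ _ (fun k => x + rho *: (tau k *: y)) g); last exact: cg.
  apply: (@cvg_rV R n nat) => i; rewrite !mxE.
  rewrite (_ : (fun k => _) = (fun k => x ord0 i + rho * (tau k * y ord0 i))).
    apply: cvgD; first exact: cvg_cst.
    rewrite -[y ord0 i]mul1r; apply: cvgM; first exact: cvg_cst.
    by rewrite mul1r -[X in _ --> X]mul1r; apply: cvgM => //; exact: cvg_cst.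
  by apply/funext => k; rewrite !mxE.
have gp : p * `|g (x + rho *: (tau k *: y))| @[k --> \oo] --> p * `|g (x + rho *: y)|.
  by apply: cvgM; [exact: cvg_cst|apply: (@cvg_norm _ R)].
apply: (@cvg_seq_le _ (fun k => - (p * `|g (x + rho *: (tau k *: y))|))); first exact: cvgN.
move=> k; rewrite lerN2 lerBlDr.
apply: contracted_bound => //; rewrite /tau subr_ge0 invf_le1 // ler1n /=.
by rewrite ltrBlDr ltrDl invr_gt0.
Qed.

End bernstein_inequality.

Lemma cos_gt0_acute (R : realType) (x : R) : 0 <= x -> x < pi / 2 -> 0 < cos x.
Proof.
move=> x0 xpi; apply: cos_gt0_pihalf; rewrite xpi andbT (lt_le_trans _ x0) //.
by rewrite oppr_lt0 divr_gt0 // pi_gt0.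
Qed.

Lemma cover_bound (R : realType) (n : nat) (K Lambda : set 'rV[R]_n) (rho : R)
    (f : 'rV[R]_n -> R[i]) :
  [set - x | x in K] = K -> 0 <= rho -> rho < pi / 2 ->
  minkowski_sum Lambda (dilate rho (polar K)) = setT -> bernstein K f ->
  supmod setT f <= (cos rho)^-1 * supmod Lambda f.
Proof.
move=> KN rho_ge0 rho_lt cover fB; have [_ [M0 fM0] _] := fB.
have cosrho : 0 < cos rho by exact: cos_gt0_acute.
rewrite ler_pdivlMl //; set M := supmod setT f; set m := supmod Lambda f.
have fM x : Normc.normc (f x) <= M.
  by apply: ub_le_sup; [exists M0 => _ [z _ <-]; exact: fM0|exists x].
have fm l : Lambda l -> Normc.normc (f l) <= m.
  by move=> Ll; apply: ub_le_sup; [exists M0 => _ [z _ <-]; exact: fM0|exists l].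
have Mle c : (forall x, Normc.normc (f x) <= c) -> M <= c.
  move=> h; apply: ge_sup; first by exists (Normc.normc (f 0)), 0.
  by move=> _ [x _ <-]; exact: h.
have M_ge0 : 0 <= M := le_trans (normc_ge0 _) (fM 0).
have near_sample x : exists2 y, forall t, K t -> `|dot t y| <= 1 & Lambda (x + rho *: y).
  have [l Ll [_ [k Kk <-] E]] : minkowski_sum Lambda (dilate rho (polar K)) x by rewrite cover.
  (* From x = l + rho k, the displacement to the sample is -rho k; the symmetry of [K] makes the
     polar inequality two-sided. *)
  exists (- k); last by rewrite -E scalerN addrK.
  move=> t Kt; rewrite dotNr normrN ler_norml dotC Kk // andbT.
  by rewrite lerNl -dotNr Kk // -KN; exists t.
(* The functional divides by rho; for rho = 0 every point is a sample. *)
have [rho0|rho_neq0] := eqVneq rho 0.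
  rewrite rho0 cos0 mul1r; apply: Mle => x.
  by have [y _] := near_sample x; rewrite rho0 scale0r addr0; exact: fm.
have rho_gt0 : 0 < rho by rewrite lt_neqAle eq_sym rho_neq0.
(* The loss will be [M * s]; any s <= 1/2 is below pi/2 and small enough for [cos_small]. *)
rewrite mulrC; apply: (@le_linear_perturbation _ _ _ M (2^-1)) => // s s_gt0 s_le.
have s_lt : s < pi / 2 by apply: le_lt_trans s_le _; have := @pi_ge2 R; lra.
have rhoI : 0 < rho < pi / 2 by rewrite rho_gt0.
have sI : 0 < s < pi / 2 by rewrite s_gt0.
have [p [q [d [e [p0 q0 pq [d0 e0] [hde hcs]]]]]] := extremal_functional rhoI sI.
have rs0 : 0 < rho * s by rewrite mulr_gt0.
have main : M / (rho * s) <= p * m + M * ((rho * s)^-1 - p * cos rho + q * (1 - cos s)).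
  rewrite ler_pdivrMr //; apply: Mle => x; rewrite -ler_pdivrMr //.
  have [y yK Ly] := near_sample x.
  apply: le_trans (translate_bound KN fB fM rho_gt0 s_gt0 p0 q0 d0 e0 hde hcs x yK) _.
  by rewrite lerD2r ler_pM2l //; exact: fm.
(* For such [s], 1 - cos s <= s^2/2 <= s (s - s^3/6) <= s sin s. *)
have cos_small : 1 - cos s <= s * sin s.
  have h1 := cos_ge s; have h2 := ler_wpM2l (ltW s_gt0) (sin_ge (ltW s_gt0)).
  have : 0 <= s ^+ 2 * (4^-1 - s ^+ 2) by rewrite mulr_ge0 ?sqr_ge0 // subr_ge0; nra.
  by move: h1 h2; rewrite mulrBr; nra.
(* As q sin s = p sin rho <= p, the loss at the node -s is at most p s, small against the main term
   p cos rho. *)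
have qs : q * (1 - cos s) <= p * s.
  apply: le_trans (ler_wpM2l (ltW q0) cos_small) _.
  rewrite mulrCA -pq mulrCA ler_pM2l // -[leRHS]mulr1 ler_pM2l //; exact: sin_le1.
have := ler_wpM2l M_ge0 qs; move: main; rewrite mulrDr mulrBr => h1 h2.
by rewrite -(ler_pM2l p0); lra.
Qed.

Theorem theorem3 (R : realType) (n : nat) (n_gt0 : (0 < n)%N)
    (K : set 'rV[R]_n) (K_body : symmetric_convex_body K)
    (K_pos : (0 < lebesgue_rV R n K)%E)
    (Lambda : set 'rV[R]_n) (rho : R) (rho_ge0 : 0 <= rho)
    (rho_lt : rho < pi / 2)
    (cover : minkowski_sum Lambda (dilate rho (polar K)) = setT) :
  (forall f : 'rV[R]_n -> R[i], bernstein K f ->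
     supmod setT f <= (cos rho)^-1 * supmod Lambda f) /\
  sampling_set K Lambda.
Proof.
have [_ _ _ KN] := K_body.
have bound := cover_bound KN rho_ge0 rho_lt cover.
split; first exact: bound.
exists (cos rho)^-1; split; last exact: bound.
by rewrite invr_gt0 cos_gt0_acute.
Qed.
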